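(* Let the upcoming gas be a Chaplygin gas with Mach number $M_\infty$. Let $w_\rho, u^t, w$ be real-valued $C^1$ functions on $C$ (i.e. $L$-periodic functions of the arc-length $s$, $L=2\pi\sin\theta_0$), with $w_\rho\ge0$, solving on $C$ the system \begin{align*} &(w_\rho (u^t)^2)'+3w_\rho u^t w=\rho_0(u_0,\mathbf n)(u_0,\mathbf t),\\ &(w_\rho u^t w)'-w_\rho (u^t)^2+2w_\rho w^2=\rho_0 w_0(u_0,\mathbf n),\\ &(w_\rho u^t)'+2w_\rho w=\rho_0(u_0,\mathbf n), \end{align*} where $'=\mathrm d/\mathrm ds$ and $u_0,w_0$ are evaluated on $C$. Suppose that the denominator below is positive for every $\phi\in[-\pi,\pi]$ and $$M_\infty>\sup_{\phi\in[-\pi,\pi]}\left(\frac{1}{(\cos\alpha_0\sin\theta_0-\sin\alpha_0\cos\theta_0\cos\phi)^2-w_\rho(u^t)^2(s(\phi))\cot\theta_0}\right)^{1/2},$$ where $s(\phi)$ is the arc-length parameter of the point of $C$ with azimuth $\phi$. Then Problem A (for Chaplygin gas) admits a Radon measure solution given by $$\varrho=\rho_0\mathbb I_\Omega\,\mathrm d\mathcal H^2+w_\rho(s)\delta_C,\quad u=u_0\mathbb I_\Omega+u^t(s)\mathbf t\,\mathbb I_C,\quad w=w_0\mathbb I_\Omega+w(s)\mathbb I_C,\quad E=E_0\mathbb I_\Omega+E_0\mathbb I_C.$$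
   Context: **Geometry.** On $\mathbb R^3$ use $x^1=r\cos\theta$, $x^2=r\sin\theta\cos\phi$, $x^3=r\sin\theta\sin\phi$, with $\theta\in[0,\pi]$, $\phi\in[-\pi,\pi]$. A straight cone with vertex $O$, symmetric about the $x^1$-axis, has semi-vertex angle $\theta_0\in(0,\pi/2)$; it meets the unit sphere $S^2$ in $Con=\{\theta\le\theta_0\}$. Let $\Omega=S^2\setminus Con$, $C=\partial\Omega=\{\theta=\theta_0\}$, a circle of length $L=2\pi\sin\theta_0$ with arc-length parameter $s$, $\mathrm ds/\mathrm d\phi=\sin\theta_0$. On $C$, $\mathbf t(s)$ is the unit tangent vector in the direction of increasing $s$, and $\mathbf n(s)$ is the unit normal, tangent to $S^2$, pointing out of $\Omega$. $(\cdot,\cdot)$, $\mathrm D$, $\nabla$, $\mathrm{div}$ are the metric, Levi-Civita connection, gradient and divergence of $S^2$; $\mathcal H^2$ is the standard Hausdorff (area) measure on $S^2$; $\mathbb I_A$ is the indicator function of $A$. **Upcoming flow.** $\rho_0=1$, $E_0\ge\frac12$ constant, and $V_0\in S^2$ the constant unit velocity with attack angle $\alpha_0$, $V_0=(\cos\alpha_0,\sin\alpha_0,0)$. Restricted to $S^2$, $V_0=u_0+w_0\vec{\partial_r}$ with $u_0$ tangent to $S^2$ and $w_0=(V_0,\vec{\partial_r})$. On $C$, $(u_0,\mathbf n)=\cos\alpha_0\sin\theta_0-\sin\alpha_0\cos\theta_0\cos\phi$ and $w_0=\cos\alpha_0\cos\theta_0+\sin\alpha_0\sin\theta_0\cos\phi$.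 **Chaplygin gas.** The state equation is $p=-A/\rho$ with $A>0$, and $E=E_0$ is a given constant in the whole flow field; after non-dimensionalization $p=-1/(M_\infty^2\rho)$, so the upstream pressure is $p_0=\tilde p(\rho_0,E_0)=-\frac{1}{\rho_0M_\infty^2}=-\frac1{M_\infty^2}$, where $M_\infty$ is the Mach number of the upcoming flow. **Problem A.** Find a solution (density $\rho$, tangential velocity $u$, radial velocity $w$, total enthalpy $E$) on $\Omega$ of $$\mathrm{div}(\rho u)+2\rho w=0,\quad \mathrm{div}(\rho uE)+2\rho wE=0,\quad \mathrm{div}(\rho wu)+2\rho w^2-\rho|u|^2=0,\quad \mathrm{div}(\rho u\otimes u)+3\rho wu+\mathrm{grad}\,p=0,$$ with the upcoming flow $(\rho_0,V_0,E_0)$, where $\rho_0=1$, $V_0=(\cos\alpha_0,\sin\alpha_0,0)=u_0+w_0\vec{\partial_r}$ and $E_0\ge\frac12$ is constant, the Chaplygin state equation $p=-1/(M_\infty^2\rho)$ with $E=E_0$ in the whole flow field, and the slip condition $(u,\mathbf n)=0$ on $C$. **Dirac measure.** For integrable $W$ on $C$, $\langle W\delta_C,\psi\rangle=\int_0^L W(s)\,\psi|_C\,\mathrm ds$. **Radon measure solution.** $(\varrho,u,w,E)$ is a Radon measure solution to Problem A if there are (scalar-, vector- or tensor-valued, as appropriate) Radon measures $m_a,n_a,m_e,n_e,m_r,n_r,m_t,n_t,\varrho,\wp$ on $\overline\Omega$ and a positive integrable function $W_C(s)$, $s\in[0,L]$, such that: (i) for every $\psi\in C^1(S^2)$ and every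 $C^1$ tangent vector field $v$ on $S^2$, $$\langle m_a,\nabla\psi\rangle=2\langle n_a,\psi\rangle,\quad \langle m_e,\nabla\psi\rangle=2\langle n_e,\psi\rangle,\quad \langle m_r,\nabla\psi\rangle=2\langle n_r,\psi\rangle-\langle n_t,\psi\rangle,$$ $$\langle m_t,\mathrm Dv\rangle+\langle\wp,\mathrm{div}\,v\rangle=3\langle m_r,v\rangle+\langle W_C\mathbf n\,\delta_C,v\rangle;$$ (ii) $\varrho$ is non-negative (for Chaplygin gas the pressure measure $\wp$ is negative, and no sign is imposed on it); $m_a,m_e,m_r,m_t,n_a,n_e,n_r,n_t,\wp$ are absolutely continuous with respect to $\varrho$; and the $\varrho$-a.e. defined functions $w,E$ and vector field $u$ satisfy $$w=\frac{\mathrm dn_a}{\mathrm d\varrho}=\frac{\mathrm dm_r/\mathrm d\varrho}{\mathrm dm_a/\mathrm d\varrho}=\frac{\mathrm dn_r/\mathrm d\varrho}{\mathrm dn_a/\mathrm d\varrho},\quad E=\frac{\mathrm dm_e/\mathrm d\varrho}{\mathrm dm_a/\mathrm d\varrho}=\frac{\mathrm dn_e/\mathrm d\varrho}{\mathrm dn_a/\mathrm d\varrho},\quad u=\frac{\mathrm dm_a}{\mathrm d\varrho},\ |u|^2=\frac{\mathrm dn_t}{\mathrm d\varrho},\ u\otimes u=\frac{\mathrm dm_t}{\mathrm d\varrho},$$ a quotient identity $a=b/c$ being understood as $b=ac$ (so $\mathrm dm_r/\mathrm d\varrho=w\,\mathrm dm_a/\mathrm d\varrho$, etc.); (iii) if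 $\varrho,\wp\ll\mathcal H^2$, with $\rho=\mathrm d\varrho/\mathrm d\mathcal H^2$, $p=\mathrm d\wp/\mathrm d\mathcal H^2$, then the state equation holds $\mathcal H^2$-a.e. and the classical entropy condition holds at discontinuities of $\rho,u,w,E$. For the infinite-thin shock layer solutions considered here, $\wp=\tilde p(\rho_0,E_0)\,\mathrm d\mathcal H^2$ on $\overline\Omega$. *)

(* Defs.v *)
From HB Require Import structures.
From mathcomp Require Import all_boot all_order all_algebra.
From mathcomp Require Import all_classical all_reals all_analysis.
From mathcomp Require Import measurable_realfun.

Set Implicit Arguments.
Unset Strict Implicit.
Unset Printing Implicit Defensive.

Import Order.TTheory GRing.Theory Num.Theory.
Import numFieldNormedType.Exports.

Local Open Scope classical_set_scope.
Local Open Scope ring_scope.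

(* R^3 with its Borel sigma-algebra. The sphere S^2, the domain Omega and the
   circle C are subsets of R^3; the outward radial unit vector at a point x of
   S^2 is x itself, and tangent vectors to S^2 at x are the h with
   dot x h = 0. *)
Definition R3 (R : realType) : measurableType _ :=
  g_sigma_algebraType (@open 'rV[R]_3).

Section Coordinates.
Context {R : realType}.
Implicit Types (x y h : 'rV[R]_3).

Definition row3 (a b c : R) : 'rV[R]_3 := \row_(i < 3) [:: a; b; c]`_i.

Definition dot x y : R := \sum_(i < 3) x 0 i * y 0 i.

Definition enorm x : R := Num.sqrt (dot x x).

Definition sphere : set 'rV[R]_3 := [set x | dot x x = 1].

Definition tanproj x h : 'rV[R]_3 := h - dot x h *: x.

Definition sph (theta phi : R) : 'rV[R]_3 :=
  row3 (cos theta) (sin theta * cos phi) (sin theta * sin phi).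

End Coordinates.

Section Area.
Context {R : realType}.
Local Notation mR := (measurableTypeR R).
Local Notation leb2 := (@lebesgue_measure R \x @lebesgue_measure R)%E.

Definition chart_rect : set (mR * mR) :=
  `[0, pi]%classic `*` `[- pi, pi]%classic.

Definition chart_pre (A : set (R3 R)) : set (mR * mR) :=
  chart_rect `&` [set p | A (sph p.1 p.2)].

(* dH^2 = sin(theta) dtheta dphi, as a measure on R^3 concentrated on S^2 *)
Definition area (A : set (R3 R)) : \bar R :=
  (\int[leb2]_(p in chart_pre A) (sin p.1)%:E)%E.

Let measurable_chart_rect : measurable chart_rect.
Proof. by apply: measurableX; exact: measurable_itv. Qed.

Lemma open_measurable_prod (U : set (R * R)) :
  open U -> measurable (U : set (mR * mR)).
Proof.
move=> oU.
pose box (q : (rat * rat) * (rat * rat)) : set (mR * mR) :=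
  `](ratr q.1.1 : R), ratr q.1.2[%classic `*`
  `](ratr q.2.1 : R), ratr q.2.2[%classic.
pose boxU q : set (mR * mR) := if pselect (box q `<=` U) then box q else set0.
suff -> : U = \bigcup_q boxU q.
  apply: countable_bigcupT_measurable; first exact: countableP.
  move=> q; rewrite /boxU; case: pselect => ?; last exact: measurable0.
  by apply: measurableX; exact: measurable_itv.
apply/seteqP; split => [[x y] Uxy|p [q _]]; last first.
  by rewrite /boxU; case: pselect => // qU; exact: qU.
have /nbhs_ballP[e /= e0 eU] : nbhs (x, y) U by exact: open_nbhs_nbhs.
have xl : x - e < x by rewrite ltrBlDr ltrDl.
have xr : x < x + e by rewrite ltrDl.
have yl : y - e < y by rewrite ltrBlDr ltrDl.
have yr : y < y + e by rewrite ltrDl.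
have [a] := rat_in_itvoo xl; rewrite in_itv/= => /andP[a1 a2].
have [b] := rat_in_itvoo xr; rewrite in_itv/= => /andP[b1 b2].
have [c] := rat_in_itvoo yl; rewrite in_itv/= => /andP[c1 c2].
have [d] := rat_in_itvoo yr; rewrite in_itv/= => /andP[d1 d2].
exists ((a, b), (c, d)) => //; rewrite /boxU; case: pselect => [?|[]].
  by split; rewrite /= in_itv/= ?a2 ?b1 ?c2 ?d1.
move=> [x' y'] [/= + +]; rewrite !in_itv/= => /andP[ax xb] /andP[cy yd].
apply: eU; split => /=; rewrite /ball/= ltr_distlC.
  by rewrite (lt_trans a1 ax) (lt_trans xb b2).
by rewrite (lt_trans c1 cy) (lt_trans yd d2).
Qed.

Let sph_continuous :
  continuous (fun p : R * R => sph p.1 p.2 : 'rV[R]_3).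
Proof.
move=> p A [P nP PA].
have cS (g : R * R -> R) : continuous g -> continuous (fun p => sin (g p)).
  by move=> cg q; exact: (continuous_comp (cg q) (@continuous_sin R (g q))).
have cC (g : R * R -> R) : continuous g -> continuous (fun p => cos (g p)).
  by move=> cg q; exact: (continuous_comp (cg q) (@continuous_cos R (g q))).
have c1 : continuous (fst : R * R -> R) by move=> q; exact: cvg_fst.
have c2 : continuous (snd : R * R -> R) by move=> q; exact: cvg_snd.
have ci (j : 'I_3) : continuous (fun q : R * R => sph q.1 q.2 0 j : R).
  case: j => -[|[|[|//]]] j3 q; rewrite /sph /row3.
  - under eq_fun do rewrite mxE/=.
    exact: cC.
  - under eq_fun do rewrite mxE/=.
    by apply: cvgM; [exact: cS|exact: cC].
  - under eq_fun do rewrite mxE/=.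
    by apply: cvgM; [exact: cS|exact: cS].
have : \forall q \near p, forall j : 'I_3, P 0 j (sph q.1 q.2 0 j).
  apply: (@filter_forall _ _ (fun j q => P 0 j (sph q.1 q.2 0 j)) (nbhs p)) => j.
  exact: (ci j p _ (nP 0 j)).
apply: filterS => q Pq; apply: PA => i j.
by rewrite ord1; exact: Pq.
Qed.

Lemma measurable_sph :
  measurable_fun setT ((fun p => sph p.1 p.2) : mR * mR -> R3 R).
Proof.
apply: (@measurability _ _ (mR * mR)%type (R3 R) setT _
  (@open 'rV[R]_3 : set (set (R3 R)))) => //.
move=> _ [U oU <-]; rewrite setTI.
apply: (@open_measurable_prod ((fun p : R * R => sph p.1 p.2) @^-1` U)).
by apply: open_comp => // p _; exact: sph_continuous.
Qed.

Let measurable_chart_pre (A : set (R3 R)) :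
  measurable A -> measurable (chart_pre A).
Proof.
move=> mA; apply: measurableI => //.
by rewrite -[X in measurable X]setTI; exact: measurable_sph.
Qed.

Let measurable_sin1 (D : set (mR * mR)) :
  @measurable_fun _ _ (mR * mR)%type (\bar R) D (fun p => (sin p.1)%:E).
Proof.
apply/measurable_EFinP; apply: measurable_funTS.
by apply: measurableT_comp => //; apply: continuous_measurable_fun;
  exact: continuous_sin.
Qed.

Let sin1_ge0 (A : set (R3 R)) p : chart_pre A p -> (0 <= (sin p.1)%:E)%E.
Proof.
by case=> -[/=+ _ _]; rewrite in_itv/= lee_fin => ?; exact: sin_ge0_pi.
Qed.

Let area0 : area set0 = 0%E.
Proof. by rewrite /area /chart_pre [X in setI _ X](_ : _ = set0)// setI0 integral_set0. Qed.

Let area_ge0 A : (0 <= area A)%E.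
Proof. by apply: integral_ge0 => p; exact: sin1_ge0. Qed.

Let area_sigma_additive : semi_sigma_additive area.
Proof.
move=> F mF tF mUF.
have FE : chart_pre (\bigcup_n F n) = \bigcup_n chart_pre (F n).
  apply/seteqP; split => [p [rp [n _ Fn]]|p [n _ [rp Fn]]].
    by exists n.
  by split => //; exists n.
rewrite /area FE ge0_integral_bigcup.
- by apply: is_cvg_ereal_nneg_natsum => n _; exact: area_ge0.
- by move=> n; exact: measurable_chart_pre.
- exact: measurable_sin1.
- by move=> p [n _]; exact: sin1_ge0.
- apply/trivIsetP => i j _ _ ij; move/trivIsetP : tF => /(_ i j I I ij) FF.
  apply/seteqP; split => // p [[_ pFi] [_ pFj]].
  by have : (F i `&` F j) (sph p.1 p.2) by []; rewrite FF.
Qed.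

HB.instance Definition _ := isMeasure.Build _ _ _ area
  area0 area_ge0 area_sigma_additive.

Let area_fin : fin_num_fun area.
Proof.
move=> A mA; rewrite ge0_fin_numE//.
have mT : measurable (chart_pre setT) by exact: measurable_chart_pre.
apply: (@le_lt_trans _ _ (\int[leb2]_(p in chart_rect) (cst 1 p))%E).
  rewrite /area.
  apply: (@le_trans _ _ (\int[leb2]_(p in chart_pre A) (cst 1 p))%E).
    apply: ge0_le_integral => //.
    - exact: measurable_chart_pre.
    - exact: sin1_ge0.
    - by move=> p _; rewrite lee_fin sin_le1.
  apply: ge0_subset_integral => //.
  - exact: measurable_chart_pre.
  - by move=> p [].
rewrite integral_cst// mul1e /chart_rect [ltLHS]product_measure1E//.
rewrite /= !lebesgue_measure_itv /=.
by case: ifP => _; case: ifP => _; rewrite -?EFinD -?EFinM ?mul0e ?mule0 ?ltry.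
Qed.

HB.instance Definition _ := Measure_isFinite.Build _ _ _ area area_fin.

End Area.

Section SphereCalculus.
Context {R : realType}.
Local Notation E3 := 'rV[R]_3.

Definition hext (W : Type) (f : E3 -> W) (x : E3) : W := f ((enorm x)^-1 *: x).

(* f restricted to S^2 is of class C^1 iff its degree-0 homogeneous extension
   is of class C^1 on R^3 minus the origin; values of f off S^2 are irrelevant *)
Definition C1_sphere (W : normedModType R) (f : E3 -> W) : Prop :=
  forall x : E3, x != 0 -> differentiable (hext f) x /\
    forall h : E3, {for x, continuous (fun y => 'D_h (hext f) y)}.

Definition tangent_field (v : E3 -> E3) : Prop :=
  forall x, sphere x -> dot x (v x) = 0.

Definition basis_vec (i : 'I_3) : E3 := delta_mx 0 i.

(* At x in S^2 the derivative of hext f in the direction x vanishes, so that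
   differentiating along basis_vec i amounts to differentiating along its
   tangential part; in particular grad psi x is tangent. *)
Definition grad (psi : E3 -> R) (x : E3) : E3 :=
  \row_(i < 3) 'D_(basis_vec i) (hext psi) x.

(* Levi-Civita connection of S^2: tangential part of the ambient derivative *)
Definition covariant (v : E3 -> E3) (x h : E3) : E3 :=
  tanproj x ('D_h (hext v) x).

Definition Dcov (v : E3 -> E3) (x : E3) : 'M[R]_3 :=
  \matrix_(i < 3, j < 3) covariant v x (basis_vec i) 0 j.

Definition sdiv (v : E3 -> E3) (x : E3) : R := \tr (Dcov v x).

End SphereCalculus.

Section Geometry.
Context {R : realType}.
Variable theta0 : R.
Local Notation E3 := 'rV[R]_3.
Local Notation leb := (@lebesgue_measure R).

(* theta <= theta0 reads cos theta0 <= x^1 *)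
Definition Con : set (R3 R) := [set x | sphere x /\ cos theta0 <= x 0 0].

Definition Omega : set (R3 R) := sphere `\` Con.

Definition Cbd : set (R3 R) := [set x | sphere x /\ x 0 0 = cos theta0].

Definition Obar : set (R3 R) := Omega `|` Cbd.

Definition clen : R := 2 * pi * sin theta0.

(* phi runs over [-pi, pi] as the arc length s runs over [0, clen] *)
Definition azimuth (s : R) : R := s / sin theta0 - pi.
Definition arclength (phi : R) : R := (phi + pi) * sin theta0.

Definition curve (s : R) : R3 R := sph theta0 (azimuth s).

Definition tvec (s : R) : E3 := row3 0 (- sin (azimuth s)) (cos (azimuth s)).

(* Omega being {theta > theta0}, the outward normal is - d/dtheta *)
Definition nvec (s : R) : E3 :=
  row3 (sin theta0) (- (cos theta0 * cos (azimuth s)))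
    (- (cos theta0 * sin (azimuth s))).

(* arc-length parameter in [0, clen[ of a point of C *)
Definition arc_param (x : R3 R) : R :=
  xget 0 [set s | 0 <= s < clen /\ curve s = x].

Definition delta_C (W : R -> R) (A : set (R3 R)) : \bar R :=
  (\int[leb]_(s in `[0%R, clen]) (W s * \1_A (curve s))%:E)%E.

End Geometry.

Section UpcomingFlow.
Context {R : realType}.
Variable alpha0 : R.

Definition rho0 : R := 1.
Definition V0 : 'rV[R]_3 := row3 (cos alpha0) (sin alpha0) 0.
Definition w0 (x : 'rV[R]_3) : R := dot V0 x.
Definition u0 (x : 'rV[R]_3) : 'rV[R]_3 := V0 - w0 x *: x.

End UpcomingFlow.

Section Chaplygin.
Context {R : realType}.
Variable Minf : R.

Definition chaplygin (rho : R) : R := - (Minf ^+ 2 * rho)^-1.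

(* sqrt (dp/drho) *)
Definition sound_speed (rho : R) : R := (Minf * rho)^-1.

End Chaplygin.

Section Pairing.
Context {R : realType}.
Variable theta0 : R.
Local Notation T := (R3 R).
Local Notation E3 := 'rV[R]_3.
Local Notation signed := ({charge set (R3 R) -> \bar R})%type.

(* <nu, f>, the integral over Omega-bar with respect to the signed measure nu *)
Definition pairing (nu : signed) (f : E3 -> R) : R :=
  let nuPN := svalP (cid (svalP (cid (Hahn_decomposition nu)))) in
  \int[jordan_pos nuPN]_(x in Obar theta0) f x -
  \int[jordan_neg nuPN]_(x in Obar theta0) f x.

Definition pairing_vec (m : 'I_3 -> signed) (F : E3 -> E3) : R :=
  \sum_(i < 3) pairing (m i) (fun x => F x 0 i).

Definition pairing_ten (m : 'I_3 -> 'I_3 -> signed) (F : E3 -> 'M[R]_3) : R :=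
  \sum_(i < 3) \sum_(j < 3) pairing (m i j) (fun x => F x i j).

End Pairing.

Section ApproximateJumps.
Context {R : realType}.
Local Notation T := (R3 R).
Local Notation E3 := 'rV[R]_3.

Definition half_disk (x nu : E3) (r : R) : set T :=
  [set y | [/\ sphere y, enorm (y - x) < r & 0 < dot y nu]].

(* l is the one-sided (H^2-approximate) limit of f at x, on the side of the
   great circle through x towards which nu points *)
Definition side_limit (W : normedModType R) (x nu : E3) (f : T -> W) (l : W) :
  Prop :=
  ((r ^- 2)%:E * \int[@area R]_(y in half_disk x nu r) (`|f y - l|)%:E)%E
  @[r --> (0 : R)^'+] --> 0%E.

End ApproximateJumps.

Section RadonMeasureSolution.
Context {R : realType}.
Variables (theta0 Minf E0 : R).
Local Notation T := (R3 R).
Local Notation E3 := 'rV[R]_3.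
Local Notation signed := ({charge set (R3 R) -> \bar R})%type.
Local Notation radon := ({finite_measure set (R3 R) -> \bar R})%type.
Local Notation leb := (@lebesgue_measure R).
Local Open Scope charge_scope.

Definition weak_equations (ma : 'I_3 -> signed) (na : signed)
    (me : 'I_3 -> signed) (ne : signed) (mr : 'I_3 -> signed) (nr : signed)
    (mt : 'I_3 -> 'I_3 -> signed) (nt wp : signed) (WC : R -> R) : Prop :=
  (forall psi : E3 -> R, C1_sphere psi ->
    [/\ pairing_vec theta0 ma (grad psi) = 2 * pairing theta0 na psi,
        pairing_vec theta0 me (grad psi) = 2 * pairing theta0 ne psi &
        pairing_vec theta0 mr (grad psi) =
          2 * pairing theta0 nr psi - pairing theta0 nt psi]) /\
  (forall v : E3 -> E3, C1_sphere v -> tangent_field v ->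
    pairing_ten theta0 mt (Dcov v) + pairing theta0 wp (sdiv v) =
      3 * pairing_vec theta0 mr v +
      \int[leb]_(s in `[0, clen theta0])
        (WC s * dot (nvec theta0 s) (v (curve theta0 s)))).

Definition dominated (rho : radon) (ma : 'I_3 -> signed) (na : signed)
    (me : 'I_3 -> signed) (ne : signed) (mr : 'I_3 -> signed) (nr : signed)
    (mt : 'I_3 -> 'I_3 -> signed) (nt wp : signed) : Prop :=
  (forall i, [/\ ma i `<< rho, me i `<< rho & mr i `<< rho]) /\
  (forall i j, mt i j `<< rho) /\
  [/\ na `<< rho, ne `<< rho, nr `<< rho, nt `<< rho & wp `<< rho].

Definition densities (rho : radon) (u : T -> E3) (w E : T -> R)
    (ma : 'I_3 -> signed) (na : signed) (me : 'I_3 -> signed) (ne : signed)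
    (mr : 'I_3 -> signed) (nr : signed) (mt : 'I_3 -> 'I_3 -> signed)
    (nt : signed) : Prop :=
  {ae rho, forall x,
    [/\ dot x (u x) = 0,
     [/\ ('d na '/d rho) x = (w x)%:E,
         forall i, ('d (mr i) '/d rho) x = ((w x)%:E * ('d (ma i) '/d rho) x)%E
       & ('d nr '/d rho) x = ((w x)%:E * ('d na '/d rho) x)%E],
     (forall i, ('d (me i) '/d rho) x = ((E x)%:E * ('d (ma i) '/d rho) x)%E) /\
       ('d ne '/d rho) x = ((E x)%:E * ('d na '/d rho) x)%E &
     [/\ forall i, ('d (ma i) '/d rho) x = (u x 0 i)%:E,
         ('d nt '/d rho) x = (dot (u x) (u x))%:E &
         forall i j, ('d (mt i j) '/d rho) x = (u x 0 i * u x 0 j)%:E]]}.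

(* Lax condition for the gas crossing the jump from the side -nu to the side
   nu; it is non-strict because the acoustic fields of a Chaplygin gas are
   linearly degenerate. Jumps without mass flux are contact discontinuities
   and are not constrained. *)
Definition entropy_condition (rho : T -> R) (u : T -> E3) (w E : T -> R) :
  Prop :=
  forall (x nu : E3) (rhom rhop : R) (um up : E3) (wm wp Em Ep : R),
    Omega theta0 x -> dot nu nu = 1 -> dot x nu = 0 ->
    [/\ side_limit x (- nu) rho rhom, side_limit x (- nu) u um,
        side_limit x (- nu) w wm & side_limit x (- nu) E Em] ->
    [/\ side_limit x nu rho rhop, side_limit x nu u up,
        side_limit x nu w wp & side_limit x nu E Ep] ->
    (rhom, um, wm, Em) <> (rhop, up, wp, Ep) ->
    0 < rhom * dot um nu ->
    sound_speed Minf rhom <= dot um nu /\ dot up nu <= sound_speed Minf rhop.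

Definition state_and_entropy (rho : radon) (wp : signed) (u : T -> E3)
    (w E : T -> R) : Prop :=
  rho `<< @area R -> wp `<< @area R ->
  let dens : T -> R := fine \o
    'd (charge_of_finite_measure rho) '/d (@area R) in
  let pres : T -> R := fine \o 'd wp '/d (@area R) in
  {ae @area R, forall x, Obar theta0 x ->
    [/\ 0 < dens x, pres x = chaplygin Minf (dens x) & E x = E0]} /\
  entropy_condition dens u w E.

(* wp is the pressure measure. All the other measures live on Omega-bar
   because rho does and dominates them. *)
Definition radon_measure_solution (rho : radon) (u : T -> E3) (w E : T -> R)
    (wp : signed) : Prop :=
  rho (~` Obar theta0) = 0%E /\
  (exists (ma : 'I_3 -> signed) (na : signed) (me : 'I_3 -> signed)
     (ne : signed) (mr : 'I_3 -> signed) (nr : signed)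
     (mt : 'I_3 -> 'I_3 -> signed) (nt : signed) (WC : R -> R),
    [/\ (forall s, s \in `[0, clen theta0] -> 0 < WC s) /\
          leb.-integrable `[0, clen theta0] (EFin \o WC),
        weak_equations ma na me ne mr nr mt nt wp WC,
        dominated rho ma na me ne mr nr mt nt wp &
        densities rho u w E ma na me ne mr nr mt nt]) /\
  state_and_entropy rho wp u w E.

End RadonMeasureSolution.

Definition C1_periodic (R : realType) (L : R) (f : R -> R) : Prop :=
  [/\ periodic f L, forall s, derivable f s 1 & continuous (derive1 f)].

(* Main.v *)
Require Import Defs.
From HB Require Import structures.
From mathcomp Require Import all_boot all_order all_algebra.
From mathcomp Require Import all_classical all_reals all_analysis.
From mathcomp Require Import measurable_realfun.
From mathcomp Require Import ring lra.

Set Implicit Arguments.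
Unset Strict Implicit.
Unset Printing Implicit Defensive.

Import Order.TTheory GRing.Theory Num.Theory.
Import numFieldNormedType.Exports.

Local Open Scope classical_set_scope.
Local Open Scope ring_scope.

(** The proposed solution carries gas of density 1 on Omega and a mass w_rho per
unit length on the circle C. Each identity of the weak formulation is thus an
integral over Omega plus an integral along C, and both are integrated by parts.

On Omega the upcoming velocity is a constant vector V of R^3. Its radial
component w0 is the restriction of a linear function and u0 is the gradient of
w0, so that div u0 = - 2 w0: the constant state solves the conical Euler
equations and the divergence theorem on Omega ([Rintegral_surf_div]) leaves only
the flux of mass (u0, n), carrying the corresponding quantity, through C
([surf_div_u0], [surf_div_w0u0], [surf_div_dotu0]). Along the closed curve C
([circle_by_parts]) the concentrated part produces the derivatives of
w_rho u^t, w_rho u^t w and w_rho (u^t)^2. The three ordinary differential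
equations on C say exactly that the two contributions cancel ([mass_balance],
[radial_balance], [tangential_balance]).

In the momentum equation this cancellation concerns the component tangent to C.
In the direction of n there remain the momentum (u0, n)^2 brought by the gas,
the force p0 = - 1 / M^2 of the upstream pressure, and the centripetal force
w_rho (u^t)^2 cot theta0, which comes from the derivative
t' = - x + cot(theta0) n of the tangent vector. Their sum
  W_C = (u0, n)^2 - w_rho (u^t)^2 cot theta0 - 1 / M^2
is the force exerted on the cone; the lower bound on the Mach number is its
positivity ([wall_pressure_gt0]).

The conditions on solutions that are absolutely continuous with respect to the
area hold because varrho is not one of them: otherwise w_rho would vanish, and
the mass equation on C would force (u0, n) = 0 along the whole circle, which
no unit vector V satisfies when 0 < theta0 < pi / 2 ([layer_not_dominated]).

The measure-theoretic part turns these computations into statements about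
measures. All the charges have a bounded density with respect to varrho (the
pressure, with respect to the area); such a density is a pair made of a function
on Omega and a function of the arc length ([two_phase]), and the pairing of the
charge with a test function is the integral of the product
([pairing_induced], [pairing_two_phase]). Integrals over Omega are computed in
the chart (theta, phi) ([Rintegral_Omega]), where the divergence theorem reduces
to Green's formula on a rectangle ([Rintegral_rect_div]). *)

(** * Measures and charges with a density *)

Section Density.
Context d1 d2 (X : measurableType d1) (Y : measurableType d2) (R : realType).
Variables (mu : {measure set X -> \bar R}) (D : set X) (k : X -> R).
Variable phi : X -> Y.
Hypotheses (mD : measurable D) (mk : measurable_fun D k).
Hypothesis k0 : forall x, D x -> 0 <= k x.
Hypothesis mphi : measurable_fun setT phi.

Import HBNNSimple.

Let mpre (A : set Y) : measurable A -> measurable (D `&` phi @^-1` A).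
Proof.
by move=> mA; apply: measurableI => //; rewrite -[X in measurable X]setTI; exact: mphi.
Qed.

(** The measure [nu] is the image under [phi] of the measure of density [k]: this
covers the area (chart and Jacobian), the Dirac measure on C (curve and linear
density) and the Jordan parts of a charge. The formula holds for simple
functions by hypothesis and passes to monotone limits. *)
Lemma ge0_integral_density (nu : {measure set Y -> \bar R}) (B : set Y)
    (f : Y -> \bar R) :
  (forall A, measurable A ->
     nu A = \int[mu]_(x in D `&` phi @^-1` A) (k x)%:E)%E ->
  measurable B -> measurable_fun B f -> (forall y, B y -> 0 <= f y)%E ->
  (\int[nu]_(y in B) f y =
   \int[mu]_(x in D `&` phi @^-1` B) (f (phi x) * (k x)%:E))%E.
Proof.
move=> nuE mB mf f0.
have mDB := mpre mB.
have mkB : measurable_fun (D `&` phi @^-1` B) (EFin \o k).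
  by apply/measurable_EFinP; apply: measurable_funS mk => //; exact: subIsetl.
pose h := nnsfun_approx mB mf.
have mh n A : measurable_fun A (fun x => (h n (phi x))%:E).
  apply/measurable_EFinP/measurable_funTS.
  by apply: (measurableT_comp (f := h n)).
have hE x : B x -> f x = lim ((EFin \o h n) x @[n --> \oo]).
  by move=> Bx; apply/esym/cvg_lim => //; exact: cvg_nnsfun_approx.
have -> : (\int[nu]_(y in B) f y =
    lim (\int[nu]_(y in B) (EFin \o h n) y @[n --> \oo]))%E.
  under eq_integral => x /[!inE] /hE -> //.
  apply: monotone_convergence => //.
  - by move=> n; apply/measurable_EFinP/measurable_funTS.
  - by move=> n x _ /=; rewrite lee_fin.
  - by move=> x Bx a b ab; rewrite lee_fin; exact/lefP/nd_nnsfun_approx.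
have -> : (\int[mu]_(x in D `&` phi @^-1` B) (f (phi x) * (k x)%:E) =
    lim (\int[mu]_(x in D `&` phi @^-1` B)
      ((h n (phi x))%:E * (k x)%:E) @[n --> \oo]))%E.
  have fg x : (D `&` phi @^-1` B) x -> (f (phi x) * (k x)%:E =
      lim (((h n (phi x))%:E * (k x)%:E) @[n --> \oo]))%E.
    move=> [Dx Bx]; apply/esym/cvg_lim => //; apply: cvgeZr => //.
    exact: (cvg_nnsfun_approx mB mf f0).
  under eq_integral => x /[!inE] /fg -> //.
  apply: monotone_convergence => //.
  - by move=> n; apply: emeasurable_funM => //; exact: mh.
  - by move=> n x [Dx _]; rewrite mule_ge0// lee_fin ?k0.
  - move=> x [Dx _] a b ab; rewrite lee_wpmul2r ?lee_fin ?k0//.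
    exact/lefP/nd_nnsfun_approx.
congr (lim _); congr (_ @ \oo); apply/funext => n.
have mi r : measurable (h n @^-1` [set r]) by exact: measurable_funPTI.
under eq_integral do rewrite /= fimfunE -fsumEFin//.
rewrite ge0_integral_fsum//; last 2 first.
- by move=> r; apply/measurable_EFinP/measurable_funTS/measurable_funM.
- by move=> r y _; exact: nnfun_muleindic_ge0.
under [RHS]eq_integral => x xE.
  rewrite fimfunE -fsumEFin// ge0_mule_fsuml; last first.
    by move=> r; exact: nnfun_muleindic_ge0.
  over.
rewrite ge0_integral_fsum//; last 2 first.
- move=> r; apply: emeasurable_funM => //.
  apply/measurable_EFinP/measurable_funTS.
  apply: measurable_funM => //.
  by apply: (measurableT_comp (f := \1_(h n @^-1` [set r]) : Y -> R)).
- move=> r x [Dx _]; rewrite mule_ge0 ?lee_fin ?k0//.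
  by rewrite -lee_fin; exact: nnfun_muleindic_ge0.
apply: eq_fsbigr => r /[!inE] -[y _ hy].
have r0 : 0 <= r by rewrite -hy.
under eq_integral do rewrite EFinM.
rewrite integralZl_indic_nnsfun// integral_indic//= nuE; last exact: measurableI.
under [RHS]eq_integral do rewrite EFinM -muleA.
rewrite ge0_integralZl//; last 2 first.
- apply: emeasurable_funM => //; apply/measurable_EFinP/measurable_funTS.
  by apply: (measurableT_comp (f := \1_(h n @^-1` [set r]) : Y -> R)).
- by move=> x [Dx _]; rewrite mule_ge0 ?lee_fin ?k0.
congr (_ * _)%E.
rewrite [RHS](eq_integral (fun x =>
   ((EFin \o k) \_ (phi @^-1` (h n @^-1` [set r]))) x)); last first.
  move=> x _; rewrite patchE indicE.
  case: (boolP (x \in phi @^-1` (h n @^-1` [set r]))) => [/set_mem hx|/negP hx].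
    by rewrite mem_set//= mul1e.
  rewrite memNset ?mul0e// => ?; apply: hx; exact/mem_set.
rewrite -integral_mkcondr; congr (integral _ _ _).
by rewrite preimage_setI setIA setIAC.
Qed.

Lemma Rintegral_density (nu : {measure set Y -> \bar R}) (B : set Y)
    (f : Y -> R) :
  (forall A, measurable A ->
     nu A = \int[mu]_(x in D `&` phi @^-1` A) (k x)%:E)%E ->
  measurable B -> measurable_fun B f ->
  \int[nu]_(y in B) f y =
  \int[mu]_(x in D `&` phi @^-1` B) (f (phi x) * k x).
Proof.
move=> nuE mB mf; rewrite /Rintegral integralE [in RHS]integralE.
have mfE : measurable_fun B (EFin \o f) by exact/measurable_EFinP.
rewrite (ge0_integral_density nuE) //; last exact: measurable_funepos.
rewrite (ge0_integral_density nuE) //; last exact: measurable_funeneg.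
congr (fine (_ - _)); apply: eq_integral => x /[!inE] -[Dx _].
- by rewrite !funeposE /= -!EFin_max -EFinM maxr_pMl ?k0// mul0r.
- by rewrite !funenegE /= -!EFin_max -EFinM maxr_pMl ?k0// mul0r mulNr.
Qed.

Lemma density_measure : mu.-integrable D (EFin \o k) ->
  exists m : {finite_measure set Y -> \bar R}, forall A, measurable A ->
    (m A = \int[mu]_(x in D `&` phi @^-1` A) (k x)%:E)%E.
Proof.
move=> ik.
pose m (A : set Y) := (\int[mu]_(x in D `&` phi @^-1` A) (k x)%:E)%E.
have m0 : m set0 = 0%E by rewrite /m preimage_set0 setI0 integral_set0.
have m_ge0 A : (0 <= m A)%E.
  by apply: integral_ge0 => x [Dx _]; rewrite lee_fin k0.
have m_sigma : semi_sigma_additive m.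
  move=> F mF tF mUF; rewrite /m preimage_bigcup setI_bigcupr.
  rewrite ge0_integral_bigcup.
  - by apply: is_cvg_ereal_nneg_natsum => n _; exact: m_ge0.
  - by move=> n; exact: mpre.
  - apply: measurable_funS (measurable_int mu ik) => //.
    by move=> x [n _ []].
  - by move=> x [n _ [Dx _]]; rewrite lee_fin k0.
  - apply/trivIsetP => i j _ _ ij; move/trivIsetP : tF => /(_ i j I I ij) FF.
    apply/seteqP; split => // x [[_ Fi] [_ Fj]].
    by have : (F i `&` F j) (phi x) by []; rewrite FF.
pose m1 : {measure set Y -> \bar R} :=
  HB.pack m (isMeasure.Build _ _ _ m m0 m_ge0 m_sigma).
have m_fin : fin_num_fun m1.
  move=> A mA; apply: integrable_fin_num; first exact: mpre.
  by apply: integrableS ik => //; exact: mpre.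
pose m2 : {finite_measure set Y -> \bar R} :=
  HB.pack (Measure.sort m1) (Measure_isFinite.Build _ _ _ m1 m_fin).
by exists m2.
Qed.

End Density.

Section InducedCharge.
Context d (T : measurableType d) (R : realType).
Variables (mu : {finite_measure set T -> \bar R}).

Lemma induced_charge_dominated (f : T -> \bar R)
  (intf : mu.-integrable setT f) : induced_charge intf `<< mu.
Proof.
apply/null_content_dominatesP => /= A mA muA.
apply: null_set_integral => //; apply: measurable_funTS.
exact: measurable_int intf.
Qed.

(** Two functions with the same integral over every measurable set agree almost
everywhere. *)
Lemma Radon_Nikodym_induced (f : T -> \bar R)
    (intf : mu.-integrable setT f) :
  ae_eq mu setT (Radon_Nikodym (induced_charge intf) mu) f.
Proof.
have dom := induced_charge_dominated intf.
apply: integral_ae_eq => //.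
- exact: Radon_Nikodym_integrable.
- exact: measurable_int intf.
- by move=> A _ mA; rewrite -Radon_Nikodym_integral.
Qed.

End InducedCharge.

Section Pairing.
Context {R : realType}.
Variable theta0 : R.
Local Notation T := (R3 R).
Local Notation E3 := 'rV[R]_3.

(** The pairing is defined through a chosen Hahn decomposition of the charge. By
essential uniqueness the Jordan parts are also those of the decomposition into
{0 <= g} and {g < 0}, hence have the densities g and - g on these two sets. *)
Lemma pairing_induced (mu : {finite_measure set T -> \bar R}) (f g : T -> R)
    (ig : mu.-integrable setT (EFin \o g)) :
  measurable (Obar theta0) -> measurable_fun (Obar theta0) f ->
  mu.-integrable (Obar theta0) (EFin \o (fun x => f x * g x)) ->
  pairing theta0 (induced_charge ig) f = \int[mu]_(x in Obar theta0) (f x * g x).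
Proof.
move=> mO mf ifg; rewrite /pairing; cbv zeta.
set nu := induced_charge ig.
move: (svalP (cid (svalP (cid (Hahn_decomposition nu))))) => nuPN.
have /measurable_EFinP mg := measurable_int mu ig.
pose P := [set x | 0 <= g x]; pose N := [set x | g x < 0].
have mP : measurable P.
  rewrite [P](_ : _ = g @^-1` `[0, +oo[); first by rewrite -[X in measurable X]setTI; exact: mg.
  by apply/seteqP; split => x /=; rewrite in_itv/= andbT.
have mN : measurable N.
  rewrite [N](_ : _ = g @^-1` `]-oo, 0[); first by rewrite -[X in measurable X]setTI; exact: mg.
  by apply/seteqP; split => x /=; rewrite in_itv/=.
have PN : hahn_decomposition nu P N.
  split.
  - split; first exact: mP.
    by move=> A mA AP; apply: integral_ge0 => x /AP; rewrite lee_fin.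
  - split; first exact: mN.
    move=> A mA AN; rewrite -oppe_ge0 -integralN/=; last first.
      exact: integrable_add_def mA _ (integrableS measurableT mA (@subsetT _ _) ig).
    by apply: integral_ge0 => x /AN /ltW; rewrite lee_fin oppr_ge0.
  - by apply/seteqP; split => // x _; case: (leP 0 (g x)) => ?; [left|right].
  - apply/seteqP; split => // x [Px Nx]; have := lt_le_trans (Nx : g x < 0) (Px : 0 <= g x); by rewrite ltxx.
have posE A : measurable A ->
    jordan_pos nuPN A = (\int[mu]_(x in P `&` id @^-1` A) (g x)%:E)%E.
  move=> mA; rewrite jordan_posE cjordan_posE /crestr0 mem_set//.
  rewrite setIC; exact: (Hahn_decomposition_uniq nuPN PN mA).1.
have negE A : measurable A ->
    jordan_neg nuPN A = (\int[mu]_(x in N `&` id @^-1` A) (- g x)%:E)%E.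
  move=> mA; rewrite jordan_negE cjordan_negE /crestr0 mem_set//.
  under eq_integral do rewrite EFinN.
  have iNA := integrableS measurableT (measurableI _ _ mN mA) (@subsetT _ _) ig.
  rewrite preimage_id integralN/=; last first.
    exact: integrable_add_def (measurableI _ _ mN mA) _ iNA.
  congr oppe; rewrite setIC.
  exact: (Hahn_decomposition_uniq nuPN PN mA).2.
have g0 x : N x -> 0 <= - g x by rewrite oppr_ge0 => /ltW.
transitivity (\int[mu]_(x in P `&` Obar theta0) (f x * g x) -
              \int[mu]_(x in N `&` Obar theta0) (f x * - g x)).
  congr (_ - _).
    apply: (@Rintegral_density _ _ _ _ _ mu P g id mP _ _ _ _ _ f posE) => //.
    exact: measurable_funTS.
  apply: (@Rintegral_density _ _ _ _ _ mu N (fun x => - g x) id mN _ g0 _ _ _ f negE) => //.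
  by apply: measurable_funTS; exact: measurableT_comp.
have E0 : Obar theta0 = (P `&` Obar theta0) `|` (N `&` Obar theta0).
  by rewrite -setIUl; case: PN => _ _ -> _; rewrite setTI.
rewrite [in RHS]E0 Rintegral_setU; last 4 first.
- exact: measurableI.
- exact: measurableI.
- by rewrite -E0.
- apply/disj_setPS => x [[/= Px _] [/= Nx _]].
  by have := lt_le_trans (Nx : g x < 0) (Px : 0 <= g x); rewrite ltxx.
congr (_ + _); rewrite -[RHS]opprK; congr (- _).
rewrite -mulN1r -RintegralZl; last 2 first.
- exact: measurableI.
- by apply: integrableS ifg => //; exact: measurableI.
by apply: eq_Rintegral => x _; rewrite mulN1r mulrN.
Qed.

End Pairing.

(** * Green's formula on a rectangle *)

Section Rectangle.
Context {R : realType}.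
Local Notation mR := (measurableTypeR R).
Local Notation leb := (@lebesgue_measure R).
Local Notation leb2 := (leb \x leb)%E.

Definition rect (a b c d : R) : set (mR * mR) :=
  `[a, b]%classic `*` `[c, d]%classic.

Lemma measurable_rect a b c d : measurable (rect a b c d).
Proof. by apply: measurableX; exact: measurable_itv. Qed.

Let pair_continuousr (x y : R) : {for y, continuous (fun y : R => (x, y))}.
Proof. exact: (@cvg_pair _ _ _ (nbhs y) (nbhs x) (nbhs y) _ _ _ (cst x) id (cvg_cst x) cvg_id). Qed.

Let pair_continuousl (y x : R) : {for x, continuous (fun x : R => (x, y))}.
Proof. exact: (@cvg_pair _ _ _ (nbhs x) (nbhs x) (nbhs y) _ _ _ id (cst y) cvg_id (cvg_cst y)). Qed.

Lemma prod_continuous_measurable (h : R * R -> R) : continuous h ->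
  measurable_fun setT (h : mR * mR -> R).
Proof.
move=> ch; apply: (measurability _ (RGenOpens.measurableE R)).
move=> _ [_ [a [b ->] <-]]; rewrite setTI.
apply: open_measurable_prod; apply: open_comp; last exact: interval_open.
by move=> x _; exact: ch.
Qed.

Lemma continuous_integrable_rect (h : R * R -> R) a b c d : continuous h ->
  leb2.-integrable (rect a b c d) (EFin \o h : mR * mR -> \bar R).
Proof.
move=> ch; apply: measurable_bounded_integrable.
- exact: measurable_rect.
- rewrite /rect [ltLHS]product_measure1E//.
  rewrite /= !lebesgue_measure_itv /=.
  by case: ifP => _; case: ifP => _; rewrite -?EFinD -?EFinM ?mul0e ?mule0 ?ltry.
- exact: measurable_funTS (prod_continuous_measurable ch).
- have cK : compact ([set` `[a, b]] `*` [set` `[c, d]] : set (R * R)).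
    by apply: compact_setX; exact: segment_compact.
  have /compact_bounded[M [Mr MP]] :
      compact (h @` ([set` `[a, b]] `*` [set` `[c, d]])).
    apply: continuous_compact cK; exact: continuous_subspaceT.
  exists M; split => // x Mx p rp; apply: MP Mx _ _.
  by exists p.
Qed.

Lemma Rintegral_FTC (F f : R -> R) (a b : R) : a < b ->
  (forall x : R, is_derive x 1 F (f x)) -> continuous f ->
  \int[leb]_(x in `[a, b]) f x = F b - F a.
Proof.
move=> ab dF cf.
have cF : continuous F.
  move=> x; apply/differentiable_continuous/derivable1_diffP.
  by case: (dF x).
rewrite /Rintegral (@continuous_FTC2 _ f F)//.
- exact: continuous_subspaceT.
- split.
  + by move=> x _; case: (dF x).
  + exact/cvg_at_right_filter/cF.
  + exact/cvg_at_left_filter/cF.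
- by move=> x _; rewrite derive1E; apply: derive_val.
Qed.

Let patch_rect (h : R * R -> R) a b c d x y :
  ((EFin \o h : mR * mR -> \bar R) \_ (rect a b c d)) (x, y) =
  if (x \in `[a, b]) && (y \in `[c, d]) then (h (x, y))%:E else 0%E.
Proof.
rewrite patchE; case: ifPn.
  by rewrite inE => -[/= -> ->].
rewrite notin_setE /rect /=; case: (x \in _); case: (y \in _) => //=.
by move=> /not_andP [].
Qed.

Lemma Rintegral_rect12 (h : R * R -> R) a b c d : continuous h ->
  \int[leb2]_(p in rect a b c d) h p =
  \int[leb]_(x in `[a, b]) \int[leb]_(y in `[c, d]) h (x, y).
Proof.
move=> ch; rewrite /Rintegral integral_mkcond.
have ih := (integrable_mkcond _ (measurable_rect a b c d)).1
  (continuous_integrable_rect a b c d ch).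
have ch1 x : continuous (fun y => h (x, y)).
  by move=> y; exact: (@continuous_comp _ _ _ (fun y => (x, y)) h y (@pair_continuousr x y) (ch _)).
rewrite -(integral12_prod_meas1 ih).
congr fine; rewrite [in RHS]integral_mkcond; apply: eq_integral => x _.
rewrite /fubini_F patchE.
under eq_integral => y _ do rewrite patch_rect.
case: ifPn => [/set_mem /= xab|/negP xab].
  rewrite xab /= fineK; last first.
    apply: integrable_fin_num => //; apply: continuous_compact_integrable.
      exact: segment_compact.
    exact: continuous_subspaceT.
  by rewrite [RHS]integral_mkcond; apply: eq_integral => y _;
    rewrite patchE mem_setE.
have -> /= : (x \in `[a, b]) = false.
  by apply/negP => ?; apply: xab; exact/mem_set.
exact: integral0.
Qed.

Lemma Rintegral_rect21 (h : R * R -> R) a b c d : continuous h ->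
  \int[leb2]_(p in rect a b c d) h p =
  \int[leb]_(y in `[c, d]) \int[leb]_(x in `[a, b]) h (x, y).
Proof.
move=> ch; rewrite /Rintegral integral_mkcond.
have ih := (integrable_mkcond _ (measurable_rect a b c d)).1
  (continuous_integrable_rect a b c d ch).
have ch1 y : continuous (fun x => h (x, y)).
  by move=> x; exact: (@continuous_comp _ _ _ (fun x => (x, y)) h x (@pair_continuousl y x) (ch _)).
rewrite -(integral21_prod_meas1 ih).
congr fine; rewrite [in RHS]integral_mkcond; apply: eq_integral => y _.
rewrite /fubini_G patchE.
under eq_integral => x _ do rewrite patch_rect andbC.
case: ifPn => [/set_mem /= yab|/negP yab].
  rewrite yab /= fineK; last first.
    apply: integrable_fin_num => //; apply: continuous_compact_integrable.
      exact: segment_compact.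
    exact: continuous_subspaceT.
  by rewrite [RHS]integral_mkcond; apply: eq_integral => x _;
    rewrite patchE mem_setE.
have -> /= : (y \in `[c, d]) = false.
  by apply/negP => ?; apply: yab; exact/mem_set.
exact: integral0.
Qed.

(** Green's formula: each term is integrated first in the variable of its
derivative, by Fubini's theorem and the fundamental theorem of calculus. *)
Lemma Rintegral_rect_div (A B A' B' : R * R -> R) a b c d :
  a < b -> c < d ->
  continuous A' -> continuous B' ->
  (forall x y : R, is_derive x 1 (fun x => A (x, y)) (A' (x, y))) ->
  (forall x y : R, is_derive y 1 (fun y => B (x, y)) (B' (x, y))) ->
  \int[leb2]_(p in rect a b c d) (A' p + B' p) =
  \int[leb]_(y in `[c, d]) (A (b, y) - A (a, y)) +
  \int[leb]_(x in `[a, b]) (B (x, d) - B (x, c)).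
Proof.
move=> ab cd cA cB dA dB.
rewrite RintegralD; last 3 first.
- exact: measurable_rect.
- exact: continuous_integrable_rect.
- exact: continuous_integrable_rect.
rewrite Rintegral_rect21// Rintegral_rect12//; congr (_ + _).
  apply: eq_Rintegral => y _; apply: (@Rintegral_FTC (fun x => A (x, y))) => // x.
  exact: (@continuous_comp _ _ _ (fun x => (x, y)) A' x (@pair_continuousl y x) (cA _)).
apply: eq_Rintegral => x _; apply: (@Rintegral_FTC (fun y => B (x, y))) => // y.
exact: (@continuous_comp _ _ _ (fun y => (x, y)) B' y (@pair_continuousr x y) (cB _)).
Qed.

End Rectangle.

(** * Calculus in R^3 minus the origin *)

Section Coordinates3.
Context {R : realType}.
Local Notation E3 := 'rV[R]_3.
Implicit Types (x y h : E3) (G : E3 -> R).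

Definition o0 : 'I_3 := @Ordinal 3 0 isT.
Definition o1 : 'I_3 := @Ordinal 3 1 isT.
Definition o2 : 'I_3 := @Ordinal 3 2 isT.

(** Sums over the three coordinates are expanded so that vector identities become
polynomial identities. *)
Lemma sum3E (V : nmodType) (F : 'I_3 -> V) : \sum_(i < 3) F i = F o0 + F o1 + F o2.
Proof.
rewrite !big_ord_recl big_ord0 addr0 addrA.
by congr (F _ + F _ + F _); apply: val_inj.
Qed.

Lemma forall3 (P : 'I_3 -> Prop) : P o0 -> P o1 -> P o2 -> forall i, P i.
Proof.
move=> P0 P1 P2 [[|[|[|//]]] i].
- by rewrite (_ : Ordinal i = o0) //; apply: val_inj.
- by rewrite (_ : Ordinal i = o1) //; apply: val_inj.
- by rewrite (_ : Ordinal i = o2) //; apply: val_inj.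
Qed.

Lemma row3E0 (a b c : R) : row3 a b c 0 o0 = a. Proof. by rewrite mxE. Qed.
Lemma row3E1 (a b c : R) : row3 a b c 0 o1 = b. Proof. by rewrite mxE. Qed.
Lemma row3E2 (a b c : R) : row3 a b c 0 o2 = c. Proof. by rewrite mxE. Qed.
Definition row3E := (row3E0, row3E1, row3E2).

Lemma dotE x y : dot x y = x 0 o0 * y 0 o0 + x 0 o1 * y 0 o1 + x 0 o2 * y 0 o2.
Proof. by rewrite /dot sum3E. Qed.

Lemma eq_row3 x y : (forall i, x 0 i = y 0 i) -> x = y.
Proof. by move=> xy; apply/matrixP => i j; rewrite ord1. Qed.

Lemma basis_sum x : x = \sum_(i < 3) x 0 i *: basis_vec i.
Proof. exact: row_sum_delta. Qed.

Lemma sphere_neq0 x : sphere x -> x != 0.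
Proof.
rewrite /sphere/= dotE => x1; apply/eqP => x0; move: x1.
by rewrite x0 !mxE !mulr0 !addr0 => /eqP; rewrite eq_sym oner_eq0.
Qed.

Lemma hext_sphere (W : Type) (f : E3 -> W) x : sphere x -> hext f x = f x.
Proof. by move=> x1; rewrite /hext /enorm x1 sqrtr1 invr1 scale1r. Qed.

Lemma rV_continuous (T : topologicalType) (c : T -> E3) (t : T) :
  (forall i, {for t, continuous (fun t => c t 0 i)}) -> {for t, continuous c}.
Proof.
move=> ci A [P nP PA].
have : \forall s \near t, forall j : 'I_3, P 0 j (c s 0 j).
  apply: (@filter_forall _ _ (fun j s => P 0 j (c s 0 j)) (nbhs t)) => j.
  exact: (ci j _ (nP 0 j)).
apply: filterS => s Ps; apply: PA => i j.
by rewrite ord1; exact: Ps.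
Qed.

Lemma derive_coordE G x h : differentiable G x ->
  'D_h G x = \sum_(i < 3) h 0 i * 'D_(basis_vec i) G x.
Proof.
move=> dG; rewrite deriveE// {1}(basis_sum h) linear_sum; apply: eq_bigr => i _.
by rewrite linearZ/= deriveE.
Qed.

(** The chain rule along a curve, in coordinates: differentiability of [G] at the
point is needed, not only its partial derivatives. *)
Lemma is_derive_along G (c c' : R -> E3) (t : R) :
  (forall i, is_derive t 1 (fun t => c t 0 i) (c' t 0 i)) ->
  differentiable G (c t) ->
  is_derive t 1 (fun t => G (c t)) (\sum_(i < 3) c' t 0 i * 'D_(basis_vec i) G (c t)).
Proof.
move=> dc dG.
have dct : derivable c t 1.
  by apply/derivable_mxP => i j; rewrite ord1; case: (dc j).
have cE : 'D_1 c t = c' t.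
  rewrite derive_mx//; apply: eq_row3 => i; rewrite mxE.
  by have d := dc i; apply: derive_val.
have dcd : differentiable c t by apply/derivable1_diffP.
have dGc : differentiable (G \o c) t by exact: differentiable_comp.
rewrite -derive_coordE//; apply: DeriveDef; first exact/derivable1_diffP.
rewrite (deriveE _ dGc) diff_comp//= -!deriveE// cE.
by [].
Qed.

(** For [hext f] this is by definition the regularity [C1_sphere f] of test functions.
Stated for functions on R^3 minus the origin, it is closed under sums and
products without any appeal to homogeneity. *)
Definition C1_off0 (W : normedModType R) (G : E3 -> W) : Prop :=
  forall x, x != 0 -> differentiable G x /\
    forall h, {for x, continuous (fun y => 'D_h G y)}.

Definition C0_off0 G : Prop := forall x, x != 0 -> {for x, continuous G}.

Lemma C1_off0_diff (W : normedModType R) (G : E3 -> W) x :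
  C1_off0 G -> x != 0 -> differentiable G x.
Proof. by move=> cG x0; case: (cG x x0). Qed.

Lemma C1_off0_C0 G : C1_off0 G -> C0_off0 G.
Proof. by move=> cG x x0; exact/differentiable_continuous/C1_off0_diff. Qed.

Lemma C1_off0_derive G h : C1_off0 G -> C0_off0 (fun x => 'D_h G x).
Proof. by move=> cG x x0; case: (cG x x0). Qed.

Lemma C0_off0_cst (a : R) : C0_off0 (fun=> a).
Proof. by move=> x _; exact: cst_continuous. Qed.

Lemma C0_off0_coord i : C0_off0 (fun x => x 0 i).
Proof. by move=> x _; exact: coord_continuous. Qed.

Lemma C0_off0D G1 G2 : C0_off0 G1 -> C0_off0 G2 -> C0_off0 (fun x => G1 x + G2 x).
Proof. by move=> c1 c2 x x0; exact: (cvgD (c1 x x0) (c2 x x0)). Qed.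

Lemma C0_off0M G1 G2 : C0_off0 G1 -> C0_off0 G2 -> C0_off0 (fun x => G1 x * G2 x).
Proof. by move=> c1 c2 x x0; exact: (cvgM (c1 x x0) (c2 x x0)). Qed.

Lemma C0_off0N G : C0_off0 G -> C0_off0 (fun x => - G x).
Proof. by move=> c x x0; exact: (cvgN (c x x0)). Qed.

Lemma C0_off0B G1 G2 : C0_off0 G1 -> C0_off0 G2 -> C0_off0 (fun x => G1 x - G2 x).
Proof. by move=> c1 c2; apply: C0_off0D => //; exact: C0_off0N. Qed.

Lemma C0_off0_sum (F : 'I_3 -> E3 -> R) :
  (forall i, C0_off0 (F i)) -> C0_off0 (fun x => \sum_(i < 3) F i x).
Proof.
move=> cF.
have -> : (fun x => \sum_(i < 3) F i x) = (fun x => F o0 x + F o1 x + F o2 x).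
  by apply/funext => x; exact: sum3E.
move=> x x0.
exact: (cvgD (cvgD (cF o0 x x0) (cF o1 x x0)) (cF o2 x x0)).
Qed.

Lemma near_neq0 x : x != 0 -> \forall y \near x, y != 0.
Proof.
move=> x0; have xp : 0 < `|x| by rewrite normr_gt0.
have : nbhs x (ball x `|x|) by exact: nbhsx_ballx.
apply: filterS => y; rewrite -ball_normE /= => xy.
by apply/eqP => y0; move: xy; rewrite y0 subr0 ltxx.
Qed.

Lemma C0_off0_near G1 G2 : (forall x, x != 0 -> G1 x = G2 x) -> C0_off0 G1 -> C0_off0 G2.
Proof.
move=> G12 c1 x x0; rewrite /prop_for /continuous_at -(G12 x x0).
apply: cvg_trans (c1 x x0); apply: (@near_eq_cvg _ _ (nbhs x)).
by near=> y; apply: G12; near: y; exact: near_neq0.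
Unshelve. all: by end_near. Qed.

Lemma C1_off0_cst (a : R) : C1_off0 (fun=> a).
Proof.
move=> x _; split; first exact: differentiable_cst.
move=> h; have -> : 'D_h (fun=> a) = cst 0 :> (E3 -> R).
  by apply/funext => y; exact: derive_cst.
exact: cst_continuous.
Qed.

Lemma derive_coord x h i : 'D_h (fun y : E3 => y 0 i) x = h 0 i.
Proof.
have := derive_mx (@derivable_id _ _ x h); rewrite derive_id => /matrixP/(_ 0 i).
by rewrite mxE => ->.
Qed.

Lemma C1_off0_coord i : C1_off0 (fun x => x 0 i).
Proof.
move=> x _; split; first exact: differentiable_coord.
move=> h; have -> : 'D_h (fun x : E3 => x 0 i) = cst (h 0 i) :> (E3 -> R).
  by apply/funext => y; exact: derive_coord.
exact: cst_continuous.
Qed.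

Lemma deriveM_off0 G1 G2 x h : C1_off0 G1 -> C1_off0 G2 -> x != 0 ->
  'D_h (fun x => G1 x * G2 x) x = G1 x * 'D_h G2 x + G2 x * 'D_h G1 x.
Proof.
by move=> c1 c2 x0; rewrite deriveM//; apply: diff_derivable; exact: C1_off0_diff.
Qed.

Lemma deriveD_off0 G1 G2 x h : C1_off0 G1 -> C1_off0 G2 -> x != 0 ->
  'D_h (fun x => G1 x + G2 x) x = 'D_h G1 x + 'D_h G2 x.
Proof.
by move=> c1 c2 x0; rewrite deriveD//; apply: diff_derivable; exact: C1_off0_diff.
Qed.

Lemma C1_off0D G1 G2 : C1_off0 G1 -> C1_off0 G2 -> C1_off0 (fun x => G1 x + G2 x).
Proof.
move=> c1 c2 x x0; split.
  by apply: differentiableD; exact: C1_off0_diff.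
move=> h; move: x x0.
apply: (@C0_off0_near (fun x => 'D_h G1 x + 'D_h G2 x)).
  by move=> x x0; rewrite deriveD_off0.
by apply: C0_off0D; exact: C1_off0_derive.
Qed.

Lemma C1_off0M G1 G2 : C1_off0 G1 -> C1_off0 G2 -> C1_off0 (fun x => G1 x * G2 x).
Proof.
move=> c1 c2 x x0; split.
  by apply: differentiableM; exact: C1_off0_diff.
move=> h; move: x x0.
apply: (@C0_off0_near (fun x => G1 x * 'D_h G2 x + G2 x * 'D_h G1 x)).
  by move=> x x0; rewrite deriveM_off0.
by apply: C0_off0D; apply: C0_off0M; do ?exact: C1_off0_derive; exact: C1_off0_C0.
Qed.

Lemma C1_off0_mxcoord (v : E3 -> E3) i : C1_off0 v -> C1_off0 (fun x => v x 0 i).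
Proof.
move=> cv x x0.
have dv y : y != 0 -> differentiable (fun x => v x 0 i) y.
  move=> y0; apply: (@differentiable_comp _ _ _ _ v (fun N : E3 => N 0 i)).
    exact: C1_off0_diff.
  exact: differentiable_coord.
split; first exact: dv.
move=> h; move: x x0.
apply: (@C0_off0_near (fun x => 'D_h v x 0 i)).
  move=> x x0; rewrite derive_mx ?mxE//.
  by apply: diff_derivable; exact: C1_off0_diff.
move=> x x0; have [_ /(_ h) cx] := cv x x0.
apply: (@continuous_comp _ _ _ (fun x => 'D_h v x) (fun N : E3 => N 0 i)) => //.
exact: coord_continuous.
Qed.

Lemma derive_mxcoord (v : E3 -> E3) x h i : C1_off0 v -> x != 0 ->
  ('D_h v x) 0 i = 'D_h (fun x => v x 0 i) x.
Proof.
move=> cv x0; rewrite derive_mx ?mxE//.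
by apply: diff_derivable; exact: C1_off0_diff.
Qed.

End Coordinates3.

(** * Borel sets and the area measure of the sphere *)

Section SphereMeasure.
Context {R : realType}.
Local Notation E3 := 'rV[R]_3.
Local Notation T := (R3 R).
Local Notation mR := (measurableTypeR R).
Local Notation leb := (@lebesgue_measure R).
Local Notation leb2 := (leb \x leb)%E.
Implicit Types (G : E3 -> R).

Lemma open_measurable_R3 (U : set E3) : open U -> measurable (U : set T).
Proof. by move=> oU; exact: sub_sigma_algebra. Qed.

(** On the complement of the origin, which is open, the preimage of an open
interval is open. *)
Lemma C0_off0_measurable_neq0 G : C0_off0 G ->
  measurable_fun ([set x | x != 0] : set T) (G : T -> R).
Proof.
move=> cG; apply: (measurability _ (RGenOpens.measurableE R)).
move=> _ [_ [a [b ->] <-]].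
suff oU : open ([set x | x != 0] `&` G @^-1` `]a, b[ : set E3).
  exact: open_measurable_R3.
rewrite openE => x [x0 Gx]; apply: filterI; first exact: near_neq0.
apply: cG => //; apply: open_nbhs_nbhs; split; [exact: interval_open|exact: Gx].
Qed.

Lemma continuous_measurable_R3 G : continuous G ->
  measurable_fun setT (G : T -> R).
Proof.
move=> cG; apply: (measurability _ (RGenOpens.measurableE R)).
move=> _ [_ [a [b ->] <-]]; rewrite setTI; apply: open_measurable_R3.
by apply: open_comp; [move=> x _; exact: cG|exact: interval_open].
Qed.

Lemma dot_continuous : continuous (fun x : E3 => dot x x).
Proof.
have -> : (fun x : E3 => dot x x) =
  (fun x => x 0 o0 * x 0 o0 + x 0 o1 * x 0 o1 + x 0 o2 * x 0 o2).
  by apply/funext => x; rewrite dotE.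
move=> x; have c i : {for x, continuous (fun y : E3 => y 0 i * y 0 i)}.
  exact: (cvgM (@coord_continuous _ _ _ 0 i x) (@coord_continuous _ _ _ 0 i x)).
exact: (cvgD (cvgD (c o0) (c o1)) (c o2)).
Qed.

Lemma measurable_sphere : measurable (sphere : set T).
Proof.
rewrite (_ : sphere = (fun x : T => dot x x) @^-1` [set 1]) //.
rewrite -[X in measurable X]setTI.
exact: (continuous_measurable_R3 dot_continuous).
Qed.

Lemma measurable_coord1 : measurable_fun setT (fun x : T => x 0 0 : R).
Proof. by apply: continuous_measurable_R3; exact: coord_continuous. Qed.

Lemma measurable_Con theta0 : measurable (Con theta0 : set T).
Proof.
rewrite (_ : Con theta0 = sphere `&` (fun x : T => x 0 0) @^-1` `[cos theta0, +oo[).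
  apply: measurableI; first exact: measurable_sphere.
  by rewrite -[X in measurable X]setTI; exact: measurable_coord1.
by apply/seteqP; split => x [Sx]; rewrite /= ?in_itv/= ?andbT => xc; split => //=;
  rewrite in_itv/= andbT.
Qed.

Lemma measurable_Omega theta0 : measurable (Omega theta0 : set T).
Proof. by apply: measurableD; [exact: measurable_sphere|exact: measurable_Con]. Qed.

Lemma measurable_Cbd theta0 : measurable (Cbd theta0 : set T).
Proof.
rewrite (_ : Cbd theta0 = sphere `&` (fun x : T => x 0 0) @^-1` [set cos theta0]) //.
apply: measurableI; first exact: measurable_sphere.
by rewrite -[X in measurable X]setTI; exact: measurable_coord1.
Qed.

Lemma measurable_Obar theta0 : measurable (Obar theta0 : set T).
Proof. by apply: measurableU; [exact: measurable_Omega|exact: measurable_Cbd]. Qed.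

Lemma Obar_sphere (theta0 : R) (x : E3) : Obar theta0 x -> sphere x.
Proof. by case=> -[]. Qed.

Lemma Omega_sphere (theta0 : R) (x : E3) : Omega theta0 x -> sphere x.
Proof. by case. Qed.

Lemma C0_off0_measurable G (A : set T) : (forall x : E3, A x -> sphere x) -> C0_off0 G ->
  measurable_fun A (G : T -> R).
Proof.
move=> AS cG; apply: measurable_funS (C0_off0_measurable_neq0 cG).
  have oU : open ([set x | x != 0] : set E3).
    by rewrite openE => x x0; exact: near_neq0.
  exact: open_measurable_R3.
by move=> x /AS; exact: sphere_neq0.
Qed.

Lemma compact_sphere : compact (sphere : set E3).
Proof.
apply: bounded_closed_compact.
  exists 1; split => // M M1 x; rewrite /sphere /= dotE => xx.
  apply/ltW/(le_lt_trans _ M1).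
  rewrite [leLHS]/Num.Def.normr/= mx_normrE; apply: bigmax_le => // -[i j] _ /=.
  rewrite ord1 -[X in _ <= X]ger0_norm// -ler_sqr ?nnegrE// !real_normK ?num_real//.
  rewrite expr1n -xx; move: j; apply: forall3; rewrite !expr2;
  have := sqr_ge0 (x 0 o0); have := sqr_ge0 (x 0 o1); have := sqr_ge0 (x 0 o2);
  rewrite !expr2; lra.
rewrite (_ : sphere = (fun x : E3 => dot x x) @^-1` [set 1]) //.
by apply: closed_comp => // x _; exact: dot_continuous.
Qed.

(** The sphere is compact. *)
Lemma C0_off0_bounded G : C0_off0 G -> [bounded G x | x in (sphere : set E3)].
Proof.
move=> cG.
have : {within sphere, continuous G}.
  apply: continuous_in_subspaceT => x /set_mem /sphere_neq0; exact: cG.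
move/continuous_compact => /(_ compact_sphere) /compact_bounded[M [Mr MP]].
exists M; split => // r Mr' x Sx; apply: MP Mr' _ _.
by exists x.
Qed.

Lemma C0_off0_integrable (mu : {finite_measure set T -> \bar R}) G (A : set T) :
  measurable A -> (forall x : E3, A x -> sphere x) -> C0_off0 G ->
  mu.-integrable A (EFin \o (G : T -> R)).
Proof.
move=> mA AS cG; apply: measurable_bounded_integrable => //.
- by rewrite -ge0_fin_numE// fin_num_measure.
- exact: C0_off0_measurable.
- have [M [Mr MP]] := C0_off0_bounded cG.
  by exists M; split => // r /MP rG x /AS; exact: rG.
Qed.

End SphereMeasure.

Section AreaChart.
Context {R : realType}.
Variable theta0 : R.
Hypothesis htheta0 : 0 < theta0 < pi / 2.
Local Notation E3 := 'rV[R]_3.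
Local Notation T := (R3 R).
Local Notation mR := (measurableTypeR R).
Local Notation leb := (@lebesgue_measure R).
Local Notation leb2 := (leb \x leb)%E.
Implicit Types (G : E3 -> R).

Lemma theta0_gt0 : 0 < theta0. Proof. by case/andP: htheta0. Qed.

Lemma theta0_lt_pi : theta0 < pi.
Proof. by have := pi_gt0 R; case/andP: htheta0; lra. Qed.

Lemma sin_theta0_gt0 : 0 < sin theta0.
Proof. by apply: sin_gt0_pi; rewrite theta0_gt0 theta0_lt_pi. Qed.

Lemma cos_theta0_gt0 : 0 < cos theta0.
Proof. by apply: cos_gt0_pihalf; case/andP: htheta0 => *; apply/andP; split; lra. Qed.

Lemma sphere_sph (t p : R) : sphere (sph t p).
Proof.
rewrite /sphere /= dotE /sph !row3E.
have := cos2Dsin2 t; have := cos2Dsin2 p; nra.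
Qed.

Lemma sph_continuous2 : continuous (fun q : R * R => sph q.1 q.2 : E3).
Proof.
have c1 : continuous (fst : R * R -> R) by move=> q; exact: cvg_fst.
have c2 : continuous (snd : R * R -> R) by move=> q; exact: cvg_snd.
have cS (g : R * R -> R) : continuous g -> continuous (fun p => sin (g p)).
  by move=> cg q; exact: (continuous_comp (cg q) (@continuous_sin R (g q))).
have cC (g : R * R -> R) : continuous g -> continuous (fun p => cos (g p)).
  by move=> cg q; exact: (continuous_comp (cg q) (@continuous_cos R (g q))).
have cM (f g : R * R -> R) : continuous f -> continuous g ->
    continuous (fun p => f p * g p).
  by move=> cf cg q; exact: (cvgM (cf q) (cg q)).
have ext (f g : R * R -> R) : (forall q, f q = g q) -> continuous g -> continuous f.
  by move=> fg; rewrite (funext fg).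
move=> q; apply: rV_continuous => i; move: i q; apply: forall3.
- by apply: ext => [q|]; [rewrite row3E|exact: (cC fst)].
- by apply: ext => [q|]; [rewrite row3E|apply: cM; [exact: (cS fst)|exact: (cC snd)]].
- by apply: ext => [q|]; [rewrite row3E|apply: cM; [exact: (cS fst)|exact: (cS snd)]].
Qed.

Lemma C0_off0_sph_continuous G : C0_off0 G ->
  continuous (fun q : R * R => G (sph q.1 q.2)).
Proof.
move=> cG q; apply: (continuous_comp (@sph_continuous2 q)).
exact: (cG _ (sphere_neq0 (sphere_sph _ _))).
Qed.

Lemma coord00 (x : E3) : x 0 0 = x 0 o0.
Proof. by congr (x _ _); apply: val_inj. Qed.

Lemma chart_pre_Omega :
  chart_pre (Omega theta0) = rect theta0 pi (- pi) pi `\` rect theta0 theta0 (- pi) pi.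
Proof.
have th := theta0_gt0; have tp := theta0_lt_pi.
apply/seteqP; split => -[t p].
  move=> [[/=]]; rewrite !in_itv/= => /andP[t0 tpi] pp [_ nC].
  have tt : theta0 < t.
    rewrite ltNge; apply/negP => tt; apply: nC; split; first exact: sphere_sph.
    by rewrite coord00 row3E leNgt ltr_cos ?in_itv/= -?leNgt ?t0 ?tpi ?(ltW th) ?(ltW tp).
  split; first by split; rewrite /= in_itv//= ?(ltW tt)// tpi.
  by move=> [/=]; rewrite in_itv/= => /andP[_]; rewrite leNgt tt.
move=> [[/=]]; rewrite !in_itv/= => /andP[t0 tpi] pp nC.
have tt : theta0 < t.
  rewrite lt_neqAle t0 andbT; apply/eqP => tE; apply: nC.
  by split; rewrite /= in_itv//= -tE lexx.
split; first by split; rewrite /= in_itv//= tpi (ltW (lt_trans th tt)).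
split; first exact: sphere_sph.
move=> [_]; rewrite coord00 row3E leNgt ltr_cos ?tt// in_itv/= ?tpi ?(ltW (lt_trans th tt))//.
by rewrite (ltW th) (ltW tp).
Qed.

Lemma leb2_seam : leb2 (rect theta0 theta0 (- pi) pi) = 0%E.
Proof.
rewrite /rect [LHS]product_measure1E//.
by rewrite /= set_itv1 lebesgue_measure_set1 mul0e.
Qed.

(** In the chart C is a vertical segment. *)
Lemma area_Cbd : area (Cbd theta0) = 0%E.
Proof.
rewrite /area.
have mC : measurable (chart_pre (Cbd theta0)).
  apply: measurableI; first exact: measurable_rect.
  rewrite -[X in measurable X]setTI; apply: measurable_sph => //.
  exact: measurable_Cbd.
apply: null_set_integral => //.
  apply/measurable_EFinP; apply: measurable_funTS.
  by apply: measurableT_comp => //; apply: continuous_measurable_fun;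
  exact: continuous_sin.
apply/eqP; rewrite eq_le measure_ge0 andbT -leb2_seam le_measure ?inE//.
  exact: measurable_rect.
have th := theta0_gt0; have tp := theta0_lt_pi.
move=> -[t p] [[/=]]; rewrite !in_itv/= => /andP[t0 tpi] pp [_].
rewrite coord00 row3E => tE.
have -> : t = theta0.
  by apply: cos_inj => //; rewrite in_itv/= ?t0 ?tpi// (ltW th) (ltW tp).
by split; rewrite /= in_itv/= ?lexx.
Qed.

(** The half-open rectangle that corresponds to Omega in the chart is replaced by
its closure: the additional edge theta = theta0 is a null set. *)
Lemma Rintegral_Omega G : C0_off0 G ->
  \int[@area R]_(x in Omega theta0) G x =
  \int[leb2]_(q in rect theta0 pi (- pi) pi) (G (sph q.1 q.2) * sin q.1).
Proof.
move=> cG.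
have cs : continuous (fun q : R * R => sin q.1).
  have c1 : continuous (fst : R * R -> R) by move=> q; exact: cvg_fst.
  by move=> q; exact: (continuous_comp (c1 q) (@continuous_sin R q.1)).
have ms : measurable_fun chart_rect (fun q : mR * mR => sin q.1).
  exact: measurable_funS (@subsetT _ _) (prod_continuous_measurable cs).
have s0 (q : mR * mR) : chart_rect q -> 0 <= sin q.1.
  by move=> [/=+ _]; rewrite in_itv/= => ?; exact: sin_ge0_pi.
rewrite (@Rintegral_density _ _ (mR * mR)%type T R leb2 _ _ _
  (measurable_rect 0 pi (- pi) pi) ms s0 measurable_sph (@area R) _ _ (fun A _ => erefl)
  (measurable_Omega theta0) (C0_off0_measurable (@Omega_sphere _ theta0) cG)).
have -> : chart_rect `&` (fun q : mR * mR => sph q.1 q.2) @^-1` Omega theta0 =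
          chart_pre (Omega theta0) by [].
rewrite chart_pre_Omega /Rintegral -negligible_integral//.
- exact: measurable_rect.
- exact: measurable_rect.
- apply: continuous_integrable_rect.
  have cgs : continuous (fun q : R * R => G (sph q.1 q.2) * sin q.1).
    by move=> q; exact: (cvgM (@C0_off0_sph_continuous G cG q) (cs q)).
  exact: cgs.
- exact: leb2_seam.
Qed.

End AreaChart.

(** * The divergence theorem on Omega *)

Section DeriveTools.
Context {R : realType}.
Implicit Types (f g : R -> R) (t : R).

Lemma is_derive_congr f t d d' : is_derive t 1 f d -> d = d' -> is_derive t 1 f d'.
Proof. by move=> ? <-. Qed.

Lemma is_derive_mulf f g t df dg : is_derive t 1 f df -> is_derive t 1 g dg ->
  is_derive t 1 (fun t => f t * g t) (df * g t + f t * dg).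
Proof.
move=> f' g'; have h := is_deriveM f' g'.
apply: (is_derive_congr h); rewrite -[f t *: dg]/(f t * dg) -[g t *: df]/(g t * df); ring.
Qed.

Lemma is_derive_addf f g t df dg : is_derive t 1 f df -> is_derive t 1 g dg ->
  is_derive t 1 (fun t => f t + g t) (df + dg).
Proof. by move=> f' g'; exact: is_deriveD. Qed.

Lemma is_derive_oppf f t df : is_derive t 1 f df ->
  is_derive t 1 (fun t => - f t) (- df).
Proof. by move=> f'; exact: is_deriveN. Qed.

Lemma is_derive_cstf (a t : R) : is_derive t 1 (fun=> a) 0.
Proof. exact: is_derive_cst. Qed.

Lemma is_derive_continuous f (f' : R -> R) :
  (forall t, is_derive t 1 f (f' t)) -> continuous f.
Proof.
move=> df t; apply/differentiable_continuous/derivable1_diffP.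
by case: (df t).
Qed.

End DeriveTools.

Section Continuity.
Context {R : realType} {X : topologicalType}.
Implicit Types (f g : X -> R).

Lemma continuous_addf f g : continuous f -> continuous g ->
  continuous (fun x => f x + g x).
Proof. by move=> cf cg x; exact: (cvgD (cf x) (cg x)). Qed.

Lemma continuous_mulf f g : continuous f -> continuous g ->
  continuous (fun x => f x * g x).
Proof. by move=> cf cg x; exact: (cvgM (cf x) (cg x)). Qed.

Lemma continuous_oppf f : continuous f -> continuous (fun x => - f x).
Proof. by move=> cf x; exact: (cvgN (cf x)). Qed.

Lemma continuous_cstf (a : R) : continuous (fun _ : X => a).
Proof. by move=> x; exact: cst_continuous. Qed.

Lemma continuous_sqrf f : continuous f -> continuous (fun x => f x ^+ 2).
Proof.
move=> cf; have -> : (fun x => f x ^+ 2) = (fun x => f x * f x).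
  by apply/funext => x; rewrite expr2.
exact: continuous_mulf.
Qed.

Lemma continuous_sinf f : continuous f -> continuous (fun x => sin (f x)).
Proof. by move=> cf x; exact: (continuous_comp (cf x) (@continuous_sin R (f x))). Qed.

Lemma continuous_cosf f : continuous f -> continuous (fun x => cos (f x)).
Proof. by move=> cf x; exact: (continuous_comp (cf x) (@continuous_cos R (f x))). Qed.

End Continuity.

(** Differentiates polynomial expressions in sin, cos and the functions whose
derivatives are among the hypotheses. *)
Ltac derivef := repeat first
  [ eassumption
  | apply: is_derive_addf | apply: is_derive_mulf
  | apply: is_derive_oppf | apply: is_derive_cstf
  | apply: is_derive_sin | apply: is_derive_cos ].

(** Splits a continuity goal syntactically along sums, products and squares; the
leaves are closed by the hypotheses, without any unfolding. *)
Ltac contf := lazymatch goal with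
  | |- continuous (fun _ => ?a) => apply: continuous_cstf
  | |- continuous (fun x => @GRing.add _ (@?f x) (@?g x)) =>
      apply: (@continuous_addf _ _ f g); contf
  | |- continuous (fun x => @GRing.mul _ (@?f x) (@?g x)) =>
      apply: (@continuous_mulf _ _ f g); contf
  | |- continuous (fun x => @GRing.opp _ (@?f x)) =>
      apply: (@continuous_oppf _ _ f); contf
  | |- continuous (fun x => @GRing.exp _ (@?f x) 2) =>
      apply: (@continuous_sqrf _ _ f); contf
  | |- continuous (fun x => sin (@?f x)) => apply: (@continuous_sinf _ _ f); contf
  | |- continuous (fun x => cos (@?f x)) => apply: (@continuous_cosf _ _ f); contf
  | |- _ => match goal with H : _ |- _ => simple apply H end
  end.

Section SphereDivergence.
Context {R : realType}.
Variable theta0 : R.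
Hypothesis htheta0 : 0 < theta0 < pi / 2.
Local Notation E3 := 'rV[R]_3.
Local Notation T := (R3 R).
Local Notation mR := (measurableTypeR R).
Local Notation leb := (@lebesgue_measure R).
Local Notation leb2 := (leb \x leb)%E.
Local Notation pd i G x := ('D_(basis_vec i) G x).

(** The divergence on S^2 of a tangent field given by its ambient components: the
trace of the ambient derivative minus its normal-normal part. It requires no
extension of the field that is homogeneous of degree 0. *)
Definition surf_div (G : 'I_3 -> E3 -> R) (x : E3) : R :=
  \sum_(i < 3) pd i (G i) x -
  \sum_(i < 3) \sum_(j < 3) x 0 i * x 0 j * pd i (G j) x.

Lemma surf_divE (G : 'I_3 -> E3 -> R) (x : E3) : surf_div G x =
  pd o0 (G o0) x + pd o1 (G o1) x + pd o2 (G o2) x -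
  (x 0 o0 * x 0 o0 * pd o0 (G o0) x + x 0 o0 * x 0 o1 * pd o0 (G o1) x
   + x 0 o0 * x 0 o2 * pd o0 (G o2) x
   + (x 0 o1 * x 0 o0 * pd o1 (G o0) x + x 0 o1 * x 0 o1 * pd o1 (G o1) x
      + x 0 o1 * x 0 o2 * pd o1 (G o2) x)
   + (x 0 o2 * x 0 o0 * pd o2 (G o0) x + x 0 o2 * x 0 o1 * pd o2 (G o1) x
      + x 0 o2 * x 0 o2 * pd o2 (G o2) x)).
Proof. by rewrite /surf_div !sum3E. Qed.

Lemma C0_off0_surf_div (G : 'I_3 -> E3 -> R) : (forall i, C1_off0 (G i)) ->
  C0_off0 (surf_div G).
Proof.
move=> cG; apply: C0_off0B.
  by apply: C0_off0_sum => i; apply: C1_off0_derive.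
apply: C0_off0_sum => i; apply: C0_off0_sum => j; apply: C0_off0M.
  by apply: C0_off0M; exact: C0_off0_coord.
exact: C1_off0_derive.
Qed.

Lemma is_derive_sph_theta G (t p : R) : C1_off0 G ->
  is_derive t 1 (fun t => G (sph t p))
    (- sin t * pd o0 G (sph t p) + cos t * cos p * pd o1 G (sph t p) +
     cos t * sin p * pd o2 G (sph t p)).
Proof.
move=> cG.
have := @is_derive_along R G (fun t => sph t p)
  (fun t => row3 (- sin t) (cos t * cos p) (cos t * sin p)) t.
rewrite sum3E !row3E; apply; last exact: C1_off0_diff cG (sphere_neq0 (sphere_sph _ _)).
apply: forall3; under [X in is_derive _ _ X _]funext => u do rewrite row3E;
  rewrite row3E.
- exact: is_derive_cos.
- by eapply is_derive_congr; [derivef|rewrite /=; ring].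
- by eapply is_derive_congr; [derivef|rewrite /=; ring].
Qed.

Lemma is_derive_sph_phi G (t p : R) : C1_off0 G ->
  is_derive p 1 (fun p => G (sph t p))
    (- (sin t * sin p) * pd o1 G (sph t p) + sin t * cos p * pd o2 G (sph t p)).
Proof.
move=> cG.
have := @is_derive_along R G (fun p => sph t p)
  (fun p => row3 0 (- (sin t * sin p)) (sin t * cos p)) p.
rewrite sum3E !row3E mul0r add0r; apply;
  last exact: C1_off0_diff cG (sphere_neq0 (sphere_sph _ _)).
apply: forall3; under [X in is_derive _ _ X _]funext => u do rewrite row3E;
  rewrite row3E.
- exact: is_derive_cstf.
- by eapply is_derive_congr; [derivef|rewrite /=; ring].
- by eapply is_derive_congr; [derivef|rewrite /=; ring].
Qed.

Section ChartFluxes.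
Variable G : 'I_3 -> E3 -> R.
Hypothesis cG : forall i, C1_off0 (G i).
Hypothesis tG : forall x, sphere x -> \sum_(i < 3) x 0 i * G i x = 0.

Let g i (q : R * R) : R := G i (sph q.1 q.2).
Let d i j (q : R * R) : R := pd i (G j) (sph q.1 q.2).

(** With e_theta = d(sph)/d(theta) and e_phi = (0, - sin phi, cos phi), these are
sin(theta) (G, e_theta) and (G, e_phi), the components whose divergence in the
chart is sin(theta) div G. *)
Definition flux_theta (q : R * R) : R := sin q.1 *
  (- sin q.1 * g o0 q + cos q.1 * cos q.2 * g o1 q + cos q.1 * sin q.2 * g o2 q).

Definition flux_phi (q : R * R) : R := - sin q.2 * g o1 q + cos q.2 * g o2 q.

Let g_theta j (q : R * R) : R := - sin q.1 * d o0 j q +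
  cos q.1 * cos q.2 * d o1 j q + cos q.1 * sin q.2 * d o2 j q.

Let g_phi j (q : R * R) : R :=
  - (sin q.1 * sin q.2) * d o1 j q + sin q.1 * cos q.2 * d o2 j q.

Let flux_theta' (q : R * R) : R :=
  cos q.1 * (- sin q.1 * g o0 q + cos q.1 * cos q.2 * g o1 q + cos q.1 * sin q.2 * g o2 q)
  + sin q.1 * (- cos q.1 * g o0 q - sin q.1 * cos q.2 * g o1 q - sin q.1 * sin q.2 * g o2 q)
  + sin q.1 * (- sin q.1 * g_theta o0 q + cos q.1 * cos q.2 * g_theta o1 q
               + cos q.1 * sin q.2 * g_theta o2 q).

Let flux_phi' (q : R * R) : R :=
  - cos q.2 * g o1 q - sin q.2 * g o2 q
  - sin q.2 * g_phi o1 q + cos q.2 * g_phi o2 q.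

Let is_derive_g_theta j (t p : R) :
  is_derive t 1 (fun t => g j (t, p)) (g_theta j (t, p)).
Proof. exact: is_derive_sph_theta. Qed.

Let is_derive_g_phi j (t p : R) :
  is_derive p 1 (fun p => g j (t, p)) (g_phi j (t, p)).
Proof. exact: is_derive_sph_phi. Qed.

Let is_derive_flux_theta (t p : R) :
  is_derive t 1 (fun t => flux_theta (t, p)) (flux_theta' (t, p)).
Proof.
have h0 := is_derive_g_theta o0 t p; have h1 := is_derive_g_theta o1 t p.
have h2 := is_derive_g_theta o2 t p.
rewrite /flux_theta /=.
by eapply is_derive_congr; [derivef|rewrite /flux_theta' /GRing.scale /=; ring].
Qed.

Let is_derive_flux_phi (t p : R) :
  is_derive p 1 (fun p => flux_phi (t, p)) (flux_phi' (t, p)).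
Proof.
have h1 := is_derive_g_phi o1 t p; have h2 := is_derive_g_phi o2 t p.
rewrite /flux_phi /=.
by eapply is_derive_congr; [derivef|rewrite /flux_phi' /GRing.scale /=; ring].
Qed.

Let continuous_g j : continuous (g j).
Proof. exact: (@C0_off0_sph_continuous _ _ (@C1_off0_C0 _ _ (cG j))). Qed.

Let continuous_d i j : continuous (d i j).
Proof. exact: (@C0_off0_sph_continuous _ _ (@C1_off0_derive _ _ (basis_vec i) (cG j))). Qed.

Let continuous_flux_theta' : continuous flux_theta'.
Proof.
have c1 : continuous (fst : R * R -> R) by move=> q; exact: cvg_fst.
have c2 : continuous (snd : R * R -> R) by move=> q; exact: cvg_snd.
have cg' j : continuous (fun q => g j q) by exact: continuous_g.
have cd i j : continuous (fun q => d i j q) by exact: continuous_d.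
by rewrite /flux_theta' /g_theta; contf.
Qed.

Let continuous_flux_phi' : continuous flux_phi'.
Proof.
have c1 : continuous (fst : R * R -> R) by move=> q; exact: cvg_fst.
have c2 : continuous (snd : R * R -> R) by move=> q; exact: cvg_snd.
have cg' j : continuous (fun q => g j q) by exact: continuous_g.
have cd i j : continuous (fun q => d i j q) by exact: continuous_d.
by rewrite /flux_phi' /g_phi; contf.
Qed.

Let flux_divergence q :
  surf_div G (sph q.1 q.2) * sin q.1 = flux_theta' q + flux_phi' q.
Proof.
have H := tG (sphere_sph q.1 q.2).
rewrite sum3E !row3E -!/(g _ q) in H.
have P : cos q.1 ^+ 2 + sin q.1 ^+ 2 - 1 = 0 by rewrite cos2Dsin2 subrr.
have Q : cos q.2 ^+ 2 + sin q.2 ^+ 2 - 1 = 0 by rewrite cos2Dsin2 subrr.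
rewrite /surf_div !sum3E !row3E -!/(d _ _ q).
rewrite /flux_theta' /flux_phi' /g_theta /g_phi.
move: (cos q.1) (sin q.1) (cos q.2) (sin q.2) H P Q => c s C S.
move: (g o0 q) (g o1 q) (g o2 q) => g0 g1 g2.
move: (d o0 o0 q) (d o0 o1 q) (d o0 o2 q) (d o1 o0 q) (d o1 o1 q) (d o1 o2 q)
  (d o2 o0 q) (d o2 o1 q) (d o2 o2 q) => d00 d01 d02 d10 d11 d12 d20 d21 d22.
move=> H P Q; apply/esym/eqP; rewrite -subr_eq0; apply/eqP.
(* coefficients of cos^2 + sin^2 - 1 for each of the two angles, and of (x, G) = 0 *)
transitivity (s * d00 * (c ^+ 2 + s ^+ 2 - 1)
  + s * d11 * (C ^+ 2 * (c ^+ 2 + s ^+ 2 - 1) + (C ^+ 2 + S ^+ 2 - 1))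
  + s * d22 * (S ^+ 2 * (c ^+ 2 + s ^+ 2 - 1) + (C ^+ 2 + S ^+ 2 - 1))
  + s * C * S * (d12 + d21) * (c ^+ 2 + s ^+ 2 - 1)
  + (g1 * C + g2 * S) * (c ^+ 2 + s ^+ 2 - 1)
  - 2 * s * (c * g0 + s * C * g1 + s * S * g2)); first by ring.
by rewrite P Q H; ring.
Qed.

Let flux_phi_periodic t : flux_phi (t, pi) - flux_phi (t, - pi) = 0.
Proof.
by rewrite /flux_phi /g /= /sph !cosN !sinN !sinpi !oppr0 subrr.
Qed.

(** Only the edge theta = theta0 contributes to Green's formula: at the pole
theta = pi the factor sin(theta) vanishes, and the edges phi = - pi and phi = pi
cancel by periodicity. *)
Lemma Rintegral_surf_div_phi :
  \int[@area R]_(x in Omega theta0) surf_div G x =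
  \int[leb]_(p in `[- pi, pi]) (sin theta0 *
    (sin theta0 * G o0 (sph theta0 p) - cos theta0 * cos p * G o1 (sph theta0 p)
     - cos theta0 * sin p * G o2 (sph theta0 p))).
Proof.
rewrite (Rintegral_Omega htheta0 (C0_off0_surf_div cG)).
under eq_Rintegral do rewrite flux_divergence.
have pp := pi_gt0 R; have tp := theta0_lt_pi htheta0.
have mpp : - pi < pi :> R by lra.
rewrite (@Rintegral_rect_div _ _ _ _ _ _ _ _ _ tp mpp continuous_flux_theta'
  continuous_flux_phi' is_derive_flux_theta is_derive_flux_phi).
rewrite [X in _ + X](_ : _ = 0) ?addr0; last first.
  under eq_Rintegral do rewrite flux_phi_periodic.
  by rewrite Rintegral_cst// mul0r.
apply: eq_Rintegral => p _.
by rewrite /flux_theta /g /= sinpi; ring.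
Qed.

End ChartFluxes.

Lemma Rintegral_arclength (f : R -> R) : continuous f ->
  \int[leb]_(s in `[0, clen theta0]) f (azimuth theta0 s) =
  \int[leb]_(p in `[- pi, pi]) (sin theta0 * f p).
Proof.
move=> cf; have s0 := sin_theta0_gt0 htheta0; have pp := pi_gt0 R.
pose F := azimuth theta0.
have dF (s : R) : is_derive s 1 F (sin theta0)^-1.
  by eapply is_derive_congr; [apply: is_derive_addf|rewrite /GRing.scale /=; ring].
have F'E : derive1 F = cst (sin theta0)^-1.
  by apply/funext => s; rewrite derive1E; have := dF s => ?; exact: derive_val.
have cF : continuous F := is_derive_continuous dF.
have F0 : F 0 = - pi by rewrite /F /azimuth mul0r add0r.
have FL : F (clen theta0) = pi.
  by rewrite /F /azimuth /clen mulfK ?gt_eqF//; ring.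
have L0 : 0 < clen theta0 by rewrite /clen !mulr_gt0.
have icf : leb.-integrable `[0, clen theta0] (EFin \o (f \o F)).
  apply: continuous_compact_integrable; first exact: segment_compact.
  by apply: continuous_subspaceT => s; apply: continuous_comp; [exact: cF|exact: cf].
rewrite RintegralZl//; last first.
  apply: continuous_compact_integrable; first exact: segment_compact.
  exact: continuous_subspaceT.
rewrite [X in _ * X](_ : _ = (sin theta0)^-1 *
    \int[leb]_(s in `[0, clen theta0]) f (F s)).
  by rewrite mulVKf// gt_eqF.
rewrite -F0 -FL /Rintegral integration_by_substitution_increasing//.
- rewrite -[LHS]/(Rintegral _ _ _) F'E.
  rewrite -RintegralZl//; apply: eq_Rintegral => s _.
  by rewrite /= mulrC.
- exact: ltW.
- by move=> x y _ _ xy; rewrite /F /azimuth ltrD2r ltr_pM2r// invr_gt0.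
- by move=> x _; rewrite F'E; exact: cst_continuous.
- by rewrite F'E; apply: is_cvg_cst.
- by rewrite F'E; apply: is_cvg_cst.
- split.
  + by move=> x _; case: (dF x).
  + exact/cvg_at_right_filter/cF.
  + exact/cvg_at_left_filter/cF.
- exact: continuous_subspaceT.
Qed.

(** The divergence theorem on Omega. The outward normal is - e_theta. *)
Lemma Rintegral_surf_div (G : 'I_3 -> E3 -> R) :
  (forall i, C1_off0 (G i)) ->
  (forall x, sphere x -> \sum_(i < 3) x 0 i * G i x = 0) ->
  \int[@area R]_(x in Omega theta0) surf_div G x =
  \int[leb]_(s in `[0, clen theta0])
    \sum_(i < 3) G i (curve theta0 s) * nvec theta0 s 0 i.
Proof.
move=> cG tG; rewrite (Rintegral_surf_div_phi cG tG).
rewrite -(Rintegral_arclength (f := fun p =>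
    (sin theta0 * G o0 (sph theta0 p) - cos theta0 * cos p * G o1 (sph theta0 p)
     - cos theta0 * sin p * G o2 (sph theta0 p)))).
  by apply: eq_Rintegral => s _; rewrite sum3E !row3E /curve; ring.
have cg i : continuous (fun p => G i (sph theta0 p)).
  by apply: is_derive_continuous => p; exact: is_derive_sph_phi.
have ci : continuous (@id R) by move=> x; exact: cvg_id.
by contf.
Qed.

End SphereDivergence.

(** * The upcoming flow *)

Section UpcomingFlowFields.
Context {R : realType}.
Variable alpha0 : R.
Local Notation E3 := 'rV[R]_3.
Local Notation pd i G x := ('D_(basis_vec i) G x).
Local Notation V := (V0 alpha0).
Local Notation W := (w0 alpha0).
Local Notation u i x := (u0 alpha0 x 0 i).

Lemma w0E : W = (fun x => V 0 o0 * x 0 o0 + V 0 o1 * x 0 o1 + V 0 o2 * x 0 o2).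
Proof. by apply/funext => x; rewrite /w0 dotE. Qed.

Lemma u0E i : (fun x => u i x) = (fun x => V 0 i + -1 * (W x * x 0 i)).
Proof. by apply/funext => x; rewrite /u0 !mxE mulN1r. Qed.

Lemma u0E_at i x : u i x = V 0 i - W x * x 0 i.
Proof. by rewrite /u0 !mxE. Qed.

Lemma C1_off0_w0 : C1_off0 W.
Proof.
rewrite w0E; do ?apply: C1_off0D; apply: C1_off0M;
  do ?[exact: C1_off0_cst|exact: C1_off0_coord].
Qed.

Lemma C1_off0_u0 i : C1_off0 (fun x => u i x).
Proof.
rewrite u0E; apply: C1_off0D; first exact: C1_off0_cst.
apply: C1_off0M; first exact: C1_off0_cst.
by apply: C1_off0M; [exact: C1_off0_w0|exact: C1_off0_coord].
Qed.

Lemma derive_w0 h x : x != 0 -> 'D_h W x = W h.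
Proof.
move=> x0; rewrite w0E.
have c i : C1_off0 (fun x : E3 => V 0 i * x 0 i).
  by apply: C1_off0M; [exact: C1_off0_cst|exact: C1_off0_coord].
have d i : 'D_h (fun x : E3 => V 0 i * x 0 i) x = V 0 i * h 0 i.
  rewrite (deriveM_off0 _ (C1_off0_cst (V 0 i)) (C1_off0_coord i))//.
  by rewrite derive_coord derive_cst mulr0 addr0.
rewrite (deriveD_off0 _ (C1_off0D (c o0) (c o1)) (c o2))//.
by rewrite (deriveD_off0 _ (c o0) (c o1))// !d.
Qed.

(** u0 x = V - w0(x) x with w0 linear. *)
Lemma derive_u0 i h x : x != 0 ->
  'D_h (fun x => u i x) x = - (W h * x 0 i) - W x * h 0 i.
Proof.
move=> x0; rewrite u0E.
have cwx : C1_off0 (fun x => W x * x 0 i).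
  by apply: C1_off0M; [exact: C1_off0_w0|exact: C1_off0_coord].
rewrite (deriveD_off0 _ (C1_off0_cst (V 0 i)) (C1_off0M (C1_off0_cst (-1)) cwx))//.
rewrite (deriveM_off0 _ (C1_off0_cst (-1)) cwx)//.
rewrite (deriveM_off0 _ C1_off0_w0 (C1_off0_coord i))//.
by rewrite !derive_cst derive_coord derive_w0//; ring.
Qed.

Lemma basis_vecE i j : basis_vec i 0 j = (j == i)%:R :> R.
Proof. by rewrite mxE eqxx. Qed.

Lemma w0_basis i : W (basis_vec i) = V 0 i.
Proof.
rewrite w0E !basis_vecE; move: i; apply: forall3;
by rewrite /= ?mulr0 ?mulr1 ?addr0 ?add0r.
Qed.

(** u0 is the projection of the constant vector V on the tangent planes. *)
Lemma u0_tangent x : sphere x -> \sum_(i < 3) x 0 i * u i x = 0.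
Proof.
rewrite /sphere /= dotE => x1; rewrite sum3E !u0E_at w0E.
move: x1; move: (x 0 o0) (x 0 o1) (x 0 o2) (V 0 o0) (V 0 o1) (V 0 o2).
move=> x1 x2 x3 a b c H.
transitivity ((a * x1 + b * x2 + c * x3) * (1 - (x1 * x1 + x2 * x2 + x3 * x3))); first by ring.
by rewrite H subrr mulr0.
Qed.

(** Leibniz' rule for f u0, and div u0 = - 2 w0 because u0 is the gradient of w0
and - w0 is half the Laplacian of w0 on S^2. *)
Lemma surf_div_u0 (f : E3 -> R) x : C1_off0 f -> sphere x ->
  surf_div (fun i x => f x * u i x) x =
  \sum_(i < 3) u i x * pd i f x - 2 * W x * f x.
Proof.
move=> cf Sx; have x0 := sphere_neq0 Sx.
have dE i j : pd i (fun x => f x * u j x) x =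
    f x * (- (V 0 i * x 0 j) - W x * (j == i)%:R) + u j x * pd i f x.
  by rewrite (deriveM_off0 _ cf (C1_off0_u0 j))// derive_u0// w0_basis basis_vecE.
rewrite surf_divE sum3E.
rewrite !dE.
rewrite /=.
rewrite !mulr1.
rewrite !mulr0.
have := u0_tangent Sx.
rewrite sum3E => H.
move: Sx; rewrite /sphere /= dotE => x1.
move: H x1.
move: (u o0 x) (u o1 x) (u o2 x) (pd o0 f x) (pd o1 f x) (pd o2 f x) (W x) (f x).
move: (x 0 o0) (x 0 o1) (x 0 o2) (V 0 o0) (V 0 o1) (V 0 o2).
move=> x1 x2 x3 a b c u1 u2 u3 d1 d2 d3 w F H S.
(* the two error terms vanish because (x, u0) = 0 and |x| = 1 *)
transitivity (u1 * d1 + u2 * d2 + u3 * d3 - 2 * w * F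
  - (x1 * u1 + x2 * u2 + x3 * u3) * (x1 * d1 + x2 * d2 + x3 * d3)
  + F * (w + (a * x1 + b * x2 + c * x3)) * ((x1 * x1 + x2 * x2 + x3 * x3) - 1)).
  ring.
by rewrite H S; ring.
Qed.

Lemma u0_V x : sphere x -> \sum_(i < 3) u i x * V 0 i = dot (u0 alpha0 x) (u0 alpha0 x).
Proof.
move=> Sx; have := u0_tangent Sx; rewrite dotE !sum3E => H.
have e i : V 0 i = u i x + W x * x 0 i by rewrite u0E_at; ring.
rewrite !e; move: H; move: (x 0 o0) (x 0 o1) (x 0 o2) (u o0 x) (u o1 x) (u o2 x) (W x).
move=> x1 x2 x3 u1 u2 u3 w H.
transitivity (u1 * u1 + u2 * u2 + u3 * u3 + w * (x1 * u1 + x2 * u2 + x3 * u3)).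
  by ring.
by rewrite H mulr0 addr0.
Qed.

(** The case of [w0 f] in [surf_div_u0], with (u0, grad w0) = (u0, V) = |u0|^2. *)
Lemma surf_div_w0u0 (f : E3 -> R) x : C1_off0 f -> sphere x ->
  surf_div (fun i x => (W x * f x) * u i x) x =
  W x * (\sum_(i < 3) u i x * pd i f x) + dot (u0 alpha0 x) (u0 alpha0 x) * f x
  - 2 * (W x ^+ 2 * f x).
Proof.
move=> cf Sx; have x0 := sphere_neq0 Sx.
rewrite (surf_div_u0 (C1_off0M C1_off0_w0 cf) Sx) -u0_V// !sum3E.
by rewrite !(deriveM_off0 _ C1_off0_w0 cf)// !derive_w0// !w0_basis; ring.
Qed.

(** The case of (u0, v) in [surf_div_u0]. The derivative of u0 along itself is
- |u0|^2 x - w0 u0, whose product with the tangent field v is - w0 (u0, v);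
this turns the factor 2 into 3. *)
Lemma surf_div_dotu0 (v : 'I_3 -> E3 -> R) x :
  (forall i, C1_off0 (v i)) -> sphere x -> \sum_(i < 3) x 0 i * v i x = 0 ->
  surf_div (fun i x => (\sum_(j < 3) u j x * v j x) * u i x) x =
  \sum_(i < 3) \sum_(j < 3) u i x * u j x * pd i (v j) x
  - 3 * (W x * \sum_(j < 3) u j x * v j x).
Proof.
move=> cv Sx tv; have x0 := sphere_neq0 Sx.
have cuv j : C1_off0 (fun x => u j x * v j x) by apply: C1_off0M => //; exact: C1_off0_u0.
have sE : (fun x => \sum_(j < 3) u j x * v j x) =
    (fun x => u o0 x * v o0 x + u o1 x * v o1 x + u o2 x * v o2 x).
  by apply/funext => y; rewrite sum3E.
have cs : C1_off0 (fun x => \sum_(j < 3) u j x * v j x).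
  by rewrite sE; do ?apply: C1_off0D.
rewrite (surf_div_u0 cs Sx) !sum3E sE.
have dE i : pd i (fun x => u o0 x * v o0 x + u o1 x * v o1 x + u o2 x * v o2 x) x =
    \sum_(j < 3) (u j x * pd i (v j) x +
       v j x * (- (V 0 i * x 0 j) - W x * (j == i)%:R)).
  rewrite (deriveD_off0 _ (C1_off0D (cuv o0) (cuv o1)) (cuv o2))//.
  rewrite (deriveD_off0 _ (cuv o0) (cuv o1))// sum3E.
  rewrite !(deriveM_off0 _ (C1_off0_u0 _) (cv _))//.
  by rewrite !derive_u0// !w0_basis !basis_vecE.
rewrite !dE !sum3E /= !mulr1 !mulr0.
rewrite sum3E in tv.
move: tv; move: (u o0 x) (u o1 x) (u o2 x) (v o0 x) (v o1 x) (v o2 x) (W x).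
move: (x 0 o0) (x 0 o1) (x 0 o2) (V 0 o0) (V 0 o1) (V 0 o2).
move=> x1 x2 x3 a b c u1 u2 u3 v1 v2 v3 w H.
set d := fun i j => pd i (v j) x; rewrite -!/(d _ _).
move: (d o0 o0) (d o0 o1) (d o0 o2) (d o1 o0) (d o1 o1) (d o1 o2)
  (d o2 o0) (d o2 o1) (d o2 o2) => d00 d01 d02 d10 d11 d12 d20 d21 d22.
apply/eqP; rewrite -subr_eq0; apply/eqP.
transitivity (- (u1 * a + u2 * b + u3 * c) * (x1 * v1 + x2 * v2 + x3 * v3)); first by ring.
by rewrite H mulr0.
Qed.

End UpcomingFlowFields.

(** * The boundary circle C *)

Section Circle.
Context {R : realType}.
Variable theta0 : R.
Hypothesis htheta0 : 0 < theta0 < pi / 2.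
Local Notation E3 := 'rV[R]_3.
Local Notation leb := (@lebesgue_measure R).
Local Notation pd i G x := ('D_(basis_vec i) G x).
Local Notation L := (clen theta0).
Local Notation c := (curve theta0).
Local Notation t := (tvec theta0).
Local Notation n := (nvec theta0).

Lemma clen_gt0 : 0 < L.
Proof. by rewrite /clen !mulr_gt0// ?pi_gt0// sin_theta0_gt0. Qed.

Lemma sphere_curve s : sphere (c s).
Proof. exact: sphere_sph. Qed.

Lemma azimuthD s : azimuth theta0 (s + L) = azimuth theta0 s + pi *+ 2.
Proof.
have s0 := sin_theta0_gt0 htheta0.
by rewrite /azimuth /clen mulrDl mulfK ?gt_eqF//; ring.
Qed.

Lemma curve_periodic s : c (s + L) = c s.
Proof. by rewrite /curve azimuthD /sph cosD2pi sinD2pi. Qed.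

Lemma tvec_periodic s : t (s + L) = t s.
Proof. by rewrite /tvec azimuthD cosD2pi sinD2pi. Qed.

Lemma is_derive_azimuth (s : R) : is_derive s 1 (azimuth theta0) (sin theta0)^-1.
Proof.
by eapply is_derive_congr; [apply: is_derive_addf|rewrite /GRing.scale /=; ring].
Qed.

Lemma continuous_azimuth : continuous (azimuth theta0).
Proof. exact: is_derive_continuous is_derive_azimuth. Qed.

Lemma is_derive_sin_azimuth (s : R) :
  is_derive s 1 (fun s => sin (azimuth theta0 s)) ((sin theta0)^-1 * cos (azimuth theta0 s)).
Proof.
have h := @is_derive1_comp _ sin (azimuth theta0) s _ _
  (is_derive_sin (azimuth theta0 s)) (is_derive_azimuth s).
by apply: (is_derive_congr h); rewrite /GRing.scale /=; ring.
Qed.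

Lemma is_derive_cos_azimuth (s : R) :
  is_derive s 1 (fun s => cos (azimuth theta0 s)) (- ((sin theta0)^-1 * sin (azimuth theta0 s))).
Proof.
have h := @is_derive1_comp _ cos (azimuth theta0) s _ _
  (is_derive_cos (azimuth theta0 s)) (is_derive_azimuth s).
by apply: (is_derive_congr h); rewrite /GRing.scale /=; ring.
Qed.

(** [curve] is parametrized by arc length, with velocity [tvec]. *)
Lemma is_derive_curve G (s : R) : C1_off0 G ->
  is_derive s 1 (fun s => G (c s)) (\sum_(i < 3) t s 0 i * pd i G (c s)).
Proof.
move=> cG; have s0 := sin_theta0_gt0 htheta0.
apply: is_derive_along; last exact: C1_off0_diff cG (sphere_neq0 (sphere_curve _)).
have hs := is_derive_sin_azimuth s; have hc := is_derive_cos_azimuth s.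
apply: forall3; under [X in is_derive _ _ X _]funext => u do rewrite row3E;
  rewrite row3E.
- exact: is_derive_cstf.
- eapply is_derive_congr; [apply: is_derive_mulf|rewrite /GRing.scale /=].
  by field; rewrite gt_eqF.
- eapply is_derive_congr; [apply: is_derive_mulf|rewrite /GRing.scale /=].
  by field; rewrite gt_eqF.
Qed.

(** The acceleration of [curve]: the sphere contributes - x, and the geodesic
curvature of the circle of polar angle theta0 contributes cot(theta0) n. *)
Lemma is_derive_tvec i (s : R) :
  is_derive s 1 (fun s => t s 0 i)
    (- c s 0 i + cos theta0 / sin theta0 * n s 0 i).
Proof.
have s0 := sin_theta0_gt0 htheta0.
have hs := is_derive_sin_azimuth s; have hc := is_derive_cos_azimuth s.
have P := cos2Dsin2 theta0.
move: i; apply: forall3; under [X in is_derive _ _ X _]funext => u do rewrite row3E;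
  rewrite !row3E.
- by eapply is_derive_congr; [apply: is_derive_cstf|field; rewrite gt_eqF].
- eapply is_derive_congr; [apply: is_derive_oppf|rewrite /=].
  transitivity (- ((cos theta0 ^+ 2 + sin theta0 ^+ 2) * ((sin theta0)^-1 * cos (azimuth theta0 s)))).
    by rewrite P mul1r.
  by field; rewrite gt_eqF.
- eapply is_derive_congr; [exact: hc|rewrite /=].
  transitivity (- ((cos theta0 ^+ 2 + sin theta0 ^+ 2) * ((sin theta0)^-1 * sin (azimuth theta0 s)))).
    by rewrite P mul1r.
  by field; rewrite gt_eqF.
Qed.

Lemma dot_tvec_curve s : dot (c s) (t s) = 0.
Proof. by rewrite dotE !row3E; ring. Qed.

(** Along C, (t, n) is an orthonormal basis of the tangent plane. *)
Lemma frame_dot (x y : 'I_3 -> R) s :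
  \sum_(i < 3) c s 0 i * x i = 0 -> \sum_(i < 3) c s 0 i * y i = 0 ->
  \sum_(i < 3) x i * y i =
  (\sum_(i < 3) x i * t s 0 i) * (\sum_(i < 3) y i * t s 0 i) +
  (\sum_(i < 3) x i * n s 0 i) * (\sum_(i < 3) y i * n s 0 i).
Proof.
have P : cos theta0 ^+ 2 + sin theta0 ^+ 2 - 1 = 0 by rewrite cos2Dsin2 subrr.
have Q : cos (azimuth theta0 s) ^+ 2 + sin (azimuth theta0 s) ^+ 2 - 1 = 0.
  by rewrite cos2Dsin2 subrr.
rewrite !sum3E !row3E.
move: (cos theta0) (sin theta0) (cos (azimuth theta0 s)) (sin (azimuth theta0 s)) P Q => a b C S P Q.
move: (x o0) (x o1) (x o2) (y o0) (y o1) (y o2) => x0 x1 x2 y0 y1 y2 H1 H2.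
apply/eqP; rewrite -subr_eq0; apply/eqP.
(* completes (t, n) into the orthonormal basis (x, t, n) of R^3 *)
transitivity ((a * x0 + b * C * x1 + b * S * x2) * (a * y0 + b * C * y1 + b * S * y2)
  - (a ^+ 2 + b ^+ 2 - 1) * (x0 * y0 + (C * x1 + S * x2) * (C * y1 + S * y2))
  - (C ^+ 2 + S ^+ 2 - 1) * (x1 * y1 + x2 * y2)); first by ring.
by rewrite P Q H1; ring.
Qed.

Lemma continuous_integrable_circle (f : R -> R) : continuous f ->
  leb.-integrable `[0, L] (EFin \o f).
Proof.
move=> cf; apply: continuous_compact_integrable; first exact: segment_compact.
exact: continuous_subspaceT.
Qed.

(** There is no boundary term on a closed curve. *)
Lemma circle_by_parts (f g f' g' : R -> R) :
  (forall s : R, is_derive s 1 f (f' s)) -> (forall s : R, is_derive s 1 g (g' s)) ->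
  continuous f' -> continuous g' -> f L = f 0 -> g L = g 0 ->
  \int[leb]_(s in `[0, L]) (f' s * g s + f s * g' s) = 0.
Proof.
move=> df dg cf' cg' fL gL.
have cf := is_derive_continuous df; have cg := is_derive_continuous dg.
have dfg (s : R) : is_derive s 1 (fun s => f s * g s) (f' s * g s + f s * g' s).
  exact: is_derive_mulf.
have cfg : continuous (fun s => f' s * g s + f s * g' s) by contf.
by rewrite (Rintegral_FTC clen_gt0 dfg cfg) fL gL subrr.
Qed.

Lemma continuous_curve G : C0_off0 G -> continuous (fun s => G (c s)).
Proof.
move=> cG s; apply: (@continuous_comp _ _ _ c G).
  apply: rV_continuous => i.
  exact: (is_derive_continuous (fun s => is_derive_curve s (C1_off0_coord i))).
exact: (cG _ (sphere_neq0 (sphere_curve s))).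
Qed.

Lemma continuous_tvec i : continuous (fun s => t s 0 i).
Proof. exact: is_derive_continuous (is_derive_tvec i). Qed.

Lemma continuous_nvec i : continuous (fun s => n s 0 i).
Proof.
have ca := continuous_azimuth.
have ext (f g : R -> R) : (forall q, f q = g q) -> continuous g -> continuous f.
  by move=> fg; rewrite (funext fg).
move: i; apply: forall3; (apply: ext => [q|]; [rewrite row3E; reflexivity|contf]).
Qed.

End Circle.

(** * Balance laws for a concentrated layer *)

Section Balance.
Context {R : realType}.
Variables theta0 alpha0 : R.
Hypothesis htheta0 : 0 < theta0 < pi / 2.
Local Notation E3 := 'rV[R]_3.
Local Notation leb := (@lebesgue_measure R).
Local Notation pd i G x := ('D_(basis_vec i) G x).
Local Notation L := (clen theta0).
Local Notation c := (curve theta0).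
Local Notation t := (tvec theta0).
Local Notation n := (nvec theta0).
Local Notation W := (w0 alpha0).
Local Notation u i x := (u0 alpha0 x 0 i).
Local Notation IO F := (\int[@area R]_(x in Omega theta0) F x).
Local Notation IC f := (\int[leb]_(s in `[0, L]) f s).

Lemma integrable_Omega F : C0_off0 F ->
  (@area R).-integrable (Omega theta0) (EFin \o (F : R3 R -> R)).
Proof.
move=> cF; exact: (@C0_off0_integrable _ (@area R) F _ (measurable_Omega theta0)
  (@Omega_sphere _ theta0) cF).
Qed.

Lemma Rintegral_OmegaD F G : C0_off0 F -> C0_off0 G ->
  \int[@area R]_(x in Omega theta0) (F x + G x) = IO F + IO G.
Proof.
move=> cF cG; apply: RintegralD; [exact: measurable_Omega|exact: integrable_Omega..].
Qed.

Lemma Rintegral_OmegaZ a F : C0_off0 F ->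
  \int[@area R]_(x in Omega theta0) (a * F x) = a * IO F.
Proof.
by move=> cF; apply: RintegralZl; [exact: measurable_Omega|exact: integrable_Omega].
Qed.

Lemma eq_Rintegral_Omega (F G : E3 -> R) : (forall x, sphere x -> F x = G x) -> IO F = IO G.
Proof.
by move=> FG; apply: eq_Rintegral => x /set_mem /Omega_sphere; exact: FG.
Qed.

Lemma Rintegral_circleD (f g : R -> R) : continuous f -> continuous g ->
  \int[leb]_(s in `[0, L]) (f s + g s) = IC f + IC g.
Proof.
by move=> cf cg; apply: RintegralD => //; exact: continuous_integrable_circle.
Qed.

Lemma Rintegral_circleZ a (f : R -> R) : continuous f ->
  \int[leb]_(s in `[0, L]) (a * f s) = a * IC f.
Proof. by move=> cf; apply: RintegralZl => //; exact: continuous_integrable_circle. Qed.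

Lemma eq_Rintegral_circle (f g : R -> R) : f =1 g -> IC f = IC g.
Proof. by move=> fg; apply: eq_Rintegral => s _; exact: fg. Qed.

Definition u0n (s : R) : R := dot (u0 alpha0 (c s)) (n s).
Definition u0t (s : R) : R := dot (u0 alpha0 (c s)) (t s).

Lemma continuous_u0c i : continuous (fun s => u i (c s)).
Proof. exact: (@continuous_curve _ _ htheta0 _ (@C1_off0_C0 _ _ (C1_off0_u0 alpha0 i))). Qed.

Lemma continuous_u0n : continuous u0n.
Proof.
have -> : u0n = (fun s => u o0 (c s) * n s 0 o0 + u o1 (c s) * n s 0 o1 + u o2 (c s) * n s 0 o2).
  by apply/funext => s; rewrite /u0n dotE.
have cu i : continuous (fun s => u i (c s)) by exact: continuous_u0c.
have cn i : continuous (fun s => n s 0 i) by exact: continuous_nvec.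
by contf.
Qed.

Lemma continuous_u0t : continuous u0t.
Proof.
have -> : u0t = (fun s => u o0 (c s) * t s 0 o0 + u o1 (c s) * t s 0 o1 + u o2 (c s) * t s 0 o2).
  by apply/funext => s; rewrite /u0t dotE.
have cu i : continuous (fun s => u i (c s)) by exact: continuous_u0c.
have ct i : continuous (fun s => t s 0 i) by exact: continuous_tvec.
by contf.
Qed.

Lemma C0_off0_u0grad (psi : E3 -> R) : C1_off0 psi ->
  C0_off0 (fun x => \sum_(i < 3) u i x * pd i psi x).
Proof.
move=> cp; apply: C0_off0_sum => i; apply: C0_off0M.
  exact: (@C1_off0_C0 _ _ (C1_off0_u0 alpha0 i)).
exact: (@C1_off0_derive _ _ (basis_vec i) cp).
Qed.

Lemma C0_off0_w0 : C0_off0 W.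
Proof. exact: (@C1_off0_C0 _ _ (C1_off0_w0 alpha0)). Qed.

Lemma C0_off0_u0sq : C0_off0 (fun x => dot (u0 alpha0 x) (u0 alpha0 x)).
Proof.
apply: C0_off0_sum => i; apply: C0_off0M;
  exact: (@C1_off0_C0 _ _ (C1_off0_u0 alpha0 i)).
Qed.

Lemma u0_tangentM (f : E3 -> R) x : sphere x ->
  \sum_(i < 3) x 0 i * (f x * u i x) = 0.
Proof.
move=> Sx; transitivity (f x * \sum_(i < 3) x 0 i * u i x); last by rewrite u0_tangent// mulr0.
by rewrite mulr_sumr; apply: eq_bigr => i _; rewrite mulrCA.
Qed.

(** The flux through C of the quantity f carried by the upcoming flow. *)
Lemma Rintegral_surf_div_u0 (f : E3 -> R) : C1_off0 f ->
  IO (surf_div (fun i x => f x * u i x)) = \int[leb]_(s in `[0, L]) (f (c s) * u0n s).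
Proof.
move=> cf; rewrite (Rintegral_surf_div htheta0); last 2 first.
- by move=> i; exact: (@C1_off0M _ _ _ cf (C1_off0_u0 alpha0 i)).
- by move=> x Sx; exact: u0_tangentM.
apply: eq_Rintegral_circle => s; rewrite /u0n /dot mulr_sumr; apply: eq_bigr => i _.
by rewrite mulrA.
Qed.

Variables wrho ut w : R -> R.
Hypotheses (cwrho : continuous wrho) (cut : continuous ut) (cw : continuous w).
Hypotheses (pwrho : wrho L = wrho 0) (put : ut L = ut 0) (pw : w L = w 0).

Let cp (psi : E3 -> R) : C1_off0 psi -> continuous (fun s => psi (c s)).
Proof. by move=> cpsi; exact: (@continuous_curve _ _ htheta0 _ (@C1_off0_C0 _ _ cpsi)). Qed.

Lemma continuous_tangential_derivative (psi : E3 -> R) : C1_off0 psi ->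
  continuous (fun s => \sum_(i < 3) t s 0 i * pd i psi (c s)).
Proof.
move=> cpsi.
have -> : (fun s => \sum_(i < 3) t s 0 i * pd i psi (c s)) =
  (fun s => t s 0 o0 * pd o0 psi (c s) + t s 0 o1 * pd o1 psi (c s) + t s 0 o2 * pd o2 psi (c s)).
  by apply/funext => s; exact: sum3E.
have cpd i : continuous (fun s => pd i psi (c s)).
  exact: (@continuous_curve _ _ htheta0 _ (@C1_off0_derive _ _ (basis_vec i) cpsi)).
have ct i : continuous (fun s => t s 0 i) by exact: continuous_tvec.
by contf.
Qed.

Let curve_L (F : E3 -> R) : F (c L) = F (c 0).
Proof. by rewrite -[in LHS](add0r L) curve_periodic. Qed.

(** The flux of psi u0 through C, supplied by Omega, is (u0, n) psi; integration by
parts along C turns w_rho u^t (t, grad psi) into - (w_rho u^t)' psi. The equation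
for w_rho u^t cancels them. *)
Lemma mass_balance (psi : E3 -> R) :
  (forall s : R, is_derive s 1 (fun s => wrho s * ut s) (u0n s - 2 * wrho s * w s)) ->
  C1_off0 psi ->
  \int[@area R]_(x in Omega theta0) (\sum_(i < 3) u i x * pd i psi x) +
  \int[leb]_(s in `[0, L]) (wrho s * ut s * \sum_(i < 3) t s 0 i * pd i psi (c s)) =
  2 * (\int[@area R]_(x in Omega theta0) (W x * psi x) +
       \int[leb]_(s in `[0, L]) (wrho s * w s * psi (c s))).
Proof.
move=> df cpsi.
have cu0n := continuous_u0n; have cpc := cp cpsi; have ctg := continuous_tangential_derivative cpsi.
have D := Rintegral_surf_div_u0 cpsi.
have cWp : C0_off0 (fun x => W x * psi x).
  by apply: C0_off0M; [exact: C0_off0_w0|exact: (@C1_off0_C0 _ _ cpsi)].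
rewrite (@eq_Rintegral_Omega _ (fun x => (\sum_(i < 3) u i x * pd i psi x) + (- 2) * (W x * psi x))) in D; last first.
  by move=> x Sx; rewrite surf_div_u0//; ring.
rewrite Rintegral_OmegaD ?Rintegral_OmegaZ// in D; last 2 first.
- exact: C0_off0_u0grad.
- by apply: C0_off0M => //; exact: C0_off0_cst.
have Z := circle_by_parts htheta0 df (fun s => is_derive_curve htheta0 s cpsi).
rewrite /= pwrho put curve_L in Z.
have {}Z := Z (ltac:(contf)) ctg erefl erefl.
rewrite (@eq_Rintegral_circle _ (fun s => psi (c s) * u0n s + (- 2) * (wrho s * w s * psi (c s))
  + wrho s * ut s * \sum_(i < 3) t s 0 i * pd i psi (c s))) in Z; last first.
  by move=> s; ring.
rewrite Rintegral_circleD in Z; [|by contf..].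
rewrite Rintegral_circleD in Z; [|by contf..].
rewrite Rintegral_circleZ in Z; [|by contf].
lra.
Qed.

(** As for [mass_balance], with the flux of w0 psi u0 and the equation for
w_rho u^t w. *)
Lemma radial_balance (psi : E3 -> R) :
  (forall s : R, is_derive s 1 (fun s => wrho s * ut s * w s)
     (W (c s) * u0n s + wrho s * ut s ^+ 2 - 2 * wrho s * w s ^+ 2)) ->
  C1_off0 psi ->
  \int[@area R]_(x in Omega theta0) (W x * \sum_(i < 3) u i x * pd i psi x) +
  \int[leb]_(s in `[0, L]) (wrho s * ut s * w s * \sum_(i < 3) t s 0 i * pd i psi (c s)) =
  2 * (\int[@area R]_(x in Omega theta0) (W x ^+ 2 * psi x) +
       \int[leb]_(s in `[0, L]) (wrho s * w s ^+ 2 * psi (c s))) -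
  (\int[@area R]_(x in Omega theta0) (dot (u0 alpha0 x) (u0 alpha0 x) * psi x) +
   \int[leb]_(s in `[0, L]) (wrho s * ut s ^+ 2 * psi (c s))).
Proof.
move=> df cpsi.
have cu0n := continuous_u0n; have cpc := cp cpsi; have ctg := continuous_tangential_derivative cpsi.
have cWc := cp (C1_off0_w0 alpha0).
have cp0 : C0_off0 psi by exact: (@C1_off0_C0 _ _ cpsi).
have D := Rintegral_surf_div_u0 (C1_off0M (C1_off0_w0 alpha0) cpsi).
have c1 : C0_off0 (fun x => W x * \sum_(i < 3) u i x * pd i psi x).
  by apply: C0_off0M; [exact: C0_off0_w0|exact: C0_off0_u0grad].
have c2 : C0_off0 (fun x => W x ^+ 2 * psi x).
  have e : (fun x => W x ^+ 2 * psi x) = (fun x => W x * W x * psi x).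
    by apply/funext => x; rewrite expr2.
  by rewrite e; apply: C0_off0M => //; apply: C0_off0M; exact: C0_off0_w0.
have c3 : C0_off0 (fun x => dot (u0 alpha0 x) (u0 alpha0 x) * psi x).
  by apply: C0_off0M => //; exact: C0_off0_u0sq.
rewrite (@eq_Rintegral_Omega _ (fun x => (W x * \sum_(i < 3) u i x * pd i psi x) +
   (dot (u0 alpha0 x) (u0 alpha0 x) * psi x + (- 2) * (W x ^+ 2 * psi x)))) in D; last first.
  by move=> x Sx; rewrite surf_div_w0u0//; ring.
have c4 : C0_off0 (fun x => (- 2) * (W x ^+ 2 * psi x)).
  by apply: C0_off0M => //; exact: C0_off0_cst.
have c5 := C0_off0D c3 c4.
rewrite (Rintegral_OmegaD c1 c5) (Rintegral_OmegaD c3 c4) (Rintegral_OmegaZ _ c2) in D.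
have Z := circle_by_parts htheta0 df (fun s => is_derive_curve htheta0 s cpsi).
rewrite /= pwrho put pw curve_L in Z.
have {}Z := Z (ltac:(contf)) ctg erefl erefl.
rewrite (@eq_Rintegral_circle _ (fun s => (W (c s) * psi (c s)) * u0n s +
  (wrho s * ut s ^+ 2 * psi (c s) + ((- 2) * (wrho s * w s ^+ 2 * psi (c s))
  + wrho s * ut s * w s * \sum_(i < 3) t s 0 i * pd i psi (c s))))) in Z; last first.
  by move=> s; ring.
rewrite Rintegral_circleD in Z; [|by contf..].
rewrite Rintegral_circleD in Z; [|by contf..].
rewrite Rintegral_circleD in Z; [|by contf..].
rewrite Rintegral_circleZ in Z; [|by contf].
lra.
Qed.

(** The flux of (u0, v) u0 through C is (u0, n) (u0, v), with a tangential and a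
normal part. On C, t (x) t : Dv = (t, v)' - (t', v) with (t', v) = cot(theta0) (n, v).
The parts along t cancel by the equation for w_rho (u^t)^2; those along n, and
the flux p0 (n, v) of the pressure, add up to the last integral. *)
Lemma tangential_balance (p0 : R) (v : 'I_3 -> E3 -> R) :
  (forall s : R, is_derive s 1 (fun s => wrho s * ut s ^+ 2)
     (u0n s * u0t s - 3 * wrho s * ut s * w s)) ->
  (forall i, C1_off0 (v i)) ->
  (forall x, sphere x -> \sum_(i < 3) x 0 i * v i x = 0) ->
  \int[@area R]_(x in Omega theta0)
     (\sum_(i < 3) \sum_(j < 3) u i x * u j x * pd i (v j) x) +
  \int[leb]_(s in `[0, L]) (wrho s * ut s ^+ 2 *
     \sum_(i < 3) \sum_(j < 3) t s 0 i * t s 0 j * pd i (v j) (c s)) +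
  p0 * \int[@area R]_(x in Omega theta0) surf_div v x =
  3 * (\int[@area R]_(x in Omega theta0) (W x * \sum_(j < 3) u j x * v j x) +
       \int[leb]_(s in `[0, L]) (wrho s * ut s * w s * \sum_(j < 3) t s 0 j * v j (c s))) +
  \int[leb]_(s in `[0, L])
     ((u0n s ^+ 2 - wrho s * ut s ^+ 2 * (cos theta0 / sin theta0) + p0) *
      \sum_(j < 3) n s 0 j * v j (c s)).
Proof.
move=> df cv tv.
have cu0n := continuous_u0n; have cu0 := continuous_u0t.
have cvc i := cp (cv i).
have cv0 i : C0_off0 (v i) by exact: (@C1_off0_C0 _ _ (cv i)).
have cu i : C0_off0 (fun x => u i x) by exact: (@C1_off0_C0 _ _ (C1_off0_u0 alpha0 i)).
have cuv : C1_off0 (fun x => \sum_(j < 3) u j x * v j x).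
  have -> : (fun x => \sum_(j < 3) u j x * v j x) =
     (fun x => u o0 x * v o0 x + u o1 x * v o1 x + u o2 x * v o2 x).
    by apply/funext => y; rewrite sum3E.
  by do ?apply: C1_off0D; (apply: C1_off0M => //; exact: C1_off0_u0).
have cpd i j : continuous (fun s => pd i (v j) (c s)).
  exact: (@continuous_curve _ _ htheta0 _ (@C1_off0_derive _ _ (basis_vec i) (cv j))).
have ct i : continuous (fun s => t s 0 i) by exact: continuous_tvec.
have cn i : continuous (fun s => n s 0 i) by exact: continuous_nvec.
have cc i : continuous (fun s => c s 0 i) by exact: (cp (C1_off0_coord i)).
(* u0 (x) u0 : Dv on Omega *)
have D := Rintegral_surf_div_u0 cuv.
have c1 : C0_off0 (fun x => \sum_(i < 3) \sum_(j < 3) u i x * u j x * pd i (v j) x).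
  apply: C0_off0_sum => i; apply: C0_off0_sum => j; apply: C0_off0M.
    exact: C0_off0M.
  exact: (@C1_off0_derive _ _ (basis_vec i) (cv j)).
have c2 : C0_off0 (fun x => W x * \sum_(j < 3) u j x * v j x).
  by apply: C0_off0M; [exact: C0_off0_w0|exact: (@C1_off0_C0 _ _ cuv)].
rewrite (@eq_Rintegral_Omega _ (fun x => (\sum_(i < 3) \sum_(j < 3) u i x * u j x * pd i (v j) x) +
   (- 3) * (W x * \sum_(j < 3) u j x * v j x))) in D; last first.
  by move=> x Sx; rewrite surf_div_dotu0// ?tv//; ring.
have c3 : C0_off0 (fun x => (- 3) * (W x * \sum_(j < 3) u j x * v j x)).
  by apply: C0_off0M => //; exact: C0_off0_cst.
rewrite (Rintegral_OmegaD c1 c3) (Rintegral_OmegaZ _ c2) in D.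
(* the pressure on Omega *)
have D2 := Rintegral_surf_div htheta0 cv tv.
(* the layer, integrated by parts along C *)
pose tDv s := \sum_(i < 3) \sum_(j < 3) t s 0 i * t s 0 j * pd i (v j) (c s).
pose vt s := \sum_(j < 3) t s 0 j * v j (c s).
pose vn s := \sum_(j < 3) n s 0 j * v j (c s).
have tvc s : \sum_(j < 3) c s 0 j * v j (c s) = 0 by exact/tv/sphere_curve.
have dvt (s : R) : is_derive s 1 vt (cos theta0 / sin theta0 * vn s + tDv s).
  have d j := is_derive_mulf (is_derive_tvec htheta0 j s) (is_derive_curve htheta0 s (cv j)).
  have vtE : vt = (fun s => t s 0 o0 * v o0 (c s) + t s 0 o1 * v o1 (c s)
     + t s 0 o2 * v o2 (c s)) by apply/funext => z; exact: sum3E.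
  rewrite vtE.
  apply: (is_derive_congr (is_derive_addf (is_derive_addf (d o0) (d o1)) (d o2))).
  have := tvc s; rewrite /vn /tDv !sum3E => H.
  apply/eqP; rewrite -subr_eq0; apply/eqP.
  pose d' i j := pd i (v j) (c s); rewrite -!/(d' _ _).
  move: H; move: (v o0 (c s)) (v o1 (c s)) (v o2 (c s)) (c s 0 o0) (c s 0 o1) (c s 0 o2).
  move=> v0 v1 v2 x0 x1 x2 H.
  transitivity (- (x0 * v0 + x1 * v1 + x2 * v2)); last by rewrite H oppr0.
  move: (t s 0 o0) (t s 0 o1) (t s 0 o2) (n s 0 o0) (n s 0 o1) (n s 0 o2).
  move: (d' o0 o0) (d' o0 o1) (d' o0 o2) (d' o1 o0) (d' o1 o1) (d' o1 o2)
    (d' o2 o0) (d' o2 o1) (d' o2 o2) => *.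
  ring.
have cvn : continuous vn.
  have -> : vn = (fun s => n s 0 o0 * v o0 (c s) + n s 0 o1 * v o1 (c s)
     + n s 0 o2 * v o2 (c s)) by apply/funext => z; exact: sum3E.
  by contf.
have cvt := is_derive_continuous dvt.
have ctDv : continuous tDv.
  have -> : tDv = (fun s =>
     (t s 0 o0 * t s 0 o0 * pd o0 (v o0) (c s) + t s 0 o0 * t s 0 o1 * pd o0 (v o1) (c s)
      + t s 0 o0 * t s 0 o2 * pd o0 (v o2) (c s)) +
     (t s 0 o1 * t s 0 o0 * pd o1 (v o0) (c s) + t s 0 o1 * t s 0 o1 * pd o1 (v o1) (c s)
      + t s 0 o1 * t s 0 o2 * pd o1 (v o2) (c s)) +
     (t s 0 o2 * t s 0 o0 * pd o2 (v o0) (c s) + t s 0 o2 * t s 0 o1 * pd o2 (v o1) (c s)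
      + t s 0 o2 * t s 0 o2 * pd o2 (v o2) (c s))).
    by apply/funext => z; rewrite /tDv !sum3E.
  by contf.
have vtL : vt L = vt 0.
  have tL : t L = t 0 by rewrite -[in LHS](add0r L) tvec_periodic.
  by rewrite /vt !sum3E !curve_L tL.
have Z := circle_by_parts htheta0 df dvt.
rewrite /= pwrho put vtL in Z.
have {}Z := Z (ltac:(contf)) (ltac:(contf)) erefl erefl.
have uvE s : \sum_(j < 3) u j (c s) * v j (c s) = u0t s * vt s + u0n s * vn s.
  rewrite (@frame_dot _ theta0 (fun j => u j (c s)) (fun j => v j (c s)) s).
  - congr (_ * _ + _ * _).
      by apply: eq_bigr => j _; rewrite mulrC.
    by apply: eq_bigr => j _; rewrite mulrC.
  - exact/u0_tangent/sphere_curve.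
  - exact: tvc.
rewrite (@eq_Rintegral_circle (fun s => _ * u0n s) (fun s => (u0n s * u0t s - 3 * wrho s * ut s * w s) * vt s
     + (3 * (wrho s * ut s * w s * vt s) + u0n s ^+ 2 * vn s))) in D; last first.
  by move=> s; rewrite uvE; ring.
rewrite (@eq_Rintegral_circle (fun s => \sum_(i < 3) _ i (c s) * n s 0 i) vn) in D2; last first.
  by move=> s; rewrite /vn; apply: eq_bigr => i _; rewrite mulrC.
rewrite (@eq_Rintegral_circle _ (fun s => (u0n s * u0t s - 3 * wrho s * ut s * w s) * vt s +
   (wrho s * ut s ^+ 2 * (cos theta0 / sin theta0) * vn s + wrho s * ut s ^+ 2 * tDv s))) in Z; last first.
  by move=> s; ring.
rewrite -[X in _ + X + _ = _]/(\int[leb]_(s in `[0, L]) (wrho s * ut s ^+ 2 * tDv s)).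
rewrite -[X in 3 * (_ + X)]/(\int[leb]_(s in `[0, L]) (wrho s * ut s * w s * vt s)).
rewrite [X in _ = _ + X](@eq_Rintegral_circle _ (fun s => u0n s ^+ 2 * vn s +
   ((- 1) * (wrho s * ut s ^+ 2 * (cos theta0 / sin theta0) * vn s) + p0 * vn s))); last first.
  by move=> s; rewrite -/(vn s); ring.
rewrite Rintegral_circleD in Z; [|by contf..].
rewrite Rintegral_circleD in Z; [|by contf..].
rewrite Rintegral_circleD in D; [|by contf..].
rewrite Rintegral_circleD in D; [|by contf..].
rewrite Rintegral_circleZ in D; [|by contf].
rewrite [X in _ = _ + X]Rintegral_circleD; [|by contf..].
rewrite [X in _ = _ + (_ + X)]Rintegral_circleD; [|by contf..].
rewrite (Rintegral_circleZ p0 cvn) Rintegral_circleZ; [|by contf].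
rewrite D2.
lra.
Qed.

End Balance.

(** * The arc-length parameter as a Borel function *)

Section ArcParam.
Context {R : realType}.
Variable theta0 : R.
Hypothesis htheta0 : 0 < theta0 < pi / 2.
Local Notation E3 := 'rV[R]_3.
Local Notation T := (R3 R).
Local Notation mR := (measurableTypeR R).
Local Notation L := (clen theta0).
Local Notation c := (curve theta0).
Local Notation C := (Cbd theta0 : set T).

Lemma Cbd_curve s : C (c s).
Proof. by split; [exact: sphere_curve|rewrite coord00 row3E]. Qed.

(** The azimuth of a point of C in [- pi, pi[ is plus or minus the arc cosine of
cos(phi), according to the sign of sin(phi). The value - pi falls in the second
case, which leaves out the value pi, as in the definition of [arc_param]. *)
Definition arc_formula (x : E3) : R :=
  ((if 0 < x 0 o2 then acos (x 0 o1 / sin theta0) else - acos (x 0 o1 / sin theta0)) + pi)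
  * sin theta0.

Lemma azimuth_itv s : 0 <= s < L -> - pi <= azimuth theta0 s < pi.
Proof.
have s0 := sin_theta0_gt0 htheta0.
move=> /andP[sge sle]; rewrite /azimuth lerBrDr addNr ltrBlDr.
rewrite divr_ge0 ?(ltW s0)//= ltr_pdivrMr//.
by move: sle; rewrite /clen; lra.
Qed.

Lemma arc_formulaK s : 0 <= s < L -> arc_formula (c s) = s.
Proof.
have s0 := sin_theta0_gt0 htheta0.
move=> /azimuth_itv /andP[a1 a2]; rewrite /arc_formula /curve !row3E.
rewrite mulrAC divff ?gt_eqF// mul1r.
suff -> : (if 0 < sin theta0 * sin (azimuth theta0 s) then acos (cos (azimuth theta0 s))
    else - acos (cos (azimuth theta0 s))) = azimuth theta0 s.
  by rewrite /azimuth subrK divfK ?gt_eqF.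
rewrite pmulr_rgt0//; have [a0|a0] := ltP 0 (azimuth theta0 s).
  by rewrite sin_gt0_pi ?a0// cosK// in_itv/= ltW//= ltW.
rewrite ltNge -oppr_ge0 -sinN sin_ge0_pi/=; last by rewrite oppr_ge0 a0 lerNl.
by rewrite cosKN ?a1// opprK.
Qed.

Lemma arc_formulaP x : C x -> 0 <= arc_formula x < L /\ c (arc_formula x) = x.
Proof.
have s0 := sin_theta0_gt0 htheta0; have pp := pi_gt0 R.
move=> [Sx x0E]; rewrite coord00 in x0E; move: Sx; rewrite /sphere /= dotE x0E => Sx.
have e : x 0 o1 * x 0 o1 + x 0 o2 * x 0 o2 = sin theta0 ^+ 2.
  by have := cos2Dsin2 theta0; rewrite !expr2; lra.
set y := x 0 o1 / sin theta0; set z := x 0 o2 / sin theta0.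
have yz : y ^+ 2 + z ^+ 2 = 1.
  transitivity ((x 0 o1 * x 0 o1 + x 0 o2 * x 0 o2) / sin theta0 ^+ 2).
    by rewrite /y /z; field; rewrite gt_eqF.
  by rewrite e divff// expf_eq0 gt_eqF.
have yB : -1 <= y <= 1 by apply/andP; split; nra.
have [/andP[q0 qpi] qK] := acos_def yB.
have sqE : sin (acos y) = `|z|.
  by rewrite sin_acos// -sqrtr_sqr; congr Num.sqrt; lra.
have z0 : (0 < x 0 o2) = (0 < z) by rewrite /z pmulr_lgt0// invr_gt0.
rewrite /arc_formula z0 -/y.
set p := if _ then _ else _.
have pB : - pi <= p < pi.
  rewrite /p; case: ifPn => zz.
    rewrite (le_trans _ q0) ?oppr_le0 ?(ltW pp)//=.
    rewrite acos_ltpi//; case/andP: yB => y1 y2; rewrite y2 andbT.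
    rewrite lt_neqAle y1 andbT; apply/eqP => yN1.
    by move: yz; rewrite -yN1; nra.
  by rewrite lerN2 qpi/=; lra.
have pc : cos p = y by rewrite /p; case: ifPn => _; rewrite ?cosN.
have ps : sin p = z.
  rewrite /p; case: ifPn => zz; rewrite ?sinN sqE.
    by rewrite gtr0_norm.
  by rewrite ler0_norm ?opprK// leNgt.
have aE : azimuth theta0 ((p + pi) * sin theta0) = p.
  by rewrite /azimuth mulfK ?gt_eqF//; ring.
case/andP: pB => p1 p2; split.
  by rewrite mulr_ge0 ?(ltW s0)//=; [rewrite /clen ltr_pM2r//; lra|lra].
rewrite /curve aE; apply: eq_row3; apply: forall3; rewrite !row3E ?x0E//.
  by rewrite pc /y; field; rewrite gt_eqF.
by rewrite ps /z; field; rewrite gt_eqF.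
Qed.

Lemma arc_paramE x : C x -> arc_param theta0 x = arc_formula x.
Proof.
move=> Cx; have [h1 h2] := arc_formulaP Cx.
have [h3 h4] : [set s | 0 <= s < L /\ c s = x] (arc_param theta0 x).
  by apply: xgetPex; exists (arc_formula x).
by rewrite -[in RHS]h4 arc_formulaK.
Qed.

Lemma arc_paramP x : C x -> 0 <= arc_param theta0 x < L /\ c (arc_param theta0 x) = x.
Proof. by move=> Cx; rewrite arc_paramE//; exact: arc_formulaP. Qed.

(** For s = L the parameter of the point is 0, whence the periodicity of [b]. *)
Lemma arc_param_curve (b : R -> R) s : b L = b 0 -> s \in `[0, L] ->
  b (arc_param theta0 (c s)) = b s.
Proof.
move=> bL; rewrite in_itv/= => /andP[s0]; rewrite le_eqVlt => /predU1P[->|sL].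
  have -> : c L = c 0 by rewrite -[in LHS](add0r L) curve_periodic.
  rewrite (arc_paramE (Cbd_curve 0)) arc_formulaK ?lexx ?clen_gt0//.
by rewrite (arc_paramE (Cbd_curve s)) arc_formulaK// s0.
Qed.

Lemma measurable_acos : measurable_fun (`[-1, 1]%classic : set mR) (@acos R).
Proof.
have -> : (`[-1, 1]%classic : set mR) = `]-1, 1[ `|` ([set -1] `|` [set 1]).
  apply/seteqP; split => x /=; rewrite !in_itv/=.
    move=> /andP[]; rewrite le_eqVlt => /predU1P[<-|x1]; first by right; left.
    rewrite le_eqVlt => /predU1P[->|x2]; first by right; right.
    by left; rewrite x1.
  by move=> [/andP[/ltW -> /ltW ->]//|[->|->]]; rewrite lexx ?andbT; lra.
apply/measurable_funU => //; first exact: measurableU.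
split; last by apply/measurable_funU => //; split; exact: measurable_fun_set1.
apply: open_continuous_measurable_fun; first exact: interval_open.
by move=> x /set_mem /=; rewrite in_itv/= => ?; exact: continuous_acos.
Qed.

(** The formula for the azimuth is Borel on each of the two parts of C where its
sign is constant. *)
Lemma measurable_arc_param : measurable_fun C (arc_param theta0 : T -> R).
Proof.
have s0 := sin_theta0_gt0 htheta0; have mC : measurable C := measurable_Cbd theta0.
apply: (eq_measurable_fun (fun x : T => arc_formula x)).
  by move=> x /set_mem Cx; rewrite arc_paramE.
pose P := [set x : T | 0 < x 0 o2].
have mcoord i : measurable_fun setT (fun x : T => x 0 i : R).
  by apply: continuous_measurable_R3; exact: coord_continuous.
have mP : measurable P.
  have -> : P = (fun x : T => x 0 o2) @^-1` `]0, +oo[.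
    by apply/seteqP; split => x; rewrite /P /= in_itv/= andbT.
  by rewrite -[X in measurable X]setTI; exact: mcoord.
have mac : measurable_fun C (fun x : T => acos (x 0 o1 / sin theta0)).
  have im : [set x 0 o1 / sin theta0 | x in C] `<=` (`[-1, 1]%classic : set mR).
    move=> _ [x Cx <-]; have [_ xE] := arc_formulaP Cx.
    rewrite /= in_itv/= -xE row3E mulrAC divff ?gt_eqF// mul1r.
    by rewrite cos_geN1 cos_le1.
  have mq : measurable_fun C (fun x : T => x 0 o1 / sin theta0 : mR).
    by apply: measurable_funTS; apply: measurable_funM.
  exact: (@measurable_comp _ _ _ T mR mR _ _ _ _ (measurable_itv _) im measurable_acos mq).
have -> : C = (C `&` P) `|` (C `&` ~` P) by rewrite -setIUr setUv setIT.
apply/measurable_funU.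
- exact: measurableI.
- by apply: measurableI => //; exact: measurableC.
split.
- apply: (eq_measurable_fun (fun x : T => (acos (x 0 o1 / sin theta0) + pi) * sin theta0)).
    by move=> x /set_mem [_ Px]; rewrite /arc_formula ifT.
  apply: measurable_funM => //; apply: measurable_funD => //.
  by apply: measurable_funS mac.
- apply: (eq_measurable_fun (fun x : T => (- acos (x 0 o1 / sin theta0) + pi) * sin theta0)).
    by move=> x /set_mem [_ Px]; rewrite /arc_formula ifF//; apply/negP.
  apply: measurable_funM => //; apply: measurable_funD => //.
  apply: measurableT_comp => //.
  by apply: measurable_funS mac.
Qed.

End ArcParam.

(** * Measures living on Omega and on C *)

Section Layer.
Context {R : realType}.
Variable theta0 : R.
Hypothesis htheta0 : 0 < theta0 < pi / 2.
Local Notation E3 := 'rV[R]_3.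
Local Notation T := (R3 R).
Local Notation mR := (measurableTypeR R).
Local Notation leb := (@lebesgue_measure R).
Local Notation L := (clen theta0).
Local Notation c := (curve theta0).
Local Notation C := (Cbd theta0 : set T).
Local Notation Om := (Omega theta0 : set T).
Local Notation Ob := (Obar theta0 : set T).

(** The form of every density of the solution: [a] is its value in the gas and [b]
its value in the layer, as a function of arc length. *)
Definition two_phase (a : E3 -> R) (b : R -> R) (x : T) : R :=
  \1_Om x * a x + \1_C x * b (arc_param theta0 x).

Lemma Omega_notC x : Om x -> ~ C x.
Proof. by move=> [Sx nC] [_ x0]; apply: nC; split => //; rewrite x0. Qed.

Lemma two_phase_Omega a b x : Om x -> two_phase a b x = a x.
Proof.
move=> Ox; rewrite /two_phase !indicE mem_set// memNset ?mul1r ?mul0r ?addr0//.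
exact: Omega_notC.
Qed.

Lemma two_phase_Cbd a b x : C x -> two_phase a b x = b (arc_param theta0 x).
Proof.
move=> Cx; rewrite /two_phase !indicE memNset; last by move=> /Omega_notC.
by rewrite mem_set// mul1r mul0r add0r.
Qed.

Lemma two_phase_out a b x : ~ Ob x -> two_phase a b x = 0.
Proof.
move=> nO; rewrite /two_phase !indicE !memNset ?mul0r ?addr0// => ?; apply: nO;
by [left|right].
Qed.

Lemma two_phase_curve a b s : b L = b 0 -> s \in `[0, L] -> two_phase a b (c s) = b s.
Proof.
move=> bL sL; rewrite two_phase_Cbd; last exact: Cbd_curve.
exact: arc_param_curve.
Qed.

Lemma two_phaseM a b a' b' x :
  two_phase a b x * two_phase a' b' x =
  two_phase (fun x => a x * a' x) (fun s => b s * b' s) x.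
Proof.
have [[Ox|Cx]|nO] := pselect (Ob x).
- by rewrite !two_phase_Omega.
- by rewrite !two_phase_Cbd.
- by rewrite !two_phase_out// mulr0.
Qed.

Lemma measurable_two_phase a b : C0_off0 a -> continuous b ->
  measurable_fun setT (two_phase a b).
Proof.
move=> ca cb.
have -> : two_phase a b = (fun x => (a \_ Om) x + ((b \o arc_param theta0) \_ C) x).
  apply/funext => x; rewrite /two_phase !indicE !patchE.
  by case: ifPn => _; case: ifPn => _; rewrite ?mul1r ?mul0r.
apply: measurable_funD.
- apply/(@measurable_restrict _ _ T mR) => //; first exact: measurable_Omega.
  by rewrite setTI; apply: C0_off0_measurable => //; exact: Omega_sphere.
- apply/(@measurable_restrict _ _ T mR) => //; first exact: measurable_Cbd.
  rewrite setTI; apply: measurableT_comp; last exact: measurable_arc_param.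
  exact: continuous_measurable_fun.
Qed.

Lemma bounded_two_phase a b (D : set T) : C0_off0 a -> continuous b ->
  [bounded two_phase a b x | x in D].
Proof.
move=> ca cb; have [M1 [M1r h1]] := C0_off0_bounded ca.
have /compact_bounded[M2 [M2r h2]] : compact (b @` `[0, L]).
  apply: continuous_compact; last exact: segment_compact.
  exact: continuous_subspaceT.
pose M := Num.max 0 (Num.max M1 M2).
exists M; split; first by rewrite num_real.
move=> r; rewrite /M !gt_max => /and3P[r0 r1 r2] x _ /=.
have [[Ox|Cx]|nO] := pselect (Ob x).
- rewrite two_phase_Omega//; apply: (h1 _ r1); exact: Omega_sphere Ox.
- rewrite two_phase_Cbd//; apply: (h2 _ r2); exists (arc_param theta0 x) => //=.
  have [/andP[s0 sL] _] := arc_paramP htheta0 Cx.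
  by rewrite in_itv/= s0 ltW.
- by rewrite two_phase_out// normr0 ltW.
Qed.

Lemma integrable_two_phase (mu : {finite_measure set T -> \bar R}) a b :
  C0_off0 a -> continuous b -> mu.-integrable setT (EFin \o two_phase a b).
Proof.
move=> ca cb; apply: measurable_bounded_integrable => //.
- by rewrite -ge0_fin_numE// fin_num_measure.
- exact: measurable_two_phase.
- exact: bounded_two_phase.
Qed.

Lemma measurable_curve : measurable_fun setT (c : mR -> T).
Proof.
apply: (@measurability _ _ mR T setT _ (@open 'rV[R]_3 : set (set T))) => //.
move=> _ [U oU <-]; rewrite setTI.
apply: (@open_measurable R (c @^-1` U)).
apply: open_comp => // s _; apply: rV_continuous => i.
exact: (is_derive_continuous (fun s => is_derive_curve htheta0 s (C1_off0_coord i))).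
Qed.

Variable wrho : R -> R.
Hypotheses (cwrho : continuous wrho) (wrho0 : forall s, 0 <= wrho s).

Definition layer_integral (F : T -> R) : R :=
  \int[@area R]_(x in Om) F x + \int[leb]_(s in `[0, L]) (wrho s * F (c s)).

(** The measure varrho of the solution: the sum of the area restricted to Omega
and of the image under [curve] of the measure of density [wrho] on [0, L]. *)
Lemma layer_measure : exists rho : {finite_measure set T -> \bar R},
  (forall A : set T, measurable A ->
     rho A = ((rho0 : R)%:E * area (A `&` Om) + delta_C theta0 wrho A)%E) /\
  (forall F : T -> R, measurable_fun Ob F -> [bounded F x | x in Ob] ->
     \int[rho]_(x in Ob) F x = layer_integral F).
Proof.
have mO : measurable Om := measurable_Omega theta0.
have mOb : measurable Ob := measurable_Obar theta0.
have i1 : (@area R).-integrable Om (EFin \o (fun=> 1)).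
  by apply: finite_measure_integrable_cst.
have [m1 m1E] := @density_measure _ _ T T R (@area R) Om (fun=> 1) id mO
  (fun _ _ => ler01) (@measurable_id _ _ _) i1.
have mL : measurable (`[0, L]%classic : set mR) by exact: measurable_itv.
have mw : measurable_fun (`[0, L]%classic : set mR) wrho.
  exact: measurable_funTS (continuous_measurable_fun cwrho).
have iw : leb.-integrable (`[0, L]%classic : set mR) (EFin \o wrho).
  exact: continuous_integrable_circle.
have [m2 m2E] := @density_measure _ _ mR T R leb _ wrho c mL
  (fun s _ => wrho0 s) measurable_curve iw.
pose m : {measure set T -> \bar R} := measure_add m1 m2.
have mE A : m A = (m1 A + m2 A)%E by exact: measure_addE.
have m_fin : fin_num_fun m.
  by move=> A mA; rewrite mE fin_numD !fin_num_measure.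
pose rho : {finite_measure set T -> \bar R} :=
  HB.pack (Measure.sort m) (Measure_isFinite.Build _ _ _ m m_fin).
have rhoE A : rho A = (m1 A + m2 A)%E by exact: mE.
exists rho; split => [A mA|F mF bF].
  rewrite rhoE m1E// m2E// /rho0 mul1e; congr (_ + _)%E.
    rewrite integral_cst; last exact: measurableI.
    by rewrite mul1e setIC.
  rewrite /delta_C integral_mkcondr; apply: eq_integral => s _.
  rewrite patchE indicE.
  case: (boolP (s \in c @^-1` A)) => [/set_mem cA|/negP cA].
    by rewrite mem_set// mulr1.
  by rewrite memNset ?mulr0// => ?; apply: cA; exact/mem_set.
have iF (k : {finite_measure set T -> \bar R}) : k.-integrable Ob (EFin \o F).
  apply: measurable_bounded_integrable => //.
  by rewrite -ge0_fin_numE// fin_num_measure.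
rewrite {1}/Rintegral (@eq_measure_integral _ _ _ _ m)//.
rewrite (integral_measure_add mOb (iF m1) (iF m2)).
rewrite fineD; [|exact: (integrable_fin_num mOb (iF m1))
  |exact: (integrable_fin_num mOb (iF m2))].
rewrite /layer_integral; congr (_ + _).
  rewrite -[LHS]/(Rintegral _ _ _) (Rintegral_density mO _ _ _ m1E)//.
  rewrite preimage_id (_ : Om `&` Ob = Om); last first.
    by apply/setIidl => x Ox; left.
  by apply: eq_Rintegral => x _; rewrite mulr1.
rewrite -[LHS]/(Rintegral _ _ _).
rewrite (Rintegral_density mL mw (fun s _ => wrho0 s) measurable_curve m2E)//.
rewrite (_ : _ `&` _ = `[0, L]%classic); last first.
  by apply/setIidl => s _; right; exact: Cbd_curve.
by apply: eq_Rintegral => s _; rewrite mulrC.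
Qed.

Lemma pairing_two_phase (rho : {finite_measure set T -> \bar R}) a b
    (iab : rho.-integrable setT (EFin \o two_phase a b)) (f G : E3 -> R) :
  (forall F : T -> R, measurable_fun Ob F -> [bounded F x | x in Ob] ->
     \int[rho]_(x in Ob) F x = layer_integral F) ->
  C0_off0 a -> continuous b -> b L = b 0 ->
  C0_off0 G -> (forall x, sphere x -> f x = G x) ->
  pairing theta0 (induced_charge iab) f =
  \int[@area R]_(x in Om) (G x * a x) +
  \int[leb]_(s in `[0, L]) (wrho s * (G (c s) * b s)).
Proof.
move=> rhoI ca cb bL cG fG.
have mOb : measurable Ob := measurable_Obar theta0.
have fE x : Ob x -> f x = G x by move=> /Obar_sphere; exact: fG.
have mf : measurable_fun Ob f.
  apply: (@eq_measurable_fun _ _ T mR Ob G f); first by move=> x /set_mem /fE.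
  by apply: C0_off0_measurable => //; exact: Obar_sphere.
have mfab : measurable_fun Ob (fun x => f x * two_phase a b x).
  by apply: measurable_funM => //; apply: measurable_funTS; exact: measurable_two_phase.
have bfab : [bounded f x * two_phase a b x | x in Ob].
  have [M1 [_ h1]] := C0_off0_bounded cG.
  have [M2 [_ h2]] := @bounded_two_phase a b Ob ca cb.
  exists ((`|M1| + 1) * (`|M2| + 1)); split; first exact: num_real.
  move=> r Mr x Obx /=; rewrite (le_trans _ (ltW Mr))// normrM fE//.
  apply: ler_pM => //.
    apply: h1; last exact: Obar_sphere Obx.
    by rewrite (le_lt_trans (ler_norm _))// ltrDl.
  apply: h2 => //; by rewrite (le_lt_trans (ler_norm _))// ltrDl.
have ifab : rho.-integrable Ob (EFin \o (fun x => f x * two_phase a b x)).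
  apply: measurable_bounded_integrable => //.
  by rewrite -ge0_fin_numE// fin_num_measure.
rewrite pairing_induced// rhoI// /layer_integral; congr (_ + _).
  apply: eq_Rintegral => x /set_mem Ox.
  by rewrite two_phase_Omega// fE//; left.
apply: eq_Rintegral => s /set_mem sL; rewrite two_phase_curve//.
by rewrite fE//; right; exact: Cbd_curve.
Qed.

End Layer.

Section PhaseCharge.
Context {R : realType}.
Variable theta0 : R.
Hypothesis htheta0 : 0 < theta0 < pi / 2.
Local Notation E3 := 'rV[R]_3.
Local Notation T := (R3 R).
Local Notation leb := (@lebesgue_measure R).
Local Notation L := (clen theta0).
Local Notation c := (curve theta0).
Local Notation Om := (Omega theta0 : set T).
Local Notation Ob := (Obar theta0 : set T).

Definition phase_charge (mu : {finite_measure set T -> \bar R}) a b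
    (ca : C0_off0 a) (cb : continuous b) : {charge set T -> \bar R} :=
  induced_charge (integrable_two_phase htheta0 mu ca cb).

Lemma phase_charge_dominated (mu : {finite_measure set T -> \bar R}) a b (ca : C0_off0 a) (cb : continuous b) :
  phase_charge mu ca cb `<< mu.
Proof. exact: induced_charge_dominated. Qed.

Lemma Radon_Nikodym_phase (mu : {finite_measure set T -> \bar R}) a b
  (ca : C0_off0 a) (cb : continuous b) :
  {ae mu, forall x,
    Radon_Nikodym (phase_charge mu ca cb) mu x = (two_phase theta0 a b x)%:E}.
Proof.
have := Radon_Nikodym_induced (integrable_two_phase htheta0 mu ca cb).
by apply: filterS => x; exact.
Qed.

(** C is a null set for the area, so that the area of Omega-bar is the case of an
empty layer. The pressure is treated like the other charges in this way. *)
Lemma area_Obar_integral (F : T -> R) : measurable_fun Ob F ->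
  [bounded F x | x in Ob] ->
  \int[@area R]_(x in Ob) F x = layer_integral theta0 (fun=> 0) F.
Proof.
move=> mF bF; have mO := measurable_Omega theta0; have mC := measurable_Cbd theta0.
have iF : (@area R).-integrable Ob (EFin \o F).
  apply: measurable_bounded_integrable => //; first exact: measurable_Obar.
  by rewrite -ge0_fin_numE// fin_num_measure//; exact: measurable_Obar.
rewrite /layer_integral Rintegral_setU//; last first.
  by apply/disj_setPS => x [Ox Cx]; exact: Omega_notC Ox Cx.
congr (_ + _); under [RHS]eq_Rintegral do rewrite mul0r.
rewrite Rintegral_cst// mul0r /Rintegral null_set_integral//.
- apply/measurable_EFinP; apply: measurable_funS mF; first exact: measurable_Obar.
  by move=> x Cx; right.
- exact: area_Cbd.
Qed.

End PhaseCharge.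

(** * Positivity of the layer and of the wall pressure *)

Section Nondegeneracy.
Context {R : realType}.
Variables theta0 alpha0 : R.
Hypothesis htheta0 : 0 < theta0 < pi / 2.
Local Notation T := (R3 R).
Local Notation leb := (@lebesgue_measure R).
Local Notation L := (clen theta0).
Local Notation c := (curve theta0).
Local Notation un := (u0n theta0 alpha0).

(** The normal is orthogonal to x, so that (u0, n) = (V, n). *)
Lemma unE s : un s = cos alpha0 * sin theta0 - sin alpha0 * cos theta0 * cos (azimuth theta0 s).
Proof.
have e : \sum_(i < 3) c s 0 i * nvec theta0 s 0 i = 0.
  rewrite sum3E !row3E.
  have Q := cos2Dsin2 (azimuth theta0 s).
  transitivity (cos theta0 * sin theta0 *
    (1 - (cos (azimuth theta0 s) ^+ 2 + sin (azimuth theta0 s) ^+ 2))); first by ring.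
  by rewrite Q subrr mulr0.
rewrite sum3E in e.
rewrite /u0n dotE !u0E_at.
transitivity (V0 alpha0 0 o0 * nvec theta0 s 0 o0 + V0 alpha0 0 o1 * nvec theta0 s 0 o1
  + V0 alpha0 0 o2 * nvec theta0 s 0 o2 - w0 alpha0 (c s) *
  (c s 0 o0 * nvec theta0 s 0 o0 + c s 0 o1 * nvec theta0 s 0 o1 + c s 0 o2 * nvec theta0 s 0 o2)).
  by ring.
by rewrite e mulr0 !row3E; ring.
Qed.

Lemma azimuth_arclength phi : azimuth theta0 (arclength theta0 phi) = phi.
Proof.
have s0 := sin_theta0_gt0 htheta0.
by rewrite /azimuth /arclength mulfK ?gt_eqF// addrK.
Qed.

Lemma arclength_azimuth s : arclength theta0 (azimuth theta0 s) = s.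
Proof.
have s0 := sin_theta0_gt0 htheta0.
by rewrite /azimuth /arclength subrK divfK ?gt_eqF.
Qed.

(** A continuous function positive at a point is bounded below by a positive
constant on an interval. *)
Lemma continuous_integral0 (f : R -> R) : continuous f -> (forall s, 0 <= f s) ->
  (\int[leb]_(s in `[0%R, L]) (f s)%:E = 0)%E -> forall s, 0 < s < L -> f s = 0.
Proof.
move=> cf f0 If s sL; apply/eqP; rewrite eq_le f0 andbT leNgt; apply/negP => fs.
have : \forall r \near s, f s / 2 < f r.
  by apply: (cvgr_gt (f s) (cf s)); rewrite ltr_pdivrMr// ltr_pMr// ltr1n.
have : \forall r \near s, r \in `]0, L[ by apply: near_in_itvoo; rewrite in_itv.
move=> h1 h2; have h : nbhs s [set r | (r \in `]0, L[) /\ (f s / 2 < f r)] by exact: filterI h1 h2.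
move: h => /nbhs_ballP[e /= e0 he].
pose I := `[s - e / 2, s + e / 2]%classic.
have hI r : I r -> (r \in `]0, L[) /\ f s / 2 < f r.
  rewrite /I /= in_itv/= => /andP[r1 r2]; apply: he.
  rewrite /ball /= ltr_distlC; apply/andP; split; lra.
have mI : measurable (I : set (measurableTypeR R)) by exact: measurable_itv.
have mf : measurable_fun setT f by exact: continuous_measurable_fun.
have : (\int[leb]_(r in I) (f s / 2)%:E <= \int[leb]_(r in `[0%R, L]) (f r)%:E)%E.
  apply: (@le_trans _ _ (\int[leb]_(r in I) (f r)%:E)%E).
    apply: ge0_le_integral => //.
    - by move=> r _; rewrite lee_fin divr_ge0// ltW.
    - by apply/measurable_EFinP; exact: measurable_funTS.
    - by move=> r /hI [_ /ltW]; rewrite lee_fin.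
  apply: ge0_subset_integral => //.
  - by apply/measurable_EFinP; exact: measurable_funTS.
  - by move=> r _; rewrite lee_fin.
  - by move=> r /hI[+ _]; rewrite /= !in_itv/= => /andP[/ltW -> /ltW ->].
rewrite If integral_cst// /I /= lebesgue_measure_itv/= lte_fin ifT; last by lra.
rewrite -EFinD -EFinM lee_fin leNgt => /negP; apply.
by apply: mulr_gt0; lra.
Qed.

(** The area ignores C, so that domination makes w_rho vanish on ]0, L[. The mass
equation then gives (u0, n) = 0 there, and the points of azimuth pi / 2 and 0 give
cos(alpha0) sin(theta0) = 0 and sin(alpha0) cos(theta0) = 0. *)
Lemma layer_not_dominated (wrho ut w : R -> R) (rho : {finite_measure set T -> \bar R}) :
  continuous wrho -> (forall s, 0 <= wrho s) ->
  (forall s, derive1 (fun s => wrho s * ut s) s + 2 * wrho s * w s = un s) ->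
  (forall A : set T, measurable A ->
     rho A = ((rho0 : R)%:E * area (A `&` Omega theta0) + delta_C theta0 wrho A)%E) ->
  ~ rho `<< @area R.
Proof.
move=> cw w0 hm rhoE /null_content_dominatesP dom.
have s0 := sin_theta0_gt0 htheta0; have c0 := cos_theta0_gt0 htheta0.
have pp := pi_gt0 R.
have mC := measurable_Cbd theta0.
have := dom _ mC (area_Cbd htheta0); rewrite rhoE//.
have -> : (Cbd theta0 : set T) `&` Omega theta0 = set0.
  by apply/seteqP; split => // x [Cx Ox]; exact: (Omega_notC Ox Cx).
rewrite measure0 mule0 add0e /delta_C => Iw.
have wz : forall s, 0 < s < L -> wrho s = 0.
  apply: continuous_integral0 => //; rewrite -[RHS]Iw; apply: eq_integral => s _.
  by rewrite indicE mem_set ?mulr1//; exact: Cbd_curve.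
have unz s : 0 < s < L -> un s = 0.
  move=> sL; rewrite -hm wz// mulr0 mul0r addr0 derive1E.
  rewrite (near_eq_derive (g := cst 0)); first exact: derive_cst.
  near=> r; rewrite wz ?mul0r//.
  have : r \in `]0, L[ by near: r; apply: near_in_itvoo; rewrite in_itv.
  by rewrite in_itv.
have hphi phi : - pi < phi < pi ->
    cos alpha0 * sin theta0 - sin alpha0 * cos theta0 * cos phi = 0.
  move=> /andP[p1 p2]; rewrite -(azimuth_arclength phi) -unE; apply: unz.
  rewrite /arclength /clen; apply/andP; split; first by apply: mulr_gt0 => //; lra.
  by rewrite ltr_pM2r//; lra.
(* azimuths where the two terms of (u0, n) decouple *)
have h1 := hphi (pi / 2); have h2 := hphi 0.
rewrite cos_pihalf mulr0 subr0 in h1; rewrite cos0 mulr1 in h2.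
have ca : cos alpha0 = 0.
  have /eqP := h1 (ltac:(apply/andP; split; lra)).
  by rewrite mulf_eq0 (gt_eqF s0) orbF => /eqP.
have sa : sin alpha0 = 0.
  have /eqP := h2 (ltac:(apply/andP; split; lra)).
  by rewrite ca mul0r sub0r oppr_eq0 mulf_eq0 (gt_eqF c0) orbF => /eqP.
by have := cos2Dsin2 alpha0; rewrite ca sa expr0n addr0 => /eqP; rewrite eq_sym oner_eq0.
Unshelve. all: by end_near. Qed.

(** A positive continuous function on a compact interval is bounded away from 0;
the set of values is thus bounded above, and its supremum is an upper bound. *)
Lemma wall_pressure_gt0 (q : R -> R) (Minf : R) : 0 < Minf -> continuous q ->
  (forall s, s \in `[0, L] -> 0 < q s) ->
  sup [set Num.sqrt (1 / q (arclength theta0 phi)) | phi in `[- pi, pi]] < Minf ->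
  forall s, s \in `[0, L] -> 0 < q s + chaplygin Minf rho0.
Proof.
move=> M0 cq q0 supM s sL.
have s0 := sin_theta0_gt0 htheta0; have pp := pi_gt0 R.
have L0 := clen_gt0 htheta0.
have aL phi : phi \in `[- pi, pi] -> arclength theta0 phi \in `[0, L].
  rewrite !in_itv/= => /andP[p1 p2]; rewrite /arclength /clen mulr_ge0 ?(ltW s0)//=; last by lra.
  by rewrite ler_pM2r//; lra.
have [m mL qm] := @EVT_min R q 0 L (ltW L0) (continuous_subspaceT cq).
have le_sup : Num.sqrt (1 / q s) <= sup [set Num.sqrt (1 / q (arclength theta0 phi)) | phi in `[- pi, pi]].
  apply: ub_le_sup.
    exists (Num.sqrt (1 / q m)) => _ [phi phiI <-].
    have qp := q0 _ (aL _ phiI); have qm0 := q0 _ mL.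
    rewrite ler_sqrt; last exact: divr_ge0 (ltW qm0).
    by rewrite !div1r lef_pV2 ?posrE//; apply: qm; exact: aL.
  exists (azimuth theta0 s); last by rewrite arclength_azimuth.
  move: sL; rewrite /= !in_itv/= /azimuth => /andP[sa sb].
  rewrite -lerBlDr subrr divr_ge0 ?(ltW s0)//= lerBlDr ler_pdivrMr//.
  by move: sb; rewrite /clen; lra.
have {supM le_sup} sM := le_lt_trans le_sup supM.
have qs := q0 s sL.
have : 1 / q s < Minf ^+ 2.
  rewrite -(ltr_sqrt _ (exprn_gt0 2 M0)) sqrtr_sqr gtr0_norm//.
rewrite /chaplygin /rho0 mulr1 subr_gt0 ltr_pdivrMr// => h.
rewrite -[ltLHS]mul1r ltr_pdivrMr ?exprn_gt0// mulrC.
exact: h.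
Qed.

End Nondegeneracy.

(** * The weak formulation *)

Section WeakEquations.
Context {R : realType}.
Variables theta0 : R.
Hypothesis htheta0 : 0 < theta0 < pi / 2.
Local Notation E3 := 'rV[R]_3.
Local Notation T := (R3 R).
Local Notation leb := (@lebesgue_measure R).
Local Notation pd i G x := ('D_(basis_vec i) G x).
Local Notation L := (clen theta0).
Local Notation c := (curve theta0).
Local Notation t := (tvec theta0).
Local Notation Om := (Omega theta0 : set T).
Local Notation Ob := (Obar theta0 : set T).
Local Notation IO F := (\int[@area R]_(x in Omega theta0) F x).
Local Notation IC f := (\int[leb]_(s in `[0, L]) f s).

Lemma C0_off0_hext (psi : E3 -> R) : C1_sphere psi -> C0_off0 (hext psi).
Proof. by move=> cpsi; exact: (@C1_off0_C0 _ _ cpsi). Qed.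

Lemma Rintegral_Omega_sum (F : 'I_3 -> E3 -> R) : (forall i, C0_off0 (F i)) ->
  \sum_(i < 3) IO (F i) = \int[@area R]_(x in Omega theta0) (\sum_(i < 3) F i x).
Proof.
move=> cF; rewrite sum3E.
rewrite (@eq_Rintegral_Omega _ _ (fun x => \sum_(i < 3) F i x) (fun x => F o0 x + F o1 x + F o2 x)); last first.
  by move=> x _; exact: sum3E.
have c01 := C0_off0D (cF o0) (cF o1).
by rewrite (Rintegral_OmegaD _ c01 (cF o2)) (Rintegral_OmegaD _ (cF o0) (cF o1)).
Qed.

Lemma Rintegral_circle_sum (f : 'I_3 -> R -> R) : (forall i, continuous (f i)) ->
  \sum_(i < 3) IC (f i) = \int[leb]_(s in `[0, L]) (\sum_(i < 3) f i s).
Proof.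
move=> cf; rewrite sum3E.
rewrite (@eq_Rintegral_circle _ _ (fun s => \sum_(i < 3) f i s) (fun s => f o0 s + f o1 s + f o2 s)); last first.
  by move=> s; exact: sum3E.
have c01 : continuous (fun s => f o0 s + f o1 s) := continuous_addf (cf o0) (cf o1).
by rewrite (Rintegral_circleD _ c01 (cf o2)) (Rintegral_circleD _ (cf o0) (cf o1)).
Qed.

Variables wrho ut w : R -> R.
Hypotheses (cwrho : continuous wrho) (cut : continuous ut) (cw : continuous w).
Hypotheses (pwrho : wrho L = wrho 0) (put : ut L = ut 0) (pw : w L = w 0).
Variable rho : {finite_measure set T -> \bar R}.
Hypothesis rhoI : forall F : T -> R, measurable_fun Ob F ->
  [bounded F x | x in Ob] -> \int[rho]_(x in Ob) F x = layer_integral theta0 wrho F.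

Lemma pairing_phase a b (ca : C0_off0 a) (cb : continuous b) (f G : E3 -> R) :
  b L = b 0 -> C0_off0 G -> (forall x, sphere x -> f x = G x) ->
  pairing theta0 (phase_charge htheta0 rho ca cb) f =
  \int[@area R]_(x in Omega theta0) (G x * a x) +
  \int[leb]_(s in `[0, L]) (wrho s * (G (c s) * b s)).
Proof. by move=> bL cG fG; exact: pairing_two_phase. Qed.

Let cGc (G : E3 -> R) : C0_off0 G -> continuous (fun s => G (c s)).
Proof. by move=> cG; exact: (@continuous_curve _ _ htheta0 _ cG). Qed.

(** Test fields enter only through their values on the sphere, where they are
replaced by functions [G i] continuous off the origin. *)
Lemma pairing_vec_phase (a : 'I_3 -> E3 -> R) (b : 'I_3 -> R -> R)
    (ca : forall i, C0_off0 (a i)) (cb : forall i, continuous (b i))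
    (F : E3 -> E3) (G : 'I_3 -> E3 -> R) :
  (forall i, b i L = b i 0) -> (forall i, C0_off0 (G i)) ->
  (forall x i, sphere x -> F x 0 i = G i x) ->
  pairing_vec theta0 (fun i => phase_charge htheta0 rho (ca i) (cb i)) F =
  \int[@area R]_(x in Omega theta0) (\sum_(i < 3) G i x * a i x) +
  \int[leb]_(s in `[0, L]) (\sum_(i < 3) wrho s * (G i (c s) * b i s)).
Proof.
move=> bL cG FG; rewrite /pairing_vec.
under eq_bigr => i _ do
  rewrite (@pairing_phase (a i) (b i) (ca i) (cb i) _ (G i) (bL i) (cG i)
    (fun x Sx => FG x i Sx)).
rewrite big_split /= Rintegral_Omega_sum; last by move=> i; exact: C0_off0M (cG i) (ca i).
by rewrite Rintegral_circle_sum// => i; have cGi := cGc (cG i); have cbi := cb i; contf.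
Qed.

Lemma pairing_ten_phase (a : 'I_3 -> 'I_3 -> E3 -> R) (b : 'I_3 -> 'I_3 -> R -> R)
    (ca : forall i j, C0_off0 (a i j)) (cb : forall i j, continuous (b i j))
    (F : E3 -> 'M[R]_3) (G : 'I_3 -> 'I_3 -> E3 -> R) :
  (forall i j, b i j L = b i j 0) -> (forall i j, C0_off0 (G i j)) ->
  (forall x i j, sphere x -> F x i j = G i j x) ->
  pairing_ten theta0 (fun i j => phase_charge htheta0 rho (ca i j) (cb i j)) F =
  \int[@area R]_(x in Omega theta0) (\sum_(i < 3) \sum_(j < 3) G i j x * a i j x) +
  \int[leb]_(s in `[0, L])
    (\sum_(i < 3) \sum_(j < 3) wrho s * (G i j (c s) * b i j s)).
Proof.
move=> bL cG FG; rewrite /pairing_ten.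
transitivity (\sum_(i < 3) (
  \int[@area R]_(x in Omega theta0) (\sum_(j < 3) G i j x * a i j x) +
  \int[leb]_(s in `[0, L]) (\sum_(j < 3) wrho s * (G i j (c s) * b i j s)))).
  apply: eq_bigr => i _.
  rewrite -(@pairing_vec_phase (a i) (b i) (ca i) (cb i) (fun x => row i (F x)) (G i)) //.
    by apply: eq_bigr => j _; congr pairing; apply/funext => x; rewrite mxE.
  by move=> x j Sx; rewrite mxE FG.
rewrite big_split /= Rintegral_Omega_sum; last first.
  by move=> i; apply: C0_off0_sum => j; exact: C0_off0M (cG i j) (ca i j).
rewrite Rintegral_circle_sum// => i.
have cGij j : continuous (fun s => G i j (c s)) := cGc (cG i j).
have cbij j : continuous (fun s => b i j s) := cb i j.
have -> : (fun s => \sum_(j < 3) wrho s * (G i j (c s) * b i j s)) =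
  (fun s => wrho s * (G i o0 (c s) * b i o0 s) + wrho s * (G i o1 (c s) * b i o1 s)
     + wrho s * (G i o2 (c s) * b i o2 s)) by apply/funext => s; exact: sum3E.
by contf.
Qed.

End WeakEquations.

Section Solution.
Context {R : realType}.
Variables theta0 alpha0 Minf E0 : R.
Hypothesis htheta0 : 0 < theta0 < pi / 2.
Local Notation E3 := 'rV[R]_3.
Local Notation T := (R3 R).
Local Notation leb := (@lebesgue_measure R).
Local Notation pd i G x := ('D_(basis_vec i) G x).
Local Notation L := (clen theta0).
Local Notation c := (curve theta0).
Local Notation t := (tvec theta0).
Local Notation n := (nvec theta0).
Local Notation Om := (Omega theta0 : set T).
Local Notation Ob := (Obar theta0 : set T).
Local Notation W := (w0 alpha0).
Local Notation u i x := (u0 alpha0 x 0 i).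
Local Notation IO F := (\int[@area R]_(x in Omega theta0) F x).
Local Notation IC f := (\int[leb]_(s in `[0, L]) f s).

Variables wrho ut w : R -> R.
Hypotheses (cwrho : continuous wrho) (cut : continuous ut) (cw : continuous w).
Hypotheses (pwrho : wrho L = wrho 0) (put : ut L = ut 0) (pw : w L = w 0).
Hypothesis dmass : forall s : R,
  is_derive s 1 (fun s => wrho s * ut s) (u0n theta0 alpha0 s - 2 * wrho s * w s).
Hypothesis dradial : forall s : R, is_derive s 1 (fun s => wrho s * ut s * w s)
  (W (c s) * u0n theta0 alpha0 s + wrho s * ut s ^+ 2 - 2 * wrho s * w s ^+ 2).
Hypothesis dtang : forall s : R, is_derive s 1 (fun s => wrho s * ut s ^+ 2)
  (u0n theta0 alpha0 s * u0t theta0 alpha0 s - 3 * wrho s * ut s * w s).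
Variable rho : {finite_measure set T -> \bar R}.
Hypothesis rhoI : forall F : T -> R, measurable_fun Ob F ->
  [bounded F x | x in Ob] -> \int[rho]_(x in Ob) F x = layer_integral theta0 wrho F.

Let p0 : R := chaplygin Minf rho0.

(** The component of index [i] of the velocity u^t t of the layer. *)
Let b_u i (s : R) : R := ut s * t s 0 i.

Let cb_u i : continuous (b_u i).
Proof.
have ct : continuous (fun s => t s 0 i) by exact: continuous_tvec.
by rewrite /b_u; contf.
Qed.

Let bL_u i : b_u i L = b_u i 0.
Proof. by rewrite /b_u put -[in LHS](add0r L) tvec_periodic. Qed.

Let ca_u i : C0_off0 (fun x => u i x).
Proof. exact: (@C1_off0_C0 _ _ (C1_off0_u0 alpha0 i)). Qed.

Let ca_w : C0_off0 W := @C0_off0_w0 R alpha0.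

Let ca_E (a : E3 -> R) : C0_off0 a -> C0_off0 (fun x => E0 * a x).
Proof. by move=> ca; apply: C0_off0M => //; exact: C0_off0_cst. Qed.

Let cb_E (b : R -> R) : continuous b -> continuous (fun s => E0 * b s).
Proof. by move=> cb; contf. Qed.

Let cbM (b b' : R -> R) : continuous b -> continuous b' -> continuous (fun s => b s * b' s).
Proof. exact: continuous_mulf. Qed.

(** The charges m_a, n_a, m_e, n_e, m_r, n_r, m_t, n_t of the definition of a Radon
measure solution, in this order, then the pressure. *)
Definition mass_flux i := phase_charge htheta0 rho (@ca_u i) (@cb_u i).
Definition radial_mass := phase_charge htheta0 rho ca_w cw.
Definition energy_flux i := phase_charge htheta0 rho (@ca_E _ (@ca_u i)) (@cb_E _ (@cb_u i)).
Definition radial_energy := phase_charge htheta0 rho (@ca_E _ ca_w) (@cb_E _ cw).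
Definition radial_momentum_flux i :=
  phase_charge htheta0 rho (@C0_off0M _ _ _ ca_w (@ca_u i)) (@cbM _ _ cw (@cb_u i)).
Definition radial_momentum :=
  phase_charge htheta0 rho (@C0_off0M _ _ _ ca_w ca_w) (@cbM _ _ cw cw).
Definition momentum_flux i j := phase_charge htheta0 rho
  (@C0_off0M _ _ _ (@ca_u i) (@ca_u j)) (@cbM _ _ (@cb_u i) (@cb_u j)).
Definition kinetic := phase_charge htheta0 rho (@C0_off0_u0sq R alpha0) (@cbM _ _ cut cut).
Definition pressure := phase_charge htheta0 (@area R) (@C0_off0_cst R p0)
  (@continuous_cstf R R p0).

Definition wall_pressure (s : R) : R :=
  u0n theta0 alpha0 s ^+ 2 - wrho s * ut s ^+ 2 * (cos theta0 / sin theta0) + p0.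

Let mass_flux_grad (psi : E3 -> R) : C1_sphere psi ->
  pairing_vec theta0 mass_flux (grad psi) =
  \int[@area R]_(x in Omega theta0) (\sum_(i < 3) u i x * pd i (hext psi) x) +
  \int[leb]_(s in `[0, L]) (wrho s * ut s * \sum_(i < 3) t s 0 i * pd i (hext psi) (c s)).
Proof.
move=> cpsi; rewrite (@pairing_vec_phase _ _ htheta0 wrho cwrho rho rhoI _ _ _ _ _
  (fun i x => pd i (hext psi) x)) //.
- congr (_ + _).
    by apply: eq_Rintegral_Omega => x _; apply: eq_bigr => i _; rewrite mulrC.
  apply: eq_Rintegral_circle => s; rewrite mulr_sumr; apply: eq_bigr => i _.
  by rewrite /b_u; ring.
- by move=> i; exact: (@C1_off0_derive _ _ (basis_vec i) cpsi).
- by move=> x i _; rewrite mxE.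
Qed.

Let mass_equation (psi : E3 -> R) : C1_sphere psi ->
  pairing_vec theta0 mass_flux (grad psi) = 2 * pairing theta0 radial_mass psi.
Proof.
move=> cpsi; rewrite mass_flux_grad//.
rewrite (mass_balance htheta0 cwrho cut cw pwrho put dmass cpsi).
rewrite (@pairing_phase _ _ htheta0 _ _ rhoI _ _ _ _ psi (hext psi)) //.
- congr (2 * (_ + _)).
    by apply: eq_Rintegral_Omega => x _; rewrite mulrC.
  by apply: eq_Rintegral_circle => s; ring.
- exact: C0_off0_hext.
- by move=> x Sx; rewrite hext_sphere.
Qed.

Let energy_equation (psi : E3 -> R) : C1_sphere psi ->
  pairing_vec theta0 energy_flux (grad psi) = 2 * pairing theta0 radial_energy psi.
Proof.
move=> cpsi.
transitivity (E0 * pairing_vec theta0 mass_flux (grad psi)).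
  rewrite mass_flux_grad// (@pairing_vec_phase _ _ htheta0 wrho cwrho rho rhoI _ _ _ _ _
    (fun i x => pd i (hext psi) x)).
  - rewrite mulrDr -Rintegral_OmegaZ; last exact: (@C0_off0_u0grad _ alpha0 (hext psi) cpsi).
    have cg := continuous_tangential_derivative htheta0 cpsi.
    rewrite -Rintegral_circleZ; last by contf.
    congr (_ + _).
      by apply: eq_Rintegral_Omega => x _; rewrite mulr_sumr; apply: eq_bigr => i _; ring.
    apply: eq_Rintegral_circle => s; rewrite mulr_sumr mulr_sumr; apply: eq_bigr => i _.
    by rewrite /b_u; ring.
  - by move=> i; rewrite bL_u.
  - by move=> i; exact: (@C1_off0_derive _ _ (basis_vec i) cpsi).
  - by move=> x i _; rewrite mxE.
rewrite mass_equation// mulrCA; congr (2 * _).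
rewrite !(@pairing_phase _ _ htheta0 _ _ rhoI _ _ _ _ psi (hext psi)).
- have ch : C0_off0 (hext psi) := C0_off0_hext cpsi.
  have chc : continuous (fun s => hext psi (c s)).
    exact: (@continuous_curve _ _ htheta0 _ ch).
  rewrite mulrDr -Rintegral_OmegaZ; last exact: C0_off0M ch ca_w.
  rewrite -Rintegral_circleZ; last by contf.
  congr (_ + _); first by apply: eq_Rintegral_Omega => x _; ring.
  by apply: eq_Rintegral_circle => s; ring.
- by rewrite pw.
- exact: C0_off0_hext.
- by move=> x Sx; rewrite hext_sphere.
- by rewrite pw.
- exact: C0_off0_hext.
- by move=> x Sx; rewrite hext_sphere.
Qed.

Let radial_equation (psi : E3 -> R) : C1_sphere psi ->
  pairing_vec theta0 radial_momentum_flux (grad psi) =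
  2 * pairing theta0 radial_momentum psi - pairing theta0 kinetic psi.
Proof.
move=> cpsi; rewrite (@pairing_vec_phase _ _ htheta0 wrho cwrho rho rhoI _ _ _ _ _
  (fun i x => pd i (hext psi) x)); last 3 first.
- by move=> i; rewrite bL_u pw.
- by move=> i; exact: (@C1_off0_derive _ _ (basis_vec i) cpsi).
- by move=> x i _; rewrite mxE.
have ch : C0_off0 (hext psi) := C0_off0_hext cpsi.
have hE x : sphere x -> psi x = hext psi x by move=> Sx; rewrite hext_sphere.
rewrite (@pairing_phase _ _ htheta0 _ _ rhoI _ _ _ _ psi (hext psi) _ ch hE); last by rewrite pw.
rewrite (@pairing_phase _ _ htheta0 _ _ rhoI _ _ _ _ psi (hext psi) _ ch hE); last by rewrite put.
transitivity (\int[@area R]_(x in Omega theta0) (W x * \sum_(i < 3) u i x * pd i (hext psi) x) +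
  \int[leb]_(s in `[0, L]) (wrho s * ut s * w s * \sum_(i < 3) t s 0 i * pd i (hext psi) (c s))).
  congr (_ + _).
    by apply: eq_Rintegral_Omega => x _; rewrite mulr_sumr; apply: eq_bigr => i _; ring.
  apply: eq_Rintegral_circle => s; rewrite mulr_sumr; apply: eq_bigr => i _.
  by rewrite /b_u; ring.
rewrite (radial_balance htheta0 cwrho cut cw pwrho put pw dradial cpsi).
congr (2 * (_ + _) - (_ + _)).
- by apply: eq_Rintegral_Omega => x _; ring.
- by apply: eq_Rintegral_circle => s; ring.
- by apply: eq_Rintegral_Omega => x _; rewrite mulrC.
- by apply: eq_Rintegral_circle => s; ring.
Qed.

(** On the sphere the covariant derivative of v along the coordinate vectors is the
ambient derivative of hext v minus a normal part, which disappears when contracted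
with the tangent tensors u0 (x) u0 and t (x) t. *)
Let tangential_equation (v : E3 -> E3) : C1_sphere v -> tangent_field v ->
  pairing_ten theta0 momentum_flux (Dcov v) + pairing theta0 pressure (sdiv v) =
  3 * pairing_vec theta0 radial_momentum_flux v +
  \int[leb]_(s in `[0, L]) (wall_pressure s * dot (n s) (v (c s))).
Proof.
move=> cv tv.
pose V i x := hext v x 0 i.
have cV i : C1_off0 (V i) by exact: C1_off0_mxcoord.
have cV0 i : C0_off0 (V i) by exact: (@C1_off0_C0 _ _ (cV i)).
have VE x i : sphere x -> v x 0 i = V i x by move=> Sx; rewrite /V hext_sphere.
have tV x : sphere x -> \sum_(i < 3) x 0 i * V i x = 0.
  move=> Sx; rewrite -[RHS](tv x Sx); apply: eq_bigr => i _; by rewrite VE.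
(* the matrix Dcov v, extended off the sphere *)
pose G i j x := pd i (V j) x - (\sum_(k < 3) x 0 k * pd i (V k) x) * x 0 j.
have cG i j : C0_off0 (G i j).
  apply: C0_off0B; first exact: (@C1_off0_derive _ _ (basis_vec i) (cV j)).
  apply: C0_off0M; last exact: C0_off0_coord.
  apply: C0_off0_sum => k; apply: C0_off0M; first exact: C0_off0_coord.
  exact: (@C1_off0_derive _ _ (basis_vec i) (cV k)).
have GE x i j : sphere x -> Dcov v x i j = G i j x.
  move=> /sphere_neq0 x0; rewrite mxE /covariant /tanproj !mxE.
  rewrite (derive_mxcoord _ _ cv x0) /G; congr (_ - _ * _).
  by apply: eq_bigr => k _; rewrite (derive_mxcoord _ _ cv x0).
have divE x : sphere x -> sdiv v x = surf_div V x.
  move=> Sx; rewrite /sdiv /mxtrace.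
  under eq_bigr => i _ do rewrite GE//.
  rewrite /G sumrB /surf_div; congr (_ - _); apply: eq_bigr => i _.
  by rewrite mulr_suml; apply: eq_bigr => k _; ring.
have GuE (x : E3) (y : 'I_3 -> R) : \sum_(j < 3) x 0 j * y j = 0 ->
    \sum_(i < 3) \sum_(j < 3) G i j x * (y i * y j) =
    \sum_(i < 3) \sum_(j < 3) y i * y j * pd i (V j) x.
  move=> xy; apply: eq_bigr => i _.
  transitivity (\sum_(j < 3) (y i * y j * pd i (V j) x) -
    (\sum_(k < 3) x 0 k * pd i (V k) x) * y i * \sum_(j < 3) x 0 j * y j).
    rewrite mulr_sumr -sumrB; apply: eq_bigr => j _; rewrite /G; ring.
  by rewrite xy mulr0 subr0.
have cdiv : C0_off0 (surf_div V) := C0_off0_surf_div cV.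
rewrite (@pairing_ten_phase _ _ htheta0 wrho cwrho rho rhoI _ _ _ _ _ G)//; last first.
  by move=> i j; rewrite !bL_u.
rewrite (@pairing_phase _ _ htheta0 _ _ (@area_Obar_integral _ _ htheta0) _ (fun=> p0) _ _ _ _ erefl cdiv divE).
rewrite (@pairing_vec_phase _ _ htheta0 wrho cwrho rho rhoI _ _ _ _ _ V)//; last first.
  by move=> i; rewrite bL_u pw.
have TB := tangential_balance htheta0 cwrho cut cw pwrho put p0 dtang cV tV.
rewrite (@eq_Rintegral_Omega _ _ _ (fun x => \sum_(i < 3) \sum_(j < 3) u i x * u j x * pd i (V j) x)); last first.
  move=> x Sx; exact: GuE (u0_tangent alpha0 Sx).
rewrite (@eq_Rintegral_circle _ _ _ (fun s => wrho s * ut s ^+ 2 *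
   \sum_(i < 3) \sum_(j < 3) t s 0 i * t s 0 j * pd i (V j) (c s))); last first.
  move=> s; rewrite -(GuE (c s) (fun i => t s 0 i)); last first.
    exact: (dot_tvec_curve theta0 s).
  rewrite mulr_sumr; apply: eq_bigr => i _; rewrite mulr_sumr; apply: eq_bigr => j _.
  by rewrite /b_u; ring.
rewrite [X in _ + (X + _) = _](@eq_Rintegral_Omega _ _ _ (fun x => p0 * surf_div V x)); last first.
  by move=> x _; rewrite mulrC.
rewrite (Rintegral_OmegaZ _ _ cdiv).
rewrite [X in _ + (_ + X) = _](_ : _ = 0); last first.
  by under eq_Rintegral do rewrite mul0r; rewrite Rintegral_cst// mul0r.
rewrite addr0 TB; congr (3 * (_ + _) + _).
- by apply: eq_Rintegral_Omega => x _; rewrite mulr_sumr; apply: eq_bigr => i _; ring.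
- by apply: eq_Rintegral_circle => s; rewrite mulr_sumr; apply: eq_bigr => i _; rewrite /b_u; ring.
- apply: eq_Rintegral_circle => s; congr (_ * _); apply: eq_bigr => i _.
  by rewrite VE//; exact: sphere_curve.
Qed.

Lemma weak_solution : weak_equations theta0 mass_flux radial_mass energy_flux
  radial_energy radial_momentum_flux radial_momentum momentum_flux kinetic
  pressure wall_pressure.
Proof.
split => [psi cpsi|v cv tv]; last exact: tangential_equation.
by split; [exact: mass_equation|exact: energy_equation|exact: radial_equation].
Qed.

Local Notation U := (fun x : T => \1_Om x *: u0 alpha0 x
  + \1_(Cbd theta0) x *: (ut (arc_param theta0 x) *: t (arc_param theta0 x))).
Local Notation Ew := (fun x : T => \1_Om x * W x + \1_(Cbd theta0) x * w (arc_param theta0 x)).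
Local Notation EE := (fun x : T => E0 * \1_Om x + E0 * \1_(Cbd theta0) x).

Let UE x i : U x 0 i = two_phase theta0 (fun x => u i x) (b_u i) x.
Proof.
rewrite /two_phase /b_u; move: (u0 alpha0 x) (t (arc_param theta0 x)) => a b.
by rewrite !mxE.
Qed.

Let EE_E x : EE x = two_phase theta0 (fun=> E0) (fun=> E0) x.
Proof. by rewrite /two_phase [E0 * \1_Om x]mulrC [E0 * \1_(Cbd theta0) x]mulrC. Qed.

Let U_tangent x : dot x (U x) = 0.
Proof.
rewrite /dot; under eq_bigr => i _ do rewrite UE.
have [[Ox|Cx]|nO] := pselect (Ob x).
- under eq_bigr => i _ do rewrite two_phase_Omega//.
  exact/u0_tangent/(Omega_sphere Ox).
- under eq_bigr => i _ do rewrite two_phase_Cbd//.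
  have [_ xE] := arc_paramP htheta0 Cx.
  transitivity (ut (arc_param theta0 x) * dot (c (arc_param theta0 x)) (t (arc_param theta0 x))).
    by rewrite xE /dot mulr_sumr; apply: eq_bigr => i _; rewrite /b_u; ring.
  by rewrite dot_tvec_curve mulr0.
- by under eq_bigr => i _ do rewrite two_phase_out// mulr0; rewrite big1.
Qed.

Let U_sq x : dot (U x) (U x) =
  two_phase theta0 (fun x => dot (u0 alpha0 x) (u0 alpha0 x)) (fun s => ut s * ut s) x.
Proof.
rewrite /dot; under eq_bigr => i _ do rewrite UE.
have [[Ox|Cx]|nO] := pselect (Ob x).
- by rewrite two_phase_Omega//; under eq_bigr => i _ do rewrite two_phase_Omega//.
- rewrite two_phase_Cbd//; under eq_bigr => i _ do rewrite two_phase_Cbd//.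
  set s := arc_param theta0 x; rewrite /b_u sum3E !row3E.
  have Q := cos2Dsin2 (azimuth theta0 s).
  transitivity (ut s * ut s * (cos (azimuth theta0 s) ^+ 2 + sin (azimuth theta0 s) ^+ 2)).
    by ring.
  by rewrite Q mulr1.
- rewrite two_phase_out//.
  by under eq_bigr => i _ do rewrite two_phase_out// mulr0; rewrite big1.
Qed.

(** The densities are the prescribed velocities and enthalpies themselves, and
[two_phase] functions multiply phase by phase. *)
Lemma densities_solution : densities rho U Ew EE mass_flux radial_mass energy_flux
  radial_energy radial_momentum_flux radial_momentum momentum_flux kinetic.
Proof.
have hma : {ae rho, forall x, forall i, Radon_Nikodym (mass_flux i) rho x =
    (two_phase theta0 (fun x => u i x) (b_u i) x)%:E}.
  by apply: filter_forall => i; exact: Radon_Nikodym_phase.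
have hme : {ae rho, forall x, forall i, Radon_Nikodym (energy_flux i) rho x =
    (two_phase theta0 (fun x => E0 * u i x) (fun s => E0 * b_u i s) x)%:E}.
  by apply: filter_forall => i; exact: Radon_Nikodym_phase.
have hmr : {ae rho, forall x, forall i, Radon_Nikodym (radial_momentum_flux i) rho x =
    (two_phase theta0 (fun x => W x * u i x) (fun s => w s * b_u i s) x)%:E}.
  by apply: filter_forall => i; exact: Radon_Nikodym_phase.
have hmt : {ae rho, forall x, forall i j, Radon_Nikodym (momentum_flux i j) rho x =
    (two_phase theta0 (fun x => u i x * u j x) (fun s => b_u i s * b_u j s) x)%:E}.
  by apply: filter_forall => i; apply: filter_forall => j; exact: Radon_Nikodym_phase.
have hna := @Radon_Nikodym_phase _ _ htheta0 rho _ _ ca_w cw.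
have hne := @Radon_Nikodym_phase _ _ htheta0 rho _ _ (@ca_E _ ca_w) (@cb_E _ cw).
have hnr := @Radon_Nikodym_phase _ _ htheta0 rho _ _
  (@C0_off0M _ _ _ ca_w ca_w) (@cbM _ _ cw cw).
have hnt := @Radon_Nikodym_phase _ _ htheta0 rho _ _ (@C0_off0_u0sq R alpha0) (@cbM _ _ cut cut).
have aeI (P Q : T -> Prop) : {ae rho, forall x, P x} -> {ae rho, forall x, Q x} ->
    {ae rho, forall x, P x /\ Q x}.
  by apply: filterS2 => x; split.
have all := aeI _ _ (aeI _ _ (aeI _ _ hma hme) (aeI _ _ hmr hmt))
  (aeI _ _ (aeI _ _ hna hne) (aeI _ _ hnr hnt)).
apply: filterS all => x [[[ma me] [mr mt]] [[na ne] [nr nt]]].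
split.
- exact: U_tangent.
- split; first exact: na.
    by move=> i; rewrite mr ma -EFinM -two_phaseM.
  by rewrite [LHS]nr [X in (_ * X)%E]na -EFinM -two_phaseM.
- split.
    by move=> i; rewrite me ma EE_E -EFinM two_phaseM.
  by rewrite [LHS]ne [X in (_ * X)%E]na EE_E -EFinM two_phaseM.
- split.
  + by move=> i; rewrite ma UE.
  + by rewrite [LHS]nt U_sq.
  + by move=> i j; rewrite mt -two_phaseM !UE.
Qed.

Lemma pressureE (A : set T) : measurable A -> pressure A = (p0%:E * area (A `&` Ob))%E.
Proof.
move=> mA; have mOb : measurable Ob := measurable_Obar theta0.
have pE x : (EFin \o two_phase theta0 (fun=> p0) (fun=> p0)) x = ((fun=> p0%:E) \_ Ob) x.
  rewrite patchE; case: ifPn => [/set_mem [Ox|Cx]|/negP nO] /=.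
  - by rewrite two_phase_Omega.
  - by rewrite two_phase_Cbd.
  - by rewrite two_phase_out// => Ox; apply: nO; exact/mem_set.
transitivity (\int[@area R]_(x in A) (EFin \o two_phase theta0 (fun=> p0) (fun=> p0)) x)%E.
  by [].
under eq_integral => x _ do rewrite pE.
by rewrite -integral_mkcondr integral_cst//; exact: measurableI.
Qed.

(** The pressure is a multiple of the area on Omega-bar; a set that is null for
varrho meets Omega in a set of area 0, and C has area 0. *)
Lemma dominated_solution :
  (forall A : set T, measurable A ->
     rho A = ((rho0 : R)%:E * area (A `&` Om) + delta_C theta0 wrho A)%E) ->
  (forall s, 0 <= wrho s) ->
  dominated rho mass_flux radial_mass energy_flux
  radial_energy radial_momentum_flux radial_momentum momentum_flux kinetic pressure.
Proof.
move=> rhoE w_ge0; split; first by move=> i; split; exact: phase_charge_dominated.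
split; first by move=> i j; exact: phase_charge_dominated.
split; do ?exact: phase_charge_dominated.
apply/null_content_dominatesP => A mA.
have mO : measurable Om := measurable_Omega theta0.
have mC : measurable (Cbd theta0 : set T) := measurable_Cbd theta0.
have mOb : measurable Ob := measurable_Obar theta0.
move=> rA; have : ((rho0 : R)%:E * area (A `&` Om) + delta_C theta0 wrho A)%E = 0%E.
  by rewrite -rhoE//; exact: rA.
rewrite mul1e => rA0.
have aO : area (A `&` Om) = 0%E.
  apply/eqP; rewrite eq_le measure_ge0 andbT -rA0 leeDl//.
  by apply: integral_ge0 => s _; rewrite lee_fin mulr_ge0.
have aC : area (A `&` Cbd theta0) = 0%E.
  apply/eqP; rewrite eq_le measure_ge0 andbT -(area_Cbd htheta0).
  by rewrite le_measure ?inE//; exact: measurableI.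
have aOb : area (A `&` Ob) = 0%E.
  apply/eqP; rewrite eq_le measure_ge0 andbT /Obar setIUr.
  have e0 : (area (A `&` Om) + area (A `&` Cbd theta0) = 0)%E by rewrite aO aC adde0.
  rewrite -[leRHS]e0; apply: measureU2; exact: measurableI.
by rewrite pressureE// aOb mule0.
Qed.

End Solution.

(** * The Radon measure solution *)

Theorem corollary3p2 (R : realType) (theta0 alpha0 E0 Minf : R)
    (htheta0 : 0 < theta0 < pi / 2) (hE0 : 1 / 2 <= E0) (hMinf : 0 < Minf)
    (wrho ut w : R -> R)
    (hwrhoC1 : C1_periodic (clen theta0) wrho)
    (hutC1 : C1_periodic (clen theta0) ut)
    (hwC1 : C1_periodic (clen theta0) w)
    (hwrho : forall s, 0 <= wrho s)
    (hmomt : forall s,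
      derive1 (fun s => wrho s * ut s ^+ 2) s + 3 * wrho s * ut s * w s =
        rho0 * dot (u0 alpha0 (curve theta0 s)) (nvec theta0 s)
             * dot (u0 alpha0 (curve theta0 s)) (tvec theta0 s))
    (hmomr : forall s,
      derive1 (fun s => wrho s * ut s * w s) s - wrho s * ut s ^+ 2
          + 2 * wrho s * w s ^+ 2 =
        rho0 * w0 alpha0 (curve theta0 s)
             * dot (u0 alpha0 (curve theta0 s)) (nvec theta0 s))
    (hmass : forall s,
      derive1 (fun s => wrho s * ut s) s + 2 * wrho s * w s =
        rho0 * dot (u0 alpha0 (curve theta0 s)) (nvec theta0 s)) :
  let denom := fun phi : R =>
    (cos alpha0 * sin theta0 - sin alpha0 * cos theta0 * cos phi) ^+ 2
      - wrho (arclength theta0 phi) * ut (arclength theta0 phi) ^+ 2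
        * (cos theta0 / sin theta0) in
  (forall phi, phi \in `[- pi, pi] -> 0 < denom phi) ->
  sup [set Num.sqrt (1 / denom phi) | phi in `[- pi, pi]] < Minf ->
  exists (rho : {finite_measure set (R3 R) -> \bar R})
         (wp : {charge set (R3 R) -> \bar R}),
    [/\ forall A : set (R3 R), measurable A ->
          rho A = ((rho0 : R)%:E * area (A `&` Omega theta0)
                   + delta_C theta0 wrho A)%E,
        forall A : set (R3 R), measurable A ->
          wp A = ((chaplygin Minf rho0)%:E * area (A `&` Obar theta0))%E &
        radon_measure_solution theta0 Minf E0 rho
          (fun x => \1_(Omega theta0) x *: u0 alpha0 x
                    + \1_(Cbd theta0) x *:
                        (ut (arc_param theta0 x) *: tvec theta0 (arc_param theta0 x)))
          (fun x => \1_(Omega theta0) x * w0 alpha0 x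
                    + \1_(Cbd theta0) x * w (arc_param theta0 x))
          (fun x => E0 * \1_(Omega theta0) x + E0 * \1_(Cbd theta0) x)
          wp].
Proof.
move=> denom denom_gt0 sup_lt.
have [perw dw cdw] := hwrhoC1; have [peru du cdu] := hutC1; have [perv dv cdv] := hwC1.
have derC (f : R -> R) : (forall s, derivable f s 1) -> continuous f.
  by move=> df s; apply/differentiable_continuous/derivable1_diffP.
have cwrho := derC _ dw; have cut := derC _ du; have cw := derC _ dv.
have perL (f : R -> R) : periodic f (clen theta0) -> f (clen theta0) = f 0.
  by move=> pf; rewrite -[in LHS](add0r (clen theta0)) pf.
have pwrho := perL _ perw; have put := perL _ peru; have pw := perL _ perv.
have isD (f : R -> R) : (forall s, derivable f s 1) ->
    forall s : R, is_derive s 1 f (derive1 f s).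
  by move=> df s; rewrite derive1E; exact: derivableP.
have dM (f g : R -> R) : (forall s, derivable f s 1) -> (forall s, derivable g s 1) ->
    forall s, derivable (fun s => f s * g s) s 1.
  by move=> df dg s; exact: derivableM.
have dmass (s : R) : is_derive s 1 (fun s => wrho s * ut s)
    (u0n theta0 alpha0 s - 2 * wrho s * w s).
  apply: (is_derive_congr (isD _ (dM _ _ dw du) s)).
  by have := hmass s; rewrite /rho0 mul1r -/(u0n theta0 alpha0 s) => <-; ring.
have dradial (s : R) : is_derive s 1 (fun s => wrho s * ut s * w s)
    (w0 alpha0 (curve theta0 s) * u0n theta0 alpha0 s + wrho s * ut s ^+ 2
     - 2 * wrho s * w s ^+ 2).
  apply: (is_derive_congr (isD _ (dM _ _ (dM _ _ dw du) dv) s)).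
  by have := hmomr s; rewrite /rho0 mul1r -/(u0n theta0 alpha0 s) => <-; ring.
have dtang (s : R) : is_derive s 1 (fun s => wrho s * ut s ^+ 2)
    (u0n theta0 alpha0 s * u0t theta0 alpha0 s - 3 * wrho s * ut s * w s).
  have d2 : forall s, derivable (fun s => wrho s * ut s ^+ 2) s 1.
    have -> : (fun s => wrho s * ut s ^+ 2) = (fun s => wrho s * (ut s * ut s)).
      by apply/funext => r; rewrite expr2.
    exact: dM _ _ dw (dM _ _ du du).
  apply: (is_derive_congr (isD _ d2 s)).
  have := hmomt s.
  by rewrite /rho0 mul1r -/(u0n theta0 alpha0 s) -/(u0t theta0 alpha0 s) => <-; ring.
have [rho [rhoE rhoI]] := layer_measure htheta0 cwrho hwrho.
exists rho, (pressure Minf htheta0); split => //.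
  by move=> A mA; exact: pressureE.
split; last split.
- have mOb : measurable (~` Obar theta0 : set (R3 R)).
    by apply: measurableC; exact: measurable_Obar.
  rewrite rhoE// [X in area X](_ : _ = set0); last first.
    by apply/seteqP; split => // x [nO Ox]; apply: nO; left.
  rewrite measure0 mule0 add0e /delta_C; apply: integral0_eq => s _.
  rewrite indicE memNset ?mulr0//= => nO; apply: nO; right; exact: Cbd_curve.
- exists (mass_flux alpha0 htheta0 cut rho), (radial_mass alpha0 htheta0 cw rho),
    (energy_flux alpha0 E0 htheta0 cut rho), (radial_energy alpha0 E0 htheta0 cw rho),
    (radial_momentum_flux alpha0 htheta0 cut cw rho),
    (radial_momentum alpha0 htheta0 cw rho), (momentum_flux alpha0 htheta0 cut rho),
    (kinetic alpha0 htheta0 cut rho), (wall_pressure theta0 alpha0 Minf wrho ut).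
  have cu0n := @continuous_u0n _ theta0 alpha0 htheta0.
  have cq : continuous (fun s => u0n theta0 alpha0 s ^+ 2
      - wrho s * ut s ^+ 2 * (cos theta0 / sin theta0)).
    by contf.
  have denomE phi : denom phi = u0n theta0 alpha0 (arclength theta0 phi) ^+ 2
      - wrho (arclength theta0 phi) * ut (arclength theta0 phi) ^+ 2
        * (cos theta0 / sin theta0).
    by rewrite /denom unE// azimuth_arclength.
  split.
  + split.
      apply: (wall_pressure_gt0 (theta0 := theta0) htheta0 hMinf cq).
        move=> s sL; rewrite -(arclength_azimuth htheta0 s) -denomE; apply: denom_gt0.
        have s0 := sin_theta0_gt0 htheta0.
        move: sL; rewrite !in_itv/= /azimuth => /andP[sa sb].
        rewrite -lerBlDr subrr divr_ge0 ?(ltW s0)//= lerBlDr ler_pdivrMr//.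
        by move: sb; rewrite /clen; lra.
      rewrite (_ : [set _ | _ in _] = [set Num.sqrt (1 / denom phi) | phi in `[- pi, pi]])//.
      by apply/seteqP; split => _ [phi phiI <-]; exists phi => //; rewrite denomE.
    have cWC : continuous (wall_pressure theta0 alpha0 Minf wrho ut).
      exact: (@continuous_addf _ _ _ _ cq (@continuous_cstf R R (chaplygin Minf rho0))).
    exact: (@continuous_integrable_circle _ theta0 _ cWC).
  + exact (weak_solution Minf E0 htheta0 cwrho cut cw pwrho put pw dmass dradial dtang rhoI).
  + exact: (dominated_solution _ _ _ _ _ _ rhoE hwrho).
  + exact: densities_solution.
(* domination of varrho by the area contradicts the presence of the layer *)
- move=> dom; exfalso; move: dom.
  apply: (@layer_not_dominated _ theta0 alpha0 htheta0 wrho ut w) => //.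
  by move=> s; rewrite hmass /rho0 mul1r.
Qed.
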